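(* There is an algorithm which, given as input a prime number $p$ and a non-constant polynomial $f(x)\in\mathbb{Z}[x]$ in one variable whose splitting field is $\mathbb{Q}$, outputs a rational function $R(T)\in\mathbb{Q}(T)$ such that $Z(s,f)=R(p^{-s})$ for all $s\in\mathbb{C}$ with $\operatorname{Re}(s)>0$ (so $R(p^{-s})$ is the meromorphic continuation of $Z(s,f)$). The number of arithmetic operations performed by the algorithm is $$O\bigl(d_f^6+d_f^9\log\|f\|+l_f^2d_f^3+d_f^2\log(\max\{B,p\})\bigr),$$ and the integers on which these operations are performed have binary length $$O\bigl(\max\{\log p,\ \log(l_f d_f),\ \log B,\ d_f^3+d_f^2\log\|f\|\}\bigr).$$
   Context: For a prime $p$, $v_p$ denotes the $p$-adic valuation on $\mathbb{Q}_p$ and $|x|_p=p^{-v_p(x)}$. For a non-constant $f\in\mathbb{Z}[x]$, Igusa's local zeta function is $Z(s,f)=\int_{\mathbb{Z}_p}|f(x)|_p^s\,|dx|$ for $\operatorname{Re}(s)>0$, where $|dx|$ is the Haar measure on $\mathbb{Q}_p$ normalized so that $\mathbb{Z}_p$ has measure $1$. Since the splitting field of $f$ is $\mathbb{Q}$, write $f(x)=\alpha_0\prod_{i=1}^r(x-\alpha_i)^{e_i}$ with $\alpha_0\in\mathbb{Q}^\times$, $\alpha_1,\dots,\alpha_r\in\mathbb{Q}$ pairwise distinct, $e_i\ge 1$. Let $d_f=\deg f$, and if $f=\sum_i a_ix^i$ put $\|f\|=\sqrt{\sum_i a_i^2}$. Define $l_f=1+\max\{v_p(\alpha_i-\alpha_j):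 i\neq j,\ 1\le i,j\le r\}$ if $r\ge2$ and $l_f=1$ if $r=1$. Define $B=\max\{|c_{j,i}|,|d_{j,i}| : 1\le i,j\le r,\ i\neq j\}$, where $\alpha_j-\alpha_i=c_{j,i}/d_{j,i}$ with $c_{j,i},d_{j,i}\in\mathbb{Z}\setminus\{0\}$. An arithmetic operation means an addition, subtraction, multiplication, division or comparison of integers. *)

(* Defs.v *)
From HB Require Import structures.
From mathcomp Require Import all_boot all_order all_algebra all_field.
From mathcomp Require Import complex.
From mathcomp Require Import all_classical all_reals all_analysis.
Import numFieldNormedType.Exports.

Set Implicit Arguments.
Unset Strict Implicit.
Unset Printing Implicit Defensive.

Import Order.TTheory GRing.Theory Num.Theory.
Local Open Scope ring_scope.

Notation "x %:F" := (@FracField.tofrac _ x) : ring_scope.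

(******************************************************************************)
(* The ring Z_p as the inverse limit of the rings Z/p^n: a p-adic integer is  *)
(* its sequence of residues, the n-th one being reduced modulo p^n.           *)
(******************************************************************************)

Record padic_int (p : nat) (p_pr : prime p) := PadicInt {
  residue : nat -> int;
  residueP : forall m n : nat,
    (m <= n)%N -> (residue n %% p%:Z ^+ m)%Z = residue m }.

Section PadicIntRing.

Variables (p : nat) (p_pr : prime p).
Local Notation Zp := (padic_int p_pr).
Implicit Types x y z : Zp.

HB.instance Definition _ := gen_eqMixin Zp.
HB.instance Definition _ := gen_choiceMixin Zp.

Lemma padic_int_eq x y : residue x =1 residue y -> x = y.
Proof.
case: x y => [x xP] [y yP] /= /funext exy; subst y.
by congr PadicInt; apply: Prop_irrelevance.
Qed.

Lemma residue_modz x n : (residue x n %% p%:Z ^+ n)%Z = residue x n.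
Proof. exact: residueP. Qed.

Fact reduce_subproof (u : nat -> int) :
  (forall m n : nat, (m <= n)%N -> (u n = u m %[mod p%:Z ^+ m])%Z) ->
  forall m n : nat, (m <= n)%N ->
    ((u n %% p%:Z ^+ n)%Z %% p%:Z ^+ m)%Z = (u m %% p%:Z ^+ m)%Z.
Proof.
move=> uP m n le_mn; rewrite -(uP _ _ le_mn).
rewrite [in RHS](divz_eq (u n) (p%:Z ^+ n)) -[in X in _ * X](subnK le_mn).
by rewrite exprD mulrA modzMDl.
Qed.

Definition reduce u uP : Zp := PadicInt p_pr (@reduce_subproof u uP).

Fact const_subproof (c : int) (m n : nat) :
  (m <= n)%N -> (c = c %[mod p%:Z ^+ m])%Z.
Proof. by []. Qed.

Fact opp_subproof x (m n : nat) :
  (m <= n)%N -> (- residue x n = - residue x m %[mod p%:Z ^+ m])%Z.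
Proof. by move=> le_mn; rewrite -modzNm (residueP x le_mn). Qed.

Fact add_subproof x y (m n : nat) : (m <= n)%N ->
  (residue x n + residue y n = residue x m + residue y m %[mod p%:Z ^+ m])%Z.
Proof. by move=> le_mn; rewrite -modzDm !residueP. Qed.

Fact mul_subproof x y (m n : nat) : (m <= n)%N ->
  (residue x n * residue y n = residue x m * residue y m %[mod p%:Z ^+ m])%Z.
Proof. by move=> le_mn; rewrite -modzMm !residueP. Qed.

Definition padic_int_const (c : int) : Zp := reduce (const_subproof c).
Definition padic_int_opp x : Zp := reduce (@opp_subproof x).
Definition padic_int_add x y : Zp := reduce (@add_subproof x y).
Definition padic_int_mul x y : Zp := reduce (@mul_subproof x y).

Fact padic_int_addA : associative padic_int_add.
Proof.
by move=> x y z; apply: padic_int_eq => n /=; rewrite modzDmr modzDml addrA.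
Qed.

Fact padic_int_addC : commutative padic_int_add.
Proof. by move=> x y; apply: padic_int_eq => n /=; rewrite addrC. Qed.

Fact padic_int_add0 : left_id (padic_int_const 0) padic_int_add.
Proof.
by move=> x; apply: padic_int_eq => n /=; rewrite mod0z add0r residue_modz.
Qed.

Fact padic_int_addN :
  left_inverse (padic_int_const 0) padic_int_opp padic_int_add.
Proof. by move=> x; apply: padic_int_eq => n /=; rewrite modzDml addNr. Qed.

HB.instance Definition _ := GRing.isZmodule.Build Zp
  padic_int_addA padic_int_addC padic_int_add0 padic_int_addN.

Fact padic_int_mulA : associative padic_int_mul.
Proof.
by move=> x y z; apply: padic_int_eq => n /=; rewrite modzMmr modzMml mulrA.
Qed.

Fact padic_int_mulC : commutative padic_int_mul.
Proof. by move=> x y; apply: padic_int_eq => n /=; rewrite mulrC. Qed.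

Fact padic_int_mul1 : left_id (padic_int_const 1) padic_int_mul.
Proof.
by move=> x; apply: padic_int_eq => n /=; rewrite modzMml mul1r residue_modz.
Qed.

Fact padic_int_mulDl : left_distributive padic_int_mul padic_int_add.
Proof.
by move=> x y z; apply: padic_int_eq => n /=; rewrite modzMml modzDm mulrDl.
Qed.

Fact padic_int_1neq0 : padic_int_const 1 != padic_int_const 0.
Proof.
apply/eqP => /(congr1 (fun x => residue x 1)) /=.
by rewrite expr1 mod0z modz_small // ltz_nat prime_gt1.
Qed.

HB.instance Definition _ := GRing.Zmodule_isComNzRing.Build Zp
  padic_int_mulA padic_int_mulC padic_int_mul1 padic_int_mulDl padic_int_1neq0.

Definition padic_int_unit : {pred Zp} := fun x => `[< exists y, y * x = 1 >].
Definition padic_int_inv x : Zp :=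
  if pselect (exists y, y * x = 1) is left xV then projT1 (cid xV) else x.

Fact padic_int_mulV : {in padic_int_unit, left_inverse 1 padic_int_inv *%R}.
Proof.
move=> x; rewrite unfold_in => /asboolP xV; rewrite /padic_int_inv.
by case: pselect => // xV'; case: cid.
Qed.

Fact padic_int_unitPl x y : y * x = 1 -> padic_int_unit x.
Proof. by move=> yx1; apply/asboolP; exists y. Qed.

Fact padic_int_inv_out : {in [predC padic_int_unit], padic_int_inv =1 id}.
Proof.
move=> x; rewrite inE unfold_in => /asboolPn xNV; rewrite /padic_int_inv.
by case: pselect.
Qed.

HB.instance Definition _ := GRing.ComNzRing_hasMulInverse.Build Zp
  padic_int_mulV padic_int_unitPl padic_int_inv_out.

Lemma padic_int_neq0 x : x != 0 -> exists n, residue x n != 0.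
Proof.
move=> /eqP x0; apply: contrapT => /forallNP xn0; apply: x0.
apply: padic_int_eq => n /=; rewrite mod0z; apply/eqP/negPn/negP.
exact: xn0.
Qed.

Fact padic_int_integral : GRing.integral_domain_axiom Zp.
Proof.
move=> x y xy0; apply/norP => -[/padic_int_neq0[m xm] /padic_int_neq0[n yn]].
have /(congr1 (fun z => residue z (m + n))) /= := xy0.
rewrite mod0z => /dvdz_mod0P.
set a := residue x _; set b := residue y _.
have aP : ~~ (p ^ m %| `|a|)%N.
  apply: contra xm => pma; rewrite -(residueP x (leq_addr n m)) -/a.
  by apply/eqP/dvdz_mod0P; rewrite dvdzE abszX.
have bP : ~~ (p ^ n %| `|b|)%N.
  apply: contra yn => pnb; rewrite -(residueP y (leq_addl m n)) -/b.
  by apply/eqP/dvdz_mod0P; rewrite dvdzE abszX.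
have a0 : (0 < `|a|)%N by case: posnP aP => // ->; rewrite dvdn0.
have b0 : (0 < `|b|)%N by case: posnP bP => // ->; rewrite dvdn0.
rewrite dvdzE abszX abszM pfactor_dvdn ?muln_gt0 ?a0 ?b0 // lognM //.
move: aP bP; rewrite !pfactor_dvdn // -!ltnNge => aP bP.
by rewrite leqNgt -addSn leq_add // ltnW.
Qed.

HB.instance Definition _ :=
  GRing.ComUnitRing_isIntegral.Build Zp padic_int_integral.

End PadicIntRing.

Definition padic (p : nat) (p_pr : prime p) := {fraction (padic_int p_pr)}.

Section Padic.

Variables (p : nat) (p_pr : prime p).
Local Notation Zp := (padic_int p_pr).
Local Notation Qp := (padic p_pr).

HB.instance Definition _ := GRing.Field.on Qp.
HB.instance Definition _ := isPointed.Build Qp 0.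

Definition padic_integers : set Qp := range (fun z : Zp => z%:F : Qp).

(* The largest n such that p^n divides x, and 0 (a junk value) if x = 0. *)
Definition padic_int_val (x : Zp) : nat :=
  if pselect (exists n, residue x n.+1 != 0) is left xn then ex_minn xn else 0%N.

Definition padic_val (x : Qp) : int :=
  (padic_int_val (repr x).1)%:Z - (padic_int_val (repr x).2)%:Z.

Definition padic_abs (R : realType) (x : Qp) : R :=
  if x == 0 then 0 else p%:R ^ (- padic_val x).

(* The cosets x + p^n Z_p are the closed balls of radius p^-n for |.|_p. *)
Definition padic_open (U : set Qp) :=
  forall x, U x -> exists n : nat, forall z : Zp, U (x + p%:R ^+ n * z%:F).

Definition padic_borel := g_sigma_algebraType padic_open.

Definition normalized_haar (R : realType)
    (mu : {measure set padic_borel -> \bar R}) :=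
  (forall (a : Qp) (A : set padic_borel), measurable A ->
    mu [set (x : Qp) + a | x in A]%classic = mu A) /\
  mu padic_integers = 1%E.

End Padic.

Arguments padic_integers {p} p_pr _.

Section IgusaZeta.

Variable R : realType.

(* a^s for a >= 0; it is exp (s log a) if a > 0, and 0 if a = 0. *)
Definition cpow (a : R) (s : R[i]) : R[i] :=
  if a == 0 then 0 else
  (expR (complex.Re s * ln a))%:C%C *
    (cos (complex.Im s * ln a) +i* sin (complex.Im s * ln a))%C.

Definition cintegral d (T : measurableType d) (mu : {measure set T -> \bar R})
    (D : set T) (g : T -> R[i]) : R[i] :=
  (Rintegral mu D (fun x => complex.Re (g x)) +i*
   Rintegral mu D (fun x => complex.Im (g x)))%C.

Definition igusa_zeta (p : nat) (p_pr : prime p)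
    (mu : {measure set padic_borel p_pr -> \bar R})
    (f : {poly int}) (s : R[i]) : R[i] :=
  cintegral mu (padic_integers p_pr)
    (fun x : padic p_pr => cpow (padic_abs R (map_poly intr f).[x]) s).

(* F has no pole at z, and F(z) = w. *)
Definition ratfun_eval (F : {fraction {poly rat}}) (z w : R[i]) :=
  exists n d : {poly rat},
    [/\ F = n%:F / d%:F, (map_poly ratr d).[z] != 0 &
        w = (map_poly ratr n).[z] / (map_poly ratr d).[z]].

Definition poly_norm (f : {poly int}) : R :=
  Num.sqrt (\sum_(i < size f) (f`_i)%:~R ^+ 2).

End IgusaZeta.

Definition root_factorization (f : {poly int}) (alpha0 : rat) (r : nat)
    (alpha : 'I_r -> rat) (e : 'I_r -> nat) :=
  [/\ alpha0 != 0, injective alpha, forall i, (0 < e i)%N &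
      map_poly intr f = alpha0 *: \prod_(i < r) ('X - (alpha i)%:P) ^+ e i].

(* 1 plus the maximum of the list s of valuations; s is empty if r = 1, and   *)
(* then the value is 1.                                                       *)
Definition root_level (p : nat) (p_pr : prime p) (r : nat)
    (alpha : 'I_r -> rat) : int :=
  let s := [seq padic_val (ratr (alpha ij.1 - alpha ij.2) : padic p_pr)
           | ij <- enum {: 'I_r * 'I_r} & ij.1 != ij.2] in
  1 + foldr Num.max (head 0 s) s.

Definition is_difference_fraction (r : nat) (alpha : 'I_r -> rat)
    (c d : 'I_r -> 'I_r -> int) :=
  forall i j, i != j ->
    [/\ c j i != 0, d j i != 0 &
        alpha j - alpha i = (c j i)%:~R / (d j i)%:~R].

Definition difference_bound (r : nat) (c d : 'I_r -> 'I_r -> int) : nat :=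
  \max_(i < r) \max_(j < r | i != j) maxn `|c j i| `|d j i|.

(* The number of binary digits of |n|; it is 1 for n = 0. *)
Definition bit_length (n : int) : nat := (trunc_log 2 `|n|).+1.

(******************************************************************************)
(* The model of computation: while-programs over integer variables and        *)
(* integer-indexed arrays of integers (an integer random-access machine).     *)
(* The trace of an execution lists, in order, the pairs of operands of the    *)
(* arithmetic operations performed; the tests of conditionals and loops are   *)
(* the comparisons. Copies and array accesses are not arithmetic operations;  *)
(* as every loop iteration performs a comparison, counting them too would     *)
(* change running times by at most a constant factor (and additive constant)  *)
(* that depends on the program only.                                          *)
(******************************************************************************)

Inductive arith_op := Add | Sub | Mul | Div.
Inductive cmp_op := Eq | Lt | Le.
Inductive atom := Const of int | Var of nat.

Inductive program :=
  | Skip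
  | Assign (x : nat) (u : atom)                   (* x := u *)
  | Arith (x : nat) (o : arith_op) (u v : atom)   (* x := u o v *)
  | Read (x a : nat) (u : atom)                   (* x := a[u] *)
  | Write (a : nat) (u v : atom)                  (* a[u] := v *)
  | Seq (P Q : program)
  | If (o : cmp_op) (u v : atom) (P Q : program)
  | While (o : cmp_op) (u v : atom) (P : program).

Record state := State { var : nat -> int; arr : nat -> int -> int }.

Definition arith_sem (o : arith_op) (m n : int) : int :=
  match o with
  | Add => m + n
  | Sub => m - n
  | Mul => m * n
  | Div => (m %/ n)%Z
  end.

Definition cmp_sem (o : cmp_op) (m n : int) : bool :=
  match o with Eq => m == n | Lt => m < n | Le => m <= n end.

Definition atom_sem (s : state) (u : atom) : int :=
  match u with Const c => c | Var x => var s x end.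

Definition set_var (s : state) (x : nat) (v : int) : state :=
  State (fun y => if y == x then v else var s y) (arr s).

Definition set_arr (s : state) (a : nat) (i v : int) : state :=
  State (var s)
    (fun b j => if (b == a) && (j == i) then v else arr s b j).

Definition trace := seq (int * int).

Inductive exec : program -> state -> trace -> state -> Prop :=
  | ExecSkip s : exec Skip s [::] s
  | ExecAssign s x u : exec (Assign x u) s [::] (set_var s x (atom_sem s u))
  | ExecArith s x o u v :
      exec (Arith x o u v) s [:: (atom_sem s u, atom_sem s v)]
        (set_var s x (arith_sem o (atom_sem s u) (atom_sem s v)))
  | ExecRead s x a u :
      exec (Read x a u) s [::] (set_var s x (arr s a (atom_sem s u)))
  | ExecWrite s a u v :
      exec (Write a u v) s [::] (set_arr s a (atom_sem s u) (atom_sem s v))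
  | ExecSeq P Q s1 t1 s2 t2 s3 :
      exec P s1 t1 s2 -> exec Q s2 t2 s3 -> exec (Seq P Q) s1 (t1 ++ t2) s3
  | ExecIfTrue o u v P Q s t s' :
      cmp_sem o (atom_sem s u) (atom_sem s v) -> exec P s t s' ->
      exec (If o u v P Q) s ((atom_sem s u, atom_sem s v) :: t) s'
  | ExecIfFalse o u v P Q s t s' :
      ~~ cmp_sem o (atom_sem s u) (atom_sem s v) -> exec Q s t s' ->
      exec (If o u v P Q) s ((atom_sem s u, atom_sem s v) :: t) s'
  | ExecWhileTrue o u v P s1 t1 s2 t2 s3 :
      cmp_sem o (atom_sem s1 u) (atom_sem s1 v) ->
      exec P s1 t1 s2 -> exec (While o u v P) s2 t2 s3 ->
      exec (While o u v P) s1 ((atom_sem s1 u, atom_sem s1 v) :: t1 ++ t2) s3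
  | ExecWhileFalse o u v P s :
      ~~ cmp_sem o (atom_sem s u) (atom_sem s v) ->
      exec (While o u v P) s [:: (atom_sem s u, atom_sem s v)] s.

(* Input: variable 0 holds p, variable 1 holds deg f, and cell i of array 0   *)
(* holds the coefficient of degree i of f; everything else is 0.              *)
Definition input_state (p : nat) (f : {poly int}) : state :=
  State (fun x => [:: p%:Z; (size f).-1%:Z]`_x)
    (fun a i => if (a, i) is (0%N, Posz k) then f`_k else 0).

(******************************************************************************)
(* A rational function is output as an explicit arithmetic expression in      *)
(* postfix notation, that is, a list of tokens (tag, v): tag 0 is the integer *)
(* constant v, tag 1 is the monomial T^v, and tags 2, 3, 4, 5 are addition,   *)
(* subtraction, multiplication and division. Variable 0 holds the number of   *)
(* tokens; token k has its tag in cell k of array 0 and v in cell k of        *)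
(* array 1. A division by 0 makes the expression ill-formed.                  *)
(******************************************************************************)

Definition token_sem (st : option (seq {fraction {poly rat}}))
    (tok : int * int) : option (seq {fraction {poly rat}}) :=
  match st, tok with
  | Some st, (Posz 0, v) => Some (v%:~R :: st)
  | Some st, (Posz 1, v) => Some (('X%:F) ^ v :: st)
  | Some [:: G, F & st], (Posz 2, _) => Some (F + G :: st)
  | Some [:: G, F & st], (Posz 3, _) => Some (F - G :: st)
  | Some [:: G, F & st], (Posz 4, _) => Some (F * G :: st)
  | Some [:: G, F & st], (Posz 5, _) =>
      if G == 0 then None else Some (F / G :: st)
  | _, _ => None
  end.

Definition postfix_sem (toks : seq (int * int)) : option {fraction {poly rat}} :=
  if foldl token_sem (Some [::]) toks is Some [:: F] then Some F else None.

Definition output (s : state) : option {fraction {poly rat}} :=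
  if var s 0 is Posz n
  then postfix_sem [seq (arr s 0%N k%:Z, arr s 1%N k%:Z) | k <- iota 0 n]
  else None.

(* Main.v *)
(* Put a = lead_coef f and d = deg f. The polynomial a^(d-1) f(X/a) is monic
   with integer coefficients, so its roots y_1, ..., y_d are integers. As they
   are real, Newton's method started above the largest root decreases to it,
   and each step divides the distance to it by at least 1 + 1/(d-1); after
   rounding to integers O(d log ||f||) steps reach the root, which is then
   divided out. No factorization algorithm is needed.

   For x in Z_p and n in N let w_n(x) be the sum over m = 1, ..., n of
   #{j : p^m divides ax - y_j}, plus 1 - d if p^m divides a. If f(x) <> 0, then
   w_n(x) is eventually the valuation of f(x); otherwise it tends to infinity.
   Hence, with t = p^-s, dominated convergence gives
   Z(s, f) = lim_n p^-n sum_(c < p^n) t^(w_n(c)).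
   If p^v is the p-part of a, the value of the sum for n = v is
   t^(w_v(0)), and from n to n+1 it changes only on the residue classes that
   contain a root; each of them is represented by the first root in it. Once
   p^n exceeds all differences of the roots the classes no longer split, and the
   remaining terms form geometric series. *)
Require Import Defs.
From HB Require Import structures.
From mathcomp Require Import all_boot all_order all_algebra all_field.
From mathcomp Require Import complex.
From mathcomp Require Import all_classical all_reals all_analysis.
From mathcomp Require Import generic_quotient fraction measurable_realfun.
From mathcomp Require Import zify ring lra.
Import numFieldNormedType.Exports.
Import Order.TTheory GRing.Theory Num.Theory.
Local Open Scope ring_scope.

Set Implicit Arguments.
Unset Strict Implicit.
Unset Printing Implicit Defensive.

(** * While-programs with bounded cost *)

(** The summand 1 - d in w_n offsets the scaling: a^(d-1) f(x) = prod (ax - y_j), whose valuation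
    exceeds that of f(x) by (d-1) v_p(a). Weights can therefore be negative; they are integer
    exponents of t, and domination rests on w_n >= -(d-1) v_p(a). All size bounds come from S =
    ||f||^2: a and the y_j are at most 2S in absolute value, so a product of factors X - y_j has
    coefficients at most (2S+1)^d, whichever roots have been divided out, and the operands of
    Newton's method have O(d (1 + log S)) bits. One root takes O(d (1 + log S)) steps of O(d)
    operations, so the whole cost is O(d^3 (1 + log ||f||)), which is O(d^6 + d^9 log ||f||). The
    result is one expression over an arbitrary field, read in Q(T) by the program and in C by the
    integral. The means over residues differ from it by an exact remainder, so that analysis enters
    only through dominated convergence and the vanishing of that remainder. *)

Definition runs (H N : nat) (P : program) (s : state) (Q : state -> Prop) :=
  exists t s', [/\ exec P s t s', (size t <= N)%N,
    all (fun mn : int * int => (`|mn.1| <= H)%N && (`|mn.2| <= H)%N) t & Q s'].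

Lemma runs_weaken H N N' P s (Q Q' : state -> Prop) :
  (N <= N')%N -> (forall s', Q s' -> Q' s') ->
  runs H N P s Q -> runs H N' P s Q'.
Proof.
move=> NN' QQ' [t [s' [e lt bt q]]]; exists t, s'; split=> //.
  exact: leq_trans NN'.
exact: QQ'.
Qed.

Lemma runs_leq H N N' P s (Q : state -> Prop) :
  (N <= N')%N -> runs H N P s Q -> runs H N' P s Q.
Proof. by move=> NN'; apply: runs_weaken. Qed.

Lemma runs_skip H s (Q : state -> Prop) : Q s -> runs H 0 Skip s Q.
Proof. by move=> q; exists [::], s; split=> //; constructor. Qed.

(** The postcondition of the first program is that the second one runs to [Q]. In this continuation
    form a block is executed symbolically from left to right, and the goal records the operations
    still allowed. *)
Lemma runs_seq H N1 N2 P1 P2 s Q :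
  runs H N1 P1 s (fun s1 => runs H N2 P2 s1 Q) ->
  runs H (N1 + N2) (Seq P1 P2) s Q.
Proof.
move=> [t1 [s1 [e1 l1 b1 [t2 [s2 [e2 l2 b2 q]]]]]].
exists (t1 ++ t2), s2; split=> //; first exact: ExecSeq e1 e2.
  by rewrite size_cat leq_add.
by rewrite all_cat b1.
Qed.

Lemma runs_if H N o u v P1 P2 s Q :
  (`|atom_sem s u| <= H)%N -> (`|atom_sem s v| <= H)%N ->
  (if cmp_sem o (atom_sem s u) (atom_sem s v) then runs H N P1 s Q
   else runs H N P2 s Q) ->
  runs H N.+1 (If o u v P1 P2) s Q.
Proof.
move=> su sv; case: ifP => c [t [s' [e l b q]]];
  exists ((atom_sem s u, atom_sem s v) :: t), s'; split=> //=.
- exact: ExecIfTrue.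
- by rewrite su sv.
- by apply: ExecIfFalse; rewrite ?c.
- by rewrite su sv.
Qed.

(** The index [n] of the invariant bounds the passes still to come, so termination and cost are
    proved together: a pass costs its body and one test, and one last test fails. *)
Lemma runs_while H N o u v P (I : nat -> state -> Prop) (Q : state -> Prop) :
  (forall n s, I n s ->
     [/\ (`|atom_sem s u| <= H)%N, (`|atom_sem s v| <= H)%N &
         if cmp_sem o (atom_sem s u) (atom_sem s v)
         then (0 < n)%N /\ runs H N P s (I n.-1) else Q s]) ->
  forall n s, I n s -> runs H (n * N.+1).+1 (While o u v P) s Q.
Proof.
move=> step; elim=> [|n IHn] s /step[su sv]; case: ifP => c.
- by case.
- move=> q; exists [:: (atom_sem s u, atom_sem s v)], s; split=> //=.
    by apply: ExecWhileFalse; rewrite c.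
  by rewrite su sv.
- move=> [_ [t1 [s1 [e1 l1 b1 /IHn[t2 [s2 [e2 l2 b2 q]]]]]]].
  exists ((atom_sem s u, atom_sem s v) :: t1 ++ t2), s2; split=> //=.
  + exact: ExecWhileTrue e1 e2.
  + by rewrite size_cat mulSn; lia.
  + by rewrite su sv all_cat b1.
- move=> q; exists [:: (atom_sem s u, atom_sem s v)], s; split=> //=.
    by apply: ExecWhileFalse; rewrite c.
  by rewrite su sv.
Qed.

Definition block : seq program -> program := foldr Seq Skip.
Arguments block : simpl never.

Lemma runs_nil H s (Q : state -> Prop) : Q s -> runs H 0 (block [::]) s Q.
Proof. exact: runs_skip. Qed.

Lemma runs_cons H N1 N2 P Ps s Q :
  runs H N1 P s (fun s1 => runs H N2 (block Ps) s1 Q) ->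
  runs H (N1 + N2) (block (P :: Ps)) s Q.
Proof. exact: runs_seq. Qed.

Lemma runs_then H N1 N2 P Ps s (Q1 Q : state -> Prop) :
  runs H N1 P s Q1 -> (forall s1, Q1 s1 -> runs H N2 (block Ps) s1 Q) ->
  runs H (N1 + N2) (block (P :: Ps)) s Q.
Proof. by move=> r1 r2; apply: runs_cons; apply: runs_weaken r1. Qed.

Lemma runs_arith H N x o u v Ps s Q :
  (`|atom_sem s u| <= H)%N -> (`|atom_sem s v| <= H)%N ->
  runs H N (block Ps)
    (set_var s x (arith_sem o (atom_sem s u) (atom_sem s v))) Q ->
  runs H N.+1 (block (Arith x o u v :: Ps)) s Q.
Proof.
move=> su sv r; rewrite -add1n; apply: runs_cons.
exists [:: (atom_sem s u, atom_sem s v)]; eexists; split=> //=.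
- exact: ExecArith.
- by rewrite su sv.
- exact: r.
Qed.

Lemma runs_assign H N x u Ps s Q :
  runs H N (block Ps) (set_var s x (atom_sem s u)) Q ->
  runs H N (block (Assign x u :: Ps)) s Q.
Proof.
move=> r; rewrite -[N]add0n; apply: runs_cons.
by exists [::]; eexists; split=> //=; [exact: ExecAssign|exact: r].
Qed.

Lemma runs_read H N x a u Ps s Q :
  runs H N (block Ps) (set_var s x (arr s a (atom_sem s u))) Q ->
  runs H N (block (Read x a u :: Ps)) s Q.
Proof.
move=> r; rewrite -[N]add0n; apply: runs_cons.
by exists [::]; eexists; split=> //=; [exact: ExecRead|exact: r].
Qed.

Lemma runs_write H N a u v Ps s Q :
  runs H N (block Ps) (set_arr s a (atom_sem s u) (atom_sem s v)) Q ->
  runs H N (block (Write a u v :: Ps)) s Q.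
Proof.
move=> r; rewrite -[N]add0n; apply: runs_cons.
by exists [::]; eexists; split=> //=; [exact: ExecWrite|exact: r].
Qed.

(** Register 0 holds p on input and the number of tokens on output, so the setup moves p to [vp] and
    then uses [vN] as the token counter; [vd] is already in place. *)
Notation vN := 0%N (only parsing).
Notation vd := 1%N (only parsing).
Notation vp := 2%N (only parsing).
Notation va := 3%N (only parsing).
Notation vU := 4%N (only parsing).
Notation vj := 5%N (only parsing).
Notation vu := 6%N (only parsing).
Notation vt := 7%N (only parsing).
Notation vpw := 8%N (only parsing).
Notation vlo := 9%N (only parsing).
Notation vx := 10%N (only parsing).
Notation vb := 11%N (only parsing).
Notation vc := 12%N (only parsing).
Notation vP := 13%N (only parsing).
Notation vE := 14%N (only parsing).
Notation vk := 15%N (only parsing).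
Notation vM := 16%N (only parsing).
Notation vi := 17%N (only parsing).
Notation vy := 18%N (only parsing).
Notation vq := 19%N (only parsing).
Notation vw := 20%N (only parsing).
Notation vr := 21%N (only parsing).
Notation vz := 22%N (only parsing).

Coercion Var : nat >-> atom.
Notation "# c" := (Const c%R) (at level 8, format "# c").

(** Only scalar registers are framed; array contents are tracked by separate equations. *)
Definition frame (V : seq nat) (s s' : state) :=
  forall x, x \notin V -> var s' x = var s x.

Lemma frame_refl V s : frame V s s. Proof. by []. Qed.

Lemma frame_set V s s' x v :
  x \in V -> frame V s s' -> frame V s (set_var s' x v).
Proof.
by move=> xV fr y yV /=; case: eqP yV => [->|_ /fr//]; rewrite xV.
Qed.

Lemma frame_set_arr V s s' a i v :
  frame V s s' -> frame V s (set_arr s' a i v).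
Proof. by []. Qed.

Lemma frame_trans V s1 s2 s3 : frame V s1 s2 -> frame V s2 s3 -> frame V s1 s3.
Proof. by move=> f12 f23 x xV; rewrite f23 // f12. Qed.

Lemma frame_sub V V' s s' :
  {subset V <= V'} -> frame V s s' -> frame V' s s'.
Proof. by move=> VV' f x xV; rewrite f //; apply: contra xV => /VV'. Qed.

Ltac frame_tac :=
  lazymatch goal with
  | |- frame _ _ (set_var _ _ _) => refine (@frame_set _ _ _ _ _ _ _); [by []|frame_tac]
  | |- frame _ _ (set_arr _ _ _ _) => refine (@frame_set_arr _ _ _ _ _ _ _); frame_tac
  | _ => first [assumption | exact: frame_refl]
  end.

(* Array 2 holds the coefficients of the polynomial whose roots are still to be
   found, from cell vlo on; array 3 receives the roots. *)
Definition horner_prog := block [::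
  Assign vb #0; Assign vc #0; Arith vj Add vd #1;
  While Lt vlo vj (block [::
    Arith vj Defs.Sub vj #1; Read vu 2 vj;
    Arith vc Mul vc vx; Arith vc Add vc vb;
    Arith vb Mul vb vx; Arith vb Add vb vu])].

(** * Simultaneous Horner evaluation of a polynomial and its derivative *)

Lemma drop_polyS (m : nat) (G : {poly int}) :
  drop_poly m G = drop_poly m.+1 G * 'X + (G`_m)%:P.
Proof.
apply/polyP => -[|i]; rewrite !(coefD, coefMX, coefC, coef_drop_poly) /=.
  by rewrite add0r add0n.
by rewrite addr0 addnS addSn.
Qed.

(** Once the cells from [m] on are read, the two accumulators of Horner's rule hold the values of
    [drop_poly m G] and of its derivative; this recurrence and the next one are a pass of the
    loop. *)
Lemma horner_dropS m (G : {poly int}) x :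
  (drop_poly m G).[x] = (drop_poly m.+1 G).[x] * x + G`_m.
Proof. by rewrite drop_polyS hornerMXaddC. Qed.

Lemma horner_deriv_dropS m (G : {poly int}) x :
  (drop_poly m G)^`().[x] =
  (drop_poly m.+1 G)^`().[x] * x + (drop_poly m.+1 G).[x].
Proof.
by rewrite drop_polyS derivD derivC addr0 derivM derivX mulr1 hornerD hornerMX.
Qed.

(** A pass multiplies by x and adds at most A Z, where Z = X.+1 ^ k. As A Z X + A Z = A X.+1 ^ k.+1,
    the successor in [X.+1] pays for the addition. *)
Lemma horner_drop_bound (A X n : nat) (G : {poly int}) (x : int) :
  (size G <= n)%N -> (`|x| <= X)%N -> (forall i, (`|(G`_i)%R| <= A)%N) ->
  forall m k, (m + k = n)%N ->
    (`|(drop_poly m G).[x]| <= A * X.+1 ^ k)%N /\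
    (`|(drop_poly m G)^`().[x]| <= A * X.+1 ^ k)%N.
Proof.
move=> sG xX GA m k; elim: k m => [|k IHk] m mk.
  have -> : drop_poly m G = 0 by apply: drop_poly_eq0; lia.
  by rewrite derivC horner0; lia.
have [b c] := IHk m.+1 ltac:(lia).
rewrite horner_dropS horner_deriv_dropS expnS.
have := GA m; set B := (_.[x]) in b *; set D := (_.[x]) in c *.
set g := G`_m => gA.
have := expn_gt0 X.+1 k; set Z := (X.+1 ^ k)%N in b c * => /= Z0.
have bx : (`|(B * x)%R| <= A * Z * X)%N by rewrite abszM leq_mul.
have cx : (`|(D * x)%R| <= A * Z * X)%N by rewrite abszM leq_mul.
have AZ : (A <= A * Z)%N by rewrite leq_pmulr.
by split; lia.
Qed.

Lemma runs_horner (H A X d lo : nat) (G : {poly int}) (x : int) s :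
  (lo <= d)%N -> (size G <= (d - lo).+1)%N ->
  (forall i, (`|(G`_i)%R| <= A)%N) -> (`|x| <= X)%N ->
  (A * X.+1 ^ d.+1 <= H)%N -> (X <= H)%N -> (d < H)%N ->
  var s vd = d -> var s vlo = lo -> var s vx = x ->
  (forall i, (i <= d - lo)%N -> arr s 2 (lo + i)%N = G`_i) ->
  runs H (d.+1 * 6 + 2) horner_prog s (fun s' =>
    [/\ frame [:: vj; vu; vb; vc] s s', arr s' = arr s,
        var s' vb = G.[x] & var s' vc = G^`().[x]]).
Proof.
move=> lod sG GA xX AH XH dH sd slo sx cells.
do 2!eapply runs_assign => /=.
rewrite addn2; eapply runs_arith => /=; rewrite ?sd //=; try lia.
pose I (n : nat) (s' : state) :=
  [/\ (n <= (d - lo).+1)%N /\ var s' vj = (lo + n)%N,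
      frame [:: vj; vu; vb; vc] s s', arr s' = arr s,
      var s' vb = (drop_poly n G).[x] & var s' vc = (drop_poly n G)^`().[x]].
rewrite -[(_ * 6).+1]addn0.
apply: (runs_then (Q1 := I 0%N)); last first.
  move=> s1 [[_ s1j] fr ar b c]; apply: runs_nil; split=> //.
    by rewrite b drop_poly0l.
  by rewrite c drop_poly0l.
apply: (@runs_weaken _ ((d - lo).+1 * 6).+1 _ _ _ (I 0%N)) => //.
  by rewrite ltnS leq_mul2r; lia.
apply: (@runs_while _ 5 _ _ _ _ I).
  move=> n s1 [[nd s1j] fr ar b c].
  have s1lo : var s1 vlo = lo by rewrite fr.
  have s1x : var s1 vx = x by rewrite fr.
  rewrite /= s1lo s1j; split; try lia.
  case: ifP => [lt|ge]; last first.
    have n0 : n = 0%N by lia.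
    by subst n.
  case: n => [|n] in nd s1j b c lt *; first lia.
  split=> //.
  have [bB cB] := @horner_drop_bound A X (d - lo).+1 G x sG xX GA n.+1
    (d - lo - n)%N ltac:(lia).
  have step : (A * X.+1 ^ (d - lo - n) * X.+1 <= H)%N.
    rewrite -mulnA -expnSr (leq_trans _ AH) // leq_mul2l leq_pexp2l ?orbT //.
    lia.
  set Y := (A * X.+1 ^ _)%N in bB cB step.
  have cx : (`|((drop_poly n.+1 G)^`().[x] * x)%R| <= Y * X)%N.
    by rewrite abszM leq_mul.
  have bx : (`|((drop_poly n.+1 G).[x] * x)%R| <= Y * X)%N by rewrite abszM leq_mul.
  have gH := GA n.
  have AY : (A <= Y)%N by rewrite leq_pmulr // expn_gt0.
  rewrite mulnS in step.
  have [YH YXH] : (Y <= H)%N /\ (Y * X <= H)%N by split; lia.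
  have bH := leq_trans bB YH; have cH := leq_trans cB YH.
  have bxH := leq_trans bx YXH; have cxH := leq_trans cx YXH.
  have {}gH := leq_trans gH (leq_trans AY YH); have xH := leq_trans xX XH.
  eapply runs_arith => /=; rewrite ?s1j //=; try lia.
  rewrite [_ - 1](_ : _ = (lo + n)%N :> int); last lia.
  eapply runs_read => /=; rewrite ar cells; last lia.
  eapply runs_arith => /=; rewrite ?c ?s1x //=; try lia.
  eapply runs_arith => /=; rewrite ?b ?s1x //=; try lia.
  eapply runs_arith => /=; rewrite ?b ?s1x //=; try lia.
  eapply runs_arith => /=; rewrite ?b ?s1x //=; try lia.
  apply: runs_nil; split=> //=; first lia.
  - by frame_tac.
  - by rewrite [RHS]horner_dropS.
  - by rewrite [RHS]horner_deriv_dropS.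
split=> //=.
- by split=> //; lia.
- by frame_tac.
- by rewrite drop_poly_eq0 // horner0.
- by rewrite drop_poly_eq0 // derivC horner0.
Qed.

(** * Newton iteration on polynomials with integer roots *)

Definition roots_poly (l : seq int) : {poly int} := \prod_(y <- l) ('X - y%:P).

Lemma roots_poly_cons y l :
  roots_poly (y :: l) = ('X - y%:P) * roots_poly l.
Proof. by rewrite /roots_poly big_cons. Qed.

Lemma roots_poly_rem y l :
  y \in l -> roots_poly l = ('X - y%:P) * roots_poly (rem y l).
Proof. by move=> yl; rewrite -roots_poly_cons; apply/perm_big/perm_to_rem. Qed.

Lemma size_roots_poly l : size (roots_poly l) = (size l).+1.
Proof. exact: size_prod_XsubC. Qed.

Lemma monic_roots_poly l : roots_poly l \is monic.
Proof. exact: monic_prod_XsubC. Qed.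

Lemma leq_abszB (u v : int) : (`|(u - v)%R| <= `|u| + `|v|)%N.
Proof. lia. Qed.

(** Multiplication by X - y increases the largest coefficient by a factor of at most 1 + |y|. *)
Lemma coef_roots_poly_bound (X : nat) l i :
  (forall y, y \in l -> (`|y| <= X)%N) ->
  (`|((roots_poly l)`_i)%R| <= X.+1 ^ size l)%N.
Proof.
elim: l i => [|y l IHl] i lX.
  by rewrite /roots_poly big_nil coef1; case: i.
have yX := lX y (mem_head _ _).
have {}IHl j := IHl j (fun z zl => lX z (@mem_behead _ (y :: l) z zl)).
rewrite roots_poly_cons mulrBl coefB coefXM mul_polyC coefZ /= expnS.
have Bi : (`|(y * (roots_poly l)`_i)%R| <= X * X.+1 ^ size l)%N.
  by rewrite abszM leq_mul.
have Bi1 := IHl i.-1; rewrite mulSn; case: eqP => [_|i0].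
  by rewrite sub0r abszN (leq_trans Bi) // leq_addl.
by apply: leq_trans (leq_add Bi1 Bi); apply: leq_abszB.
Qed.

(** This is G'/G = sum 1/(x - y) <= size l / delta with denominators cleared; the form without
    division also makes sense at a root. *)
Lemma newton_lower_bound (l : seq int) (x delta : int) :
  0 <= delta -> (forall y, y \in l -> delta <= x - y) ->
  [/\ 0 <= (roots_poly l).[x], 0 <= (roots_poly l)^`().[x] &
      delta * (roots_poly l)^`().[x] <= (size l)%:Z * (roots_poly l).[x]].
Proof.
move=> d0; elim: l => [|y l IHl] dl.
  by rewrite /roots_poly big_nil -polyC1 derivC hornerC horner0 mulr0 mul0r.
have yd := dl y (mem_head _ _).
have [e0 c0 le] := IHl (fun z zl => dl z (@mem_behead _ (y :: l) z zl)).
rewrite roots_poly_cons derivM derivXsubC mul1r !hornerE /=.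
move: (_.[x]) (_^`().[x]) e0 c0 le => e c e0 c0 le.
have xy0 : 0 <= x - y by lia.
split; [exact: mulr_ge0|by rewrite addr_ge0 // mulr_ge0|].
have h1 := ler_wpM2r e0 yd; have h2 := ler_wpM2l xy0 le.
nia.
Qed.

(** To the right of the roots all terms of G'/G = sum 1/(x - y) are positive, so the term of [m]
    alone gives G'/G >= 1/(x - m). Denominators are cleared to include x = m. *)
Lemma newton_upper_bound (l : seq int) (x m : int) :
  (forall y, y \in l -> y <= m) -> m <= x -> m \in l ->
  (roots_poly l).[x] <= (x - m) * (roots_poly l)^`().[x].
Proof.
move=> lm mx; elim: l lm => // y l IHl lm; rewrite inE => ml.
have ym := lm y (mem_head _ _).
have lm' z (zl : z \in l) := lm z (@mem_behead _ (y :: l) z zl).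
have [||e0 c0 _] := @newton_lower_bound l x (x - m); first lia.
  by move=> z /lm'; lia.
rewrite roots_poly_cons derivM derivXsubC mul1r !hornerE /=.
have {IHl} : y = m \/ (roots_poly l).[x] <= (x - m) * (roots_poly l)^`().[x].
  by case/predU1P: ml => [->|ml]; [left|right; apply: IHl].
move: (_.[x]) (_^`().[x]) e0 c0 => e c e0 c0.
have h0 : 0 <= (x - m) * c by rewrite mulr_ge0 //; lia.
have h1 : 0 <= (x - y) * c by rewrite mulr_ge0 //; lia.
case=> [->|le].
  by rewrite mulrDr lerDl mulr_ge0 //; lia.
rewrite mulrDr; nia.
Qed.

(* The rounded-up Newton step divides the distance to the largest root by at
   least 1 + 1 / (d - 1), because G / G' lies between that distance and its
   quotient by d when all roots are real. *)
Lemma newton_step (l : seq int) (x m : int) :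
  (forall y, y \in l -> y <= m) -> m \in l -> m < x ->
  let e := (roots_poly l).[x] in let c := (roots_poly l)^`().[x] in
  let x' := x + ((0 - e) %/ c)%Z in
  [/\ m <= x' & (size l)%:Z * (x' - m) + (x - m) <= (size l)%:Z * (x - m)].
Proof.
move=> lm ml mx e c x'.
have up := newton_upper_bound lm (ltW mx) ml.
have [||e0 c0 low] := @newton_lower_bound l x (x - m); first lia.
  by move=> z /lm; lia.
have egt : 0 < e.
  rewrite lt0r e0 andbT /e /roots_poly horner_prod prodf_seq_neq0.
  by apply/allP => y /lm ym /=; rewrite !hornerE; lia.
have cgt : 0 < c by rewrite /e /c in egt up *; nia.
(* [k] is minus the ceiling of e / c. Rounding the step up cannot pass [m], since x - m is an
   integer that is at least e / c, and it keeps the guaranteed decrease. *)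
rewrite /x'; set k := (_ %/ _)%Z.
have k1 : k * c <= - e.
  by have := divz_eq (0 - e) c; have := @modz_ge0 (0 - e) c; rewrite /k; lia.
have k2 : - e < k * c + c.
  have := divz_eq (0 - e) c; have := ltz_pmod (0 - e) cgt; rewrite /k; lia.
rewrite -/e -/c in up low *.
split; first by nia.
suff : (x - m) <= (size l)%:Z * (- k) by lia.
rewrite -(ler_pM2r cgt); nia.
Qed.

(* d log_2 delta, interpolated linearly between the powers of 2: its slope is at
   least d / delta, so multiplying delta by 1 - 1 / d decreases it. *)
Definition newton_rank (d delta : nat) : nat :=
  (d * trunc_log 2 delta + d * delta %/ 2 ^ trunc_log 2 delta)%N.

(** For delta > 0 the second term of the rank lies between d and 2d, the latter excluded. If the
    logarithm k stays the same, d delta drops by at least delta >= 2^k, so the quotient by 2^k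
    drops. If the logarithm drops, the first term loses at least d, while the second gains less than
    d. *)
Lemma newton_rank_lt d delta delta' :
  (0 < delta)%N -> (d * delta' + delta <= d * delta)%N ->
  (newton_rank d delta' < newton_rank d delta)%N.
Proof.
move=> d0 dd; have dgt0 : (0 < d)%N by case: d dd => //; lia.
have dd' : (delta' <= delta)%N by nia.
have k_le : (2 ^ trunc_log 2 delta <= delta)%N by rewrite trunc_logP.
have k_lt : (delta' < 2 ^ (trunc_log 2 delta').+1)%N by rewrite trunc_log_ltn.
rewrite /newton_rank.
have : (trunc_log 2 delta' <= trunc_log 2 delta)%N by apply: leq_trunc_log.
move: (trunc_log 2 delta') (trunc_log 2 delta) k_le k_lt => k' k k_le k_lt.
rewrite leq_eqVlt => /predU1P[->|kk].
  rewrite ltn_add2l.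
  rewrite (@leq_trans ((d * delta' + 2 ^ k) %/ 2 ^ k)) //.
    by rewrite divnDr // divnn expn_gt0 addn1.
  by apply: leq_div2r; lia.
have h1 : (d * delta' %/ 2 ^ k' < 2 * d)%N.
  by rewrite ltn_divLR ?expn_gt0 // mulnAC -expnS mulnC ltn_pmul2r.
have h2 : (d <= d * delta %/ 2 ^ k)%N by rewrite leq_divRL ?expn_gt0 // leq_mul2l k_le orbT.
nia.
Qed.

Lemma newton_rank_le d delta k :
  (delta < 2 ^ k)%N -> (newton_rank d delta <= d * k + 2 * d)%N.
Proof.
move=> dk; rewrite /newton_rank leq_add //.
  have [->|d0] := posnP delta; first by rewrite trunc_log0 muln0.
  rewrite leq_mul2l; apply/orP; right; apply: ltnW.
  rewrite -(@ltn_exp2l 2) //; apply: leq_ltn_trans dk.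
  by rewrite trunc_logP.
have [->|d0] := posnP d; first by rewrite div0n.
apply: ltnW; rewrite ltn_divLR ?expn_gt0 // mulnAC -expnS mulnC ltn_pmul2r //.
by rewrite trunc_log_ltn.
Qed.

Definition newton_prog := block [::
  Assign vx vU; horner_prog;
  While Lt #0 vb (block [::
    Arith vu Defs.Sub #0 vb; Arith vu Div vu vc; Arith vx Add vx vu;
    horner_prog])].

Lemma max_mem (l : seq int) :
  l != [::] -> exists2 m, m \in l & forall y, y \in l -> y <= m.
Proof.
elim: l => // y l IHl _; have [->|/IHl[m ml lm]] := eqVneq l [::].
  by exists y; rewrite ?mem_head // => z; rewrite inE => /eqP->.
have [ym|my] := leP y m.
  exists m; first by rewrite inE ml orbT.
  by move=> z; rewrite inE => /predU1P[->|/lm].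
exists y; rewrite ?mem_head // => z; rewrite inE => /predU1P[->//|/lm].
by move=> zm; apply: le_trans zm (ltW my).
Qed.

Definition newton_cost (d K : nat) := ((d * K + 2 * d) * (d.+1 * 6 + 6) + d.+1 * 6 + 3)%N.

Lemma runs_newton (H U K d lo : nat) (l : seq int) s :
  (lo < d)%N -> size l = (d - lo)%N ->
  (forall y, y \in l -> (`|y| <= U)%N) -> (2 * U < 2 ^ K)%N ->
  (U.+1 ^ d * U.+1 ^ d.+1 <= H)%N -> (d < H)%N ->
  var s vd = d -> var s vlo = lo -> var s vU = U ->
  (forall i, (i <= d - lo)%N -> arr s 2 (lo + i)%N = (roots_poly l)`_i) ->
  runs H (newton_cost d K) newton_prog s (fun s' =>
    [/\ frame [:: vx; vj; vu; vb; vc] s s', arr s' = arr s &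
        var s' vx \in l]).
Proof.
move=> lod sl lU UK AH dH sd slo sU cells.
have [|m ml lm] := @max_mem l; first by rewrite -size_eq0 sl; lia.
have GA i : (`|((roots_poly l)`_i)%R| <= U.+1 ^ d)%N.
  apply: leq_trans (coef_roots_poly_bound i lU) _.
  by rewrite leq_pexp2l // sl leq_subr.
have UH : (U < H)%N.
  apply: leq_trans AH; rewrite -expnD -[X in (X <= _)%N]expn1 leq_pexp2l //.
  by lia.
have U2H : (2 * U < H)%N.
  apply: leq_trans AH; rewrite -expnD (@leq_trans (U.+1 ^ 2)) //.
    by rewrite -mulnn; nia.
  by rewrite leq_pexp2l //; lia.
have mU := lU m ml.
pose I0 x (s' : state) :=
  [/\ frame [:: vx; vj; vu; vb; vc] s s', arr s' = arr s,
      var s' vx = x, var s' vb = (roots_poly l).[x] &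
      var s' vc = (roots_poly l)^`().[x]].
have horner x s1 : (`|x| <= U)%N ->
    frame [:: vx; vj; vu; vb; vc] s s1 -> arr s1 = arr s -> var s1 vx = x ->
    runs H (d.+1 * 6 + 2) horner_prog s1 (I0 x).
  move=> xU fr ar s1x.
  have := @runs_horner H (U.+1 ^ d) U d lo (roots_poly l) x s1 (ltnW lod).
  rewrite size_roots_poly sl ar (fr vd) // (fr vlo) // => /(_ (leqnn _) GA xU AH (ltnW UH) dH).
  move=> /(_ sd slo s1x cells); apply: runs_weaken => // s2 [fr2 ar2 b c].
  split=> //; first by apply: frame_trans fr (frame_sub _ fr2); apply/allP.
  by rewrite fr2.
eapply runs_assign => /=; rewrite sU.
rewrite (_ : newton_cost d K = (d.+1 * 6 + 2) +
  (((d * K + 2 * d) * (d.+1 * 6 + 5).+1).+1 + 0))%N; last first.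
  by rewrite /newton_cost; lia.
apply: runs_then.
  by apply: (horner U) => //=; frame_tac.
move=> s1 Is1.
pose I n s' := exists x : int, [/\ m <= x, (`|x| <= U)%N, I0 x s' &
  (newton_rank (size l) `|(x - m)%R| <= n)%N].
apply: (@runs_then _ _ _ _ _ _ (I0 m)); last first.
  by move=> s2 [fr ar xm b c]; apply: runs_nil; split; rewrite ?xm.
apply: (@runs_while _ (d.+1 * 6 + 5) _ _ _ _ I); last first.
  exists U; split=> //; first lia.
  apply: leq_trans (newton_rank_le _ (_ : _ < 2 ^ K)%N) _; first by lia.
  by rewrite sl; apply: leq_add; rewrite leq_mul // leq_subr.
move=> n s2 [x [mx xU [fr ar s2x b c] rk]] /=.
have [bB cB] := @horner_drop_bound (U.+1 ^ d) U (d - lo).+1 (roots_poly l) x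
  ltac:(by rewrite size_roots_poly sl) xU GA 0 _ erefl.
rewrite drop_poly0l in bB cB.
have [bH cH] : (`|var s2 vb| <= H)%N /\ (`|var s2 vc| <= H)%N.
  rewrite b c; split; [apply: leq_trans bB _|apply: leq_trans cB _];
    by apply: leq_trans AH; rewrite leq_mul2l leq_pexp2l ?orbT //; lia.
split=> //.
case: ifP => [bgt|ble]; last first.
  (* To the right of the roots G is nonnegative, so the exit condition G(x) <= 0 makes x a root; as
     x >= m, it is m. *)
  have [||e0 _ _] := @newton_lower_bound l x (x - m); first lia.
    by move=> y /lm; lia.
  have : (roots_poly l).[x] = 0 by rewrite b in ble; lia.
  move/eqP; rewrite -rootE root_prod_XsubC => /lm xm.
  by have <- : x = m by lia.
have xm : m < x.
  rewrite lt_neqAle mx andbT; apply/eqP => xm; move: bgt; rewrite b.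
  suff /eqP -> : (roots_poly l).[x] == 0 by rewrite ltxx.
  by rewrite -rootE root_prod_XsubC -xm.
have [mx' stp] := newton_step lm ml xm.
set x' := x + _ in mx' stp.
have e1 : Posz `|(x' - m)%R| = x' - m by rewrite gez0_abs // subr_ge0.
have e2 : Posz `|(x - m)%R| = x - m by rewrite gez0_abs // subr_ge0.
have rk' : (newton_rank (size l) `|(x' - m)%R| <
            newton_rank (size l) `|(x - m)%R|)%N.
  apply: newton_rank_lt; first by rewrite -ltz_nat e2 subr_gt0.
  by rewrite -lez_nat PoszD !PoszM e1 e2.
split; first exact: leq_ltn_trans (leq0n _) (leq_trans rk' rk).
rewrite (_ : d.+1 * 6 + 5 = (d.+1 * 6 + 2 + 0).+3)%N; last lia.
have xx' : x' <= x.
  rewrite leNgt; apply/negP => lt.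
  have h : (size l)%:Z * (x - m) <= (size l)%:Z * (x' - m).
    by rewrite ler_wpM2l // lerB // ltW.
  by have := le_trans stp h; rewrite gerDl leNgt subr_gt0 xm.
eapply runs_arith => //=.
eapply runs_arith => //=; first by rewrite sub0r abszN.
eapply runs_arith => /=.
- by rewrite s2x (leq_trans xU (ltnW UH)).
(* The quotient is bounded through the step itself: it lies between m - x and 0, hence within 2U. *)
- rewrite b c; set k := divz _ _.
  have {}xx' : x + k <= x by [].
  have {}mx' : m <= x + k by [].
  move: xU U2H xx' mx' mU; clear; lia.
rewrite s2x b c -/x'.
apply: runs_then.
  apply: (horner x') => //=; first by clear -xU xx' mx' mU; lia.
  by frame_tac.
by move=> s3 Is3; apply: runs_nil; exists x'; split=> //; [lia|move: rk rk'; clear; lia].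
Qed.

(** * Division by a linear factor *)

Definition deflate_prog := block [::
  Assign vj vd; Assign vu #1;
  While Lt vlo vj (block [::
    Arith vj Defs.Sub vj #1; Arith vt Mul vu vx; Read vu 2 vj;
    Arith vu Add vu vt; Write 2 vj vu])].

(** Synthetic division in place: if P = (X - x) G, then P_n + x G_n is the coefficient of degree n
    of ['X * G]. The quotient thus lands one cell higher, from [lo.+1] on, and cell [lo] receives
    the remainder 0, so that increasing [vlo] completes the division. *)
Lemma runs_deflate (H A X d lo : nat) (G : {poly int}) (x : int) s :
  (lo < d)%N -> size G = (d - lo)%N -> G \is monic ->
  (forall i, (`|(G`_i)%R| <= A)%N) ->
  (forall i, (`|((('X - x%:P) * G)`_i)%R| <= A)%N) ->
  (`|x| <= X)%N -> (A * X.+1 <= H)%N -> (d < H)%N -> (X < H)%N ->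
  var s vd = d -> var s vlo = lo -> var s vx = x ->
  (forall i, (i <= d - lo)%N ->
     arr s 2 (lo + i)%N = (('X - x%:P) * G)`_i) ->
  runs H (d * 4 + 1) deflate_prog s (fun s' =>
    [/\ frame [:: vj; vu; vt] s s', (forall a, a != 2%N -> arr s' a = arr s a) &
        forall i, (i < d - lo)%N -> arr s' 2 (lo.+1 + i)%N = G`_i]).
Proof.
move=> lod sG mG GA XGA xX AH dH XH sd slo sx cells.
pose I n (s' : state) :=
  [/\ [/\ (n <= d - lo)%N, var s' vj = (lo + n)%N & var s' vu = ('X * G)`_n],
     frame [:: vj; vu; vt] s s', (forall a, a != 2%N -> arr s' a = arr s a) &
     forall i, (i <= d - lo)%N ->
       arr s' 2 (lo + i)%N = if (n <= i)%N then ('X * G)`_i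
                             else (('X - x%:P) * G)`_i].
have AX : (A <= A * X.+1)%N by rewrite leq_pmulr.
have XG i : (`|(('X * G)`_i)%R| <= A)%N.
  by rewrite coefXM; case: eqP => //.
eapply runs_assign; eapply runs_assign => /=; rewrite sd.
apply: (@runs_leq _ (((d - lo) * 4).+1 + 0)).
  by rewrite addn0 addn1 ltnS leq_mul2r; lia.
- apply: (@runs_then _ _ _ _ _ _ (I 0%N)); last first.
    move=> s1 [[_ _ _] fr ar cl]; apply: runs_nil; split=> // i id.
    by rewrite addSnnS cl //= coefXM.
  apply: (@runs_while _ 3 _ _ _ _ I); last first.
    split=> //=.
    + split=> //; first lia.
      (* The leading coefficient 1 of the quotient is the initial value of [vu]. *)
      have g1 : G`_(d - lo).-1 = 1 by have := monicP mG; rewrite lead_coefE sG.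
      by rewrite coefXM g1; case: eqP => //; lia.
    + by frame_tac.
    + move=> i id; rewrite cells //; case: leqP => // di.
      have -> : i = (d - lo)%N by lia.
      rewrite mulrBl coefB mul_polyC coefZ [G`_(d - lo)]nth_default ?sG //.
      by rewrite mulr0 subr0.
  move=> n s1 [[nd s1j s1u] fr ar cl] /=.
  have s1lo : var s1 vlo = lo by rewrite fr.
  have s1x : var s1 vx = x by rewrite fr.
  rewrite s1lo s1j; split; try lia.
  case: ifP => [lt|ge]; last by have n0 : n = 0%N by [lia]; subst n.
  case: n => [|n] in nd s1j s1u cl lt *; first lia.
  split=> //.
  have uB := XG n.+1.
  have uxB : (`|(('X * G)`_n.+1 * x)%R| <= A * X)%N by rewrite abszM leq_mul.
  have [uH uxH] : (`|(('X * G)`_n.+1)%R| <= H)%N /\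
                  (`|(('X * G)`_n.+1 * x)%R| <= H)%N.
    by split; [apply: leq_trans uB _|apply: leq_trans uxB _]; lia.
  have gH : (`|((('X - x%:P) * G)`_n)%R| <= H)%N.
    by apply: leq_trans (XGA n) _; lia.
  eapply runs_arith => /=; rewrite ?s1j; try lia.
  rewrite [_ - 1](_ : _ = (lo + n)%N :> int); last lia.
  eapply runs_arith => /=; rewrite ?s1u ?s1x //; try lia.
  eapply runs_read => /=; rewrite cl ?ltnn; last lia.
  eapply runs_arith => //=.
  eapply runs_write => /=.
  have E : (('X - x%:P) * G)`_n + ('X * G)`_n.+1 * x = ('X * G)`_n.
    by rewrite mulrBl coefB mul_polyC coefZ [('X * G)`_n.+1]coefXM /= [G`_n * x]mulrC subrK.
  rewrite E; apply: runs_nil; split=> //=.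
  + by split=> //; lia.
  + by frame_tac.
  + by move=> a /negbTE a2; rewrite -ar ?a2 //=; apply/funext => j; rewrite a2.
  + move=> i id; rewrite eqz_nat eqn_add2l; case: eqP => [->|ne] /=.
      by rewrite leqnn.
    by rewrite cl // (_ : (n < i)%N = (n <= i)%N) //; lia.
Qed.

Definition roots_prog := block [::
  Assign vlo #0;
  While Lt vlo vd (block [::
    newton_prog; deflate_prog; Write 3 vlo vx; Arith vlo Add vlo #1])].

Definition root_regs := [:: vlo; vx; vj; vu; vb; vc; vt].

(** The found roots [ys] and the remaining ones [rest] make up [l], and array 2 holds
    [roots_poly rest] from cell [vlo] on. The coefficients of each intermediate polynomial are
    bounded afresh from its roots, so the bounds do not grow with the number of divisions. *)
Lemma runs_roots (H U K d : nat) (l : seq int) s :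
  (0 < d)%N -> size l = d ->
  (forall y, y \in l -> (`|y| <= U)%N) -> (2 * U < 2 ^ K)%N ->
  (U.+1 ^ d * U.+1 ^ d.+1 <= H)%N -> (d < H)%N ->
  var s vd = d -> var s vU = U ->
  (forall i, (i <= d)%N -> arr s 2 i = (roots_poly l)`_i) ->
  runs H (d * (newton_cost d K + d * 4 + 3) + 1) roots_prog s (fun s' =>
    [/\ frame root_regs s s',
        (forall a : nat, a \notin [:: 2%N; 3%N] -> arr s' a = arr s a) &
        exists2 ys : seq int, perm_eq ys l & forall i, (i < d)%N -> arr s' 3 i = ys`_i]).
Proof.
move=> d0 sl lU UK AH dH sd sU cells.
pose I n (s' : state) :=
  [/\ (n <= d)%N /\ var s' vlo = (d - n)%N, frame root_regs s s',
      (forall a : nat, a \notin [:: 2%N; 3%N] -> arr s' a = arr s a) &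
      exists ys rest : seq int, [/\ perm_eq (ys ++ rest) l, size ys = (d - n)%N,
        (forall i, (i < d - n)%N -> arr s' 3 i = ys`_i) &
        forall i, (i <= n)%N ->
          arr s' 2 (d - n + i)%N = (roots_poly rest)`_i]].
have UH : (U < H)%N.
  apply: leq_trans AH; rewrite -expnD -[X in (X <= _)%N]expn1 leq_pexp2l //.
  by lia.
eapply runs_assign => /=.
apply: (@runs_leq _ ((d * (newton_cost d K + d * 4 + 2).+1).+1 + 0)).
  by lia.
apply: (@runs_then _ _ _ _ _ _ (I 0%N)); last first.
  move=> s1 [_ fr ar [ys [rest [pe sys cl _]]]]; apply: runs_nil; split=> //.
  exists ys => [|i id]; last by rewrite cl ?subn0.
  move: pe (perm_size pe); rewrite size_cat sys subn0 sl.
  by case: rest => [|z rest] /=; [rewrite cats0|lia].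
apply: (@runs_while _ (newton_cost d K + d * 4 + 2) _ _ _ _ I); last first.
  split=> //=; first by rewrite subnn.
    by frame_tac.
  exists [::], l; split=> //= [|i|i id]; rewrite subnn //.
  by rewrite add0n cells.
move=> n s1 [[nd s1lo] fr ar [ys [rest [pe sys cl3 cl2]]]].
have s1d : var s1 vd = d by rewrite fr.
have s1U : var s1 vU = U by rewrite fr.
rewrite /= s1lo s1d; split; try lia.
case: ifP => [lt|ge]; last first.
  have n0 : n = 0%N by lia.
  by subst n; split=> //; exists ys, rest.
case: n => [|n] in nd s1lo sys cl3 cl2 lt *; first lia.
split=> //.
set lo := (d - n.+1)%N in s1lo sys cl3 cl2 lt.
have lod : (lo < d)%N by rewrite /lo ltn_subrL d0.
have dlo : (d - lo)%N = n.+1 by rewrite /lo subKn.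
have srest : size rest = n.+1.
  have /eqP := perm_size pe; rewrite size_cat sys sl /lo.
  by rewrite -[d in _ == d](subnK nd) eqn_add2l => /eqP.
have restU y : y \in rest -> (`|y| <= U)%N.
  by move=> yr; apply: lU; rewrite -(perm_mem pe) mem_cat yr orbT.
rewrite (_ : (_ + 2)%N = (newton_cost d K + (d * 4 + 1 + 1))%N); last by lia.
apply: runs_then.
  apply: (@runs_newton H U K d lo rest) => //.
    by rewrite srest dlo.
  by move=> i; rewrite dlo => id; apply: cl2.
move=> s2 [fr2 ar2]; set x := var s2 vx => xr.
have xU := restU x xr.
apply: runs_then.
  apply: (@runs_deflate H (U.+1 ^ d) U d lo (roots_poly (rem x rest)) x) => //.
  - by rewrite size_roots_poly size_rem // srest dlo.
  - exact: monic_roots_poly.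
  - move=> i; have remU y : y \in rem x rest -> (`|y| <= U)%N.
      by move=> /mem_rem/restU.
    apply: leq_trans (coef_roots_poly_bound i remU) _.
    by rewrite leq_pexp2l // size_rem // srest; lia.
  - move=> i; rewrite -roots_poly_rem //.
    apply: leq_trans (coef_roots_poly_bound i restU) _.
    by rewrite leq_pexp2l // srest; lia.
  - by apply: leq_trans AH; rewrite leq_mul2l -[X in (X <= _)%N]expn1 leq_pexp2l ?orbT.
  - by rewrite fr2.
  - by rewrite fr2.
  - move=> i id; rewrite -roots_poly_rem // ar2 cl2 //.
    by rewrite -dlo.
move=> s3 [fr3 ar3 cl3']; have s3lo : var s3 vlo = lo by rewrite fr3 ?fr2.
have s3x : var s3 vx = x by rewrite fr3.
eapply runs_write => /=; rewrite s3lo s3x.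
eapply runs_arith => //=; rewrite ?s3lo; try lia.
apply: runs_nil; split=> //=.
- by split; rewrite /lo; lia.
- refine (@frame_set _ _ _ _ _ _ _) => //; refine (@frame_set_arr _ _ _ _ _ _ _).
  apply: (frame_trans fr); apply: (frame_trans (s2 := s2)).
    by apply: frame_sub fr2; apply/allP.
  by apply: frame_sub fr3; apply/allP.
- move=> a; rewrite !inE negb_or => /andP[a2 a3].
  rewrite (negbTE a3) /= -ar ?inE ?negb_or ?a2 //.
  by apply/funext => j; rewrite ar3 // ar2.
- exists (rcons ys x), (rem x rest); split.
  + rewrite -cats1 -catA; apply: perm_trans pe.
    by rewrite perm_cat2l /= perm_sym perm_to_rem.
  + by rewrite size_rcons sys /lo; lia.
  + move=> i id; rewrite /= eqz_nat nth_rcons sys.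
    case: eqP => [->|ilo]; first by rewrite ltnn.
    have ilt : (i < lo)%N by rewrite /lo; lia.
    by rewrite ilt ar3 // ar2 cl3.
  + move=> i id; rewrite /= (_ : (d - n + i)%N = (lo.+1 + i)%N).
      by rewrite cl3' // /lo; lia.
    by rewrite /lo; lia.
Qed.

(** * Reduction to a monic polynomial *)

Definition setup_prog := block [::
  Assign vp vN; Assign vN #0; Read va 0 vd; Arith vU Mul va va;
  Assign vpw #1; Write 2 vd #1; Assign vj vd;
  While Lt #0 vj (block [::
    Arith vj Defs.Sub vj #1; Read vu 0 vj; Arith vt Mul vu vu;
    Arith vU Add vU vt; Arith vt Mul vu vpw; Write 2 vj vt;
    Arith vpw Mul vpw va]);
  Arith vU Add vU vU].

(** Partial sums of ||f||^2 in the order of the loop, which reads the coefficients downwards. *)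
Definition sumsq_from (f : {poly int}) n := (\sum_(n <= i < size f) `|(f`_i)%R| ^ 2)%N.
Definition sumsq (f : {poly int}) := sumsq_from f 0.

(** The top coefficient is separate: for i = d the exponent d - 1 - i would be -1, and natural
    subtraction would turn it into 0. *)
Definition monic_scale (f : {poly int}) : {poly int} :=
  'X^((size f).-1) +
  \poly_(i < (size f).-1) (f`_i * lead_coef f ^+ ((size f).-2 - i)).

Lemma sumsq_from_le f n : (sumsq_from f n <= sumsq f)%N.
Proof.
have [ns|sn] := leqP n (size f); last by rewrite /sumsq_from big_geq // ltnW.
by rewrite /sumsq/sumsq_from [X in (_ <= X)%N](big_cat_nat (leq0n n) ns) /= leq_addl.
Qed.

Lemma coef_sumsq (f : {poly int}) i : (`|(f`_i)%R| ^ 2 <= sumsq f)%N.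
Proof.
have [fi|/leq_sizeP/(_ _ (leqnn _))->//] := ltnP i (size f).
by apply: leq_trans (sumsq_from_le f i); rewrite /sumsq_from big_ltn ?leq_addr.
Qed.

Lemma coef_le_sumsq (f : {poly int}) i : (`|(f`_i)%R| <= sumsq f)%N.
Proof. by apply: leq_trans (coef_sumsq f i); rewrite -mulnn; nia. Qed.

Lemma absz_sqr (u : int) : Posz (`|u| ^ 2) = u * u.
Proof. by lia. Qed.

Lemma runs_setup (H p : nat) (f : {poly int}) :
  (1 < size f)%N -> let d := (size f).-1 in
  ((sumsq f).+1 ^ d.+1 <= H)%N -> (d < H)%N ->
  runs H (d * 6 + 3) setup_prog (input_state p f) (fun s' =>
    [/\ [/\ var s' vN = 0, var s' vd = d, var s' vp = p,
        var s' va = lead_coef f & var s' vU = (2 * sumsq f)%N] &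
        (forall i, (i <= d)%N -> arr s' 2 i = (monic_scale f)`_i)]).
Proof.
move=> sf d SH dH; set S := sumsq f in SH *.
set a := lead_coef f.
have fd : f`_d = a by [].
have S0 : (S < H)%N.
  apply: leq_trans SH; rewrite -[X in (X <= _)%N]expn1 leq_pexp2l //.
have aS : (`|a| <= S)%N by rewrite -fd coef_le_sumsq.
have SdH : (S.+1 ^ d * S <= H)%N.
  by apply: leq_trans SH; rewrite expnSr leq_mul2l leqnSn orbT.
have powS k : (k <= d)%N -> (`|(a ^+ k)%R| <= S.+1 ^ d)%N.
  move=> kd; rewrite abszX; apply: (@leq_trans (S.+1 ^ k)).
    have [->|k0] := posnP k; first by rewrite !expn0.
    by rewrite leq_exp2r // (leq_trans aS).
  by rewrite leq_pexp2l.
pose I n (s' : state) :=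
  [/\ [/\ (n <= d)%N, var s' vj = n, var s' vU = sumsq_from f n &
        var s' vpw = a ^+ (d - n)],
     frame [:: vj; vu; vt; vpw; vN; vp; va; vU] (input_state p f) s',
     [/\ var s' vN = 0, var s' vp = p & var s' va = a],
     (forall b, b != 2%N -> arr s' b = arr (input_state p f) b) &
     forall i, (n <= i <= d)%N -> arr s' 2 i = (monic_scale f)`_i].
have S_d : sumsq_from f d = (`|a| ^ 2)%N.
  have sfd : size f = d.+1 by rewrite prednK // ltnW.
  by rewrite /sumsq_from sfd big_nat1.
have aaH : (`|(a * a)%R| <= S)%N by rewrite abszM mulnn -fd coef_sumsq.
have gd : (monic_scale f)`_d = 1.
  by rewrite coefD coefXn eqxx coef_poly ltnn addr0.
do 2! eapply runs_assign; eapply runs_read => /=.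
rewrite (_ : d * 6 + 3 = ((d * 6).+1 + 1).+1)%N; last lia.
have aH := leq_trans aS (ltnW S0); have aaE := absz_sqr a.
eapply runs_arith => /=; [exact: aH..|].
eapply runs_assign; eapply runs_write; eapply runs_assign => /=.
apply: (@runs_then _ _ _ _ _ _ (I 0%N)); last first.
  move=> s1 [[_ _ s1U _] fr [s1N s1p s1a] ar cl].
  have UH : (sumsq_from f 0 <= H)%N by apply: ltnW.
  eapply runs_arith => /=; rewrite ?s1U //.
  apply: runs_nil; split=> //; split=> //=; rewrite ?fr //.
  by rewrite /S /sumsq; lia.
apply: (@runs_while _ 5 _ _ _ _ I); last first.
  split=> //=.
  - by split=> //; [rewrite S_d aaE|rewrite subnn].
  - by frame_tac.
  - by move=> b /negbTE b2; apply/funext => j; rewrite b2.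
  - move=> i id; have -> : i = d by lia.
    by rewrite eqxx gd.
move=> n s1 [[nd s1j s1U s1pw] fr [s1N s1p s1a] ar cl].
rewrite /= s1j; split; try lia.
case: ifP => [lt|ge]; last by have n0 : n = 0%N by [lia]; subst n.
case: n => [|n] in nd s1j s1U s1pw cl lt *; first lia.
split=> //.
have pwS := powS (d - n.+1)%N (leq_subr _ _).
have fS := coef_le_sumsq f n; have ffS := coef_sumsq f n.
have Sn : sumsq_from f n = (`|(f`_n)%R| ^ 2 + sumsq_from f n.+1)%N.
  by rewrite /sumsq_from big_ltn // ltnW // -ltn_predRL.
have SnS := sumsq_from_le f n; rewrite -/S in fS ffS SnS.
have SdH' : (S.+1 ^ d <= H)%N by apply: leq_trans SH; rewrite leq_pexp2l.
have nH : (n.+1 <= H)%N by apply: leq_trans nd (ltnW dH).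
eapply runs_arith => /=; rewrite ?s1j //; first by apply: leq_trans nH.
rewrite [_ - 1](_ : _ = n :> int); last by clear; lia.
eapply runs_read => /=; rewrite ar //=.
have fH := leq_trans fS (ltnW S0).
have pwH := leq_trans pwS SdH'.
have ffE := absz_sqr f`_n.
eapply runs_arith => //=.
eapply runs_arith => /=; rewrite ?s1U.
- by apply: leq_trans (ltnW S0); apply: leq_trans (sumsq_from_le f n.+1) _.
- by rewrite abszM mulnn; apply: leq_trans ffS (ltnW S0).
eapply runs_arith => /=; rewrite ?s1pw //.
eapply runs_write => /=.
eapply runs_arith => /=; rewrite ?s1pw ?s1a //.
apply: runs_nil; split=> //=.
- split=> //; first lia.
  + by rewrite Sn -ffE; lia.
  + by rewrite -exprSr subnSK.
- by frame_tac.
- by move=> b b2; rewrite -[RHS]ar //; apply/funext => j; rewrite (negbTE b2).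
- move=> i ind; rewrite eqz_nat; case: eqP => [->|ne] /=.
    rewrite coefD coefXn coef_poly -/d (ltn_eqF nd).
    rewrite nd add0r -/a; by rewrite subnS predn_sub.
  by rewrite cl //; lia.
Qed.

(** * Residue classes of the roots and output of the rational function *)

(** The machine has no remainder operation, so q divides u is tested as (u div q) q = u. The
    register [b] holds the length of the prefix of the roots to inspect: [vd] for all of them, [vi]
    for those before the current one. *)
Definition count_prog (b : nat) := block [::
  Assign vk #0; Assign vj #0;
  While Lt vj b (block [::
    Read vu 3 vj; Arith vu Defs.Sub vy vu;
    Arith vt Div vu vq; Arith vt Mul vt vq;
    If Eq vt vu (block [:: Arith vk Add vk #1]) Skip;
    Arith vj Add vj #1])].

Definition congr_count (q y : int) (l : seq int) : nat :=
  count (fun z => (q %| y - z)%Z) l.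

Definition count_regs := [:: vk; vj; vu; vt].

Lemma absz_divz_le (u q : int) : 0 < q -> (`|(u %/ q)%Z| <= `|u|)%N.
Proof.
move=> q0; have := divz_eq u q; have := ltz_pmod u q0.
have := modz_ge0 u (lt0r_neq0 q0); move: (u %/ q)%Z (u %% q)%Z => k r.
nia.
Qed.

Lemma absz_divz_mul_le (u q : int) :
  0 < q -> (`|((u %/ q)%Z * q)%R| <= `|u| + `|q|)%N.
Proof.
move=> q0; have := divz_eq u q; have := ltz_pmod u q0.
have := modz_ge0 u (lt0r_neq0 q0); move: (_ * q) (u %% q)%Z => k r.
lia.
Qed.

Lemma runs_count (H Y m b : nat) (ys : seq int) (y q : int) s :
  b \notin count_regs -> var s b = m -> (m <= size ys)%N -> (m < H)%N ->
  (forall i, (i < m)%N -> arr s 3 i = ys`_i) ->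
  (forall z, z \in ys -> (`|z| <= Y)%N) -> (`|y| <= Y)%N ->
  0 < q -> (2 * Y + `|q| <= H)%N ->
  var s vy = y -> var s vq = q ->
  runs H (m * 7 + 1) (count_prog b) s (fun s' =>
    [/\ frame count_regs s s', arr s' = arr s &
        var s' vk = congr_count q y (take m ys)]).
Proof.
move=> breg sb mys mH cells ysY yY q0 YH sy sq.
pose I n (s' : state) :=
  [/\ (n <= m)%N /\ var s' vj = (m - n)%N, frame count_regs s s',
     arr s' = arr s & var s' vk = congr_count q y (take (m - n) ys)].
do 2! eapply runs_assign.
apply: (@runs_leq _ ((m * 7).+1 + 0)); first by rewrite addn0 addn1.
apply: (@runs_then _ _ _ _ _ _ (I 0%N)); last first.
  by move=> s1 [_ fr ar k]; apply: runs_nil; split; rewrite ?k ?subn0.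
apply: (@runs_while _ 6 _ _ _ _ I); last first.
  split=> //=; first by rewrite subnn.
    by frame_tac.
  by rewrite subnn take0.
move=> n s1 [[nm s1j] fr ar k] /=.
have s1b : var s1 b = m by rewrite fr.
have s1y : var s1 vy = y by rewrite fr.
have s1q : var s1 vq = q by rewrite fr.
have mnm : (m - n <= m)%N by apply: leq_subr.
rewrite s1b s1j; split.
- by apply: leq_trans (ltnW mH).
- exact: ltnW.
case: ifP => [lt|ge]; last first.
  have n0 : n = 0%N by move: ge nm; clear; lia.
  by subst n.
case: n => [|n] in nm s1j k lt mnm *; first by rewrite subn0 ltxx in lt.
split=> //; set j := (m - n.+1)%N in s1j k lt mnm.
have jm : (j < m)%N by [].
have jys : (j < size ys)%N by apply: leq_trans jm mys.
have zY : (`|(ys`_j)%R| <= Y)%N by apply/ysY/mem_nth.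
have uY : (`|(y - ys`_j)%R| <= 2 * Y)%N by move: zY yY; clear; lia.
eapply runs_read => /=; rewrite s1j ar cells //.
set u := y - ys`_j in uY *.
have [uH qH yH zH] : [/\ `|u| <= H, `|q| <= H, `|y| <= H & `|(ys`_j)%R| <= H]%N.
  by move: uY zY yY YH; clear; split; lia.
eapply runs_arith => //=; first by rewrite s1y.
rewrite s1y -/u; eapply runs_arith => //=; first by rewrite s1q.
rewrite s1q; eapply runs_arith => /=.
- by apply: leq_trans (absz_divz_le _ q0) uH.
- by rewrite s1q.
rewrite s1q -[3%N]/(2 + 1)%N.
have kcount : congr_count q y (take (m - n) ys) =
    (congr_count q y (take j ys) + (q %| u)%Z)%N.
  have -> : (m - n = j.+1)%N by rewrite /j subnSK.
  by rewrite (take_nth 0) // /congr_count -cats1 count_cat /= addn0.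
have kH : (congr_count q y (take j ys) <= H)%N.
  apply: leq_trans (count_size _ _) _; rewrite size_takel ?(ltnW jys) //.
  by apply: ltnW; apply: ltn_trans mH.
apply: (@runs_then _ _ _ _ _ _ (fun s2 => [/\ frame count_regs s1 s2,
    arr s2 = arr s1, var s2 vj = j &
    var s2 vk = congr_count q y (take (m - n) ys)])).
  eapply runs_if => //=.
    apply: leq_trans (absz_divz_mul_le _ q0) _.
    by move: uY YH; clear; lia.
  rewrite -dvdz_eq kcount; case: ifP => qu.
    eapply runs_arith => /=; rewrite ?k //.
      by move: YH q0; clear; lia.
    apply: runs_nil; split=> //=; first by frame_tac.
    by rewrite qu PoszD.
  apply: (@runs_leq _ 0) => //; apply: runs_skip; split=> //=.
    by frame_tac.
  by rewrite qu addn0.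
move=> s2 [fr2 ar2 s2j s2k]; eapply runs_arith; rewrite /= ?s2j //.
- by apply: leq_trans mnm (ltnW mH).
- by move: YH q0; clear; lia.
apply: runs_nil; split=> //=.
- by split; [apply: ltnW|rewrite -PoszD addn1 /j subnSK].
- by refine (@frame_set _ _ _ _ _ _ _) => //; apply: frame_trans fr fr2.
- by rewrite ar2.
Qed.

(** * Emission of the postfix expression *)

Definition emit (xs : seq (int * atom)) : program :=
  block (flatten [seq [:: Write 0 vN #(x.1); Write 1 vN x.2;
                          Arith vN Add vN #1] | x <- xs]).

Definition tokens (s : state) (n : nat) : seq (int * int) :=
  [seq (arr s 0%N k%:Z, arr s 1%N k%:Z) | k <- iota 0 n].

(** The counter [vN] changes during emission; every other register still has the value it had at the
    start. *)
Definition not_counter (u : atom) := if u is Var x then x != 0%N else true.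

Lemma runs_emit (H n : nat) xs s :
  all (fun x => not_counter x.2) xs -> (0 < H)%N -> (n + size xs <= H)%N ->
  var s vN = n ->
  runs H (size xs) (emit xs) s (fun s' =>
    [/\ frame [:: vN] s s', var s' vN = (n + size xs)%N,
       (forall a, a \notin [:: 0%N; 1%N] -> arr s' a = arr s a) &
       tokens s' (n + size xs)%N =
         tokens s n ++ [seq (x.1, atom_sem s x.2) | x <- xs]]).
Proof.
elim: xs n s => [|[g u] xs IHxs] n s /=.
  move=> _ _ _ sn; apply: runs_nil; split=> //; first by rewrite addn0.
  by rewrite cats0 addn0.
move=> /andP[u0 xs0] H0 nH sn; rewrite /emit /=.
do 2! eapply runs_write; eapply runs_arith => //=; rewrite ?sn.
  by move: nH; clear; lia.
apply: runs_weaken (IHxs n.+1 _ xs0 H0 _ _) => //; last first.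
- by rewrite /= -PoszD addn1.
- by rewrite addSnnS.
move=> s' [fr s'N ar tk]; rewrite addnS -addSn; split=> //.
- move=> x x0; rewrite fr //=; case: eqP => // xE.
  by rewrite xE in x0.
- move=> a; rewrite !inE negb_or => /andP[a0 a1].
  rewrite ar ?inE ?negb_or ?a0 ?a1 //=.
  by apply/funext => j; rewrite (negbTE a0) (negbTE a1).
- rewrite tk /tokens -[in LHS](addn1 n) iotaD map_cat -catA /= add0n; congr (_ ++ _).
    apply/eq_in_map => k; rewrite mem_iota add0n => kn /=.
    by rewrite !eqz_nat !ltn_eqF.
  rewrite /= !eqxx /=; congr ((_, _) :: _).
  clear -xs0; elim: xs xs0 => //= -[g' u'] xs IHxs /andP[u'0 /IHxs ->].
  by congr ((_, _) :: _); case: u' u'0 => //= x /negbTE ->.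
Qed.

(** The tokens written so far leave one value on the stack, the partial sum; each later group of
    tokens ends with an addition to it. [B] bounds the number of tokens and so the counter. *)
Definition emitted (B : nat) (s : state) (F : {fraction {poly rat}}) :=
  exists n : nat, [/\ var s vN = n, (n <= B)%N &
    foldl token_sem (Some [::]) (tokens s n) = Some [:: F]].

Lemma runs_emit_sem (H B : nat) xs s F G :
  all (fun x => not_counter x.2) xs -> (0 < H)%N -> (B + size xs <= H)%N ->
  emitted B s F ->
  foldl token_sem (Some [:: F]) [seq (x.1, atom_sem s x.2) | x <- xs] =
    Some [:: G] ->
  runs H (size xs) (emit xs) s (fun s' =>
    [/\ frame [:: vN] s s',
       (forall a, a \notin [:: 0%N; 1%N] -> arr s' a = arr s a) &
       emitted (B + size xs) s' G]).
Proof.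
move=> xs0 H0 BH [n [sn nB tk]] sem.
apply: (runs_weaken (leqnn _) _ (@runs_emit H n xs s xs0 H0 _ sn)); last first.
  by apply: leq_trans BH; rewrite leq_add2r.
move=> s' [fr s'n ar tk']; split=> //.
exists (n + size xs)%N; split=> //; first by rewrite leq_add2r.
by rewrite tk' foldl_cat tk.
Qed.

(** The w_n(x) of the overview as a function of y = ax, so that it can also be taken at the roots
    y_j. *)
Definition vweight (p : nat) (a : int) (l : seq int) (n : nat) (y : int) : int :=
  \sum_(1 <= m < n.+1) ((congr_count (p%:Z ^+ m) y l)%:Z +
    (if (p%:Z ^+ m %| a)%Z then 1 - (size l)%:Z else 0)).

Lemma vweightS p a l n y : vweight p a l n.+1 y =
  vweight p a l n y + ((congr_count (p%:Z ^+ n.+1) y l)%:Z +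
    (if (p%:Z ^+ n.+1 %| a)%Z then 1 - (size l)%:Z else 0)).
Proof. by rewrite /vweight big_nat_recr. Qed.

Lemma vweight0 p a l y : vweight p a l 0 y = 0.
Proof. by rewrite /vweight big_geq. Qed.

Lemma vweight_bound p a l n y :
  (0 < size l)%N -> (`|vweight p a l n y| <= size l * n)%N.
Proof.
move=> l0; elim: n => [|n IHn]; first by rewrite vweight0.
rewrite vweightS mulnS; have := count_size (fun z => (p%:Z ^+ n.+1 %| y - z)%Z) l.
rewrite /congr_count; move: (count _ _) (size l) (vweight _ _ _ _ _) l0 IHn.
by move=> c s w; case: ifP; clear; lia.
Qed.

Lemma congr_count_eq (q y y' : int) l :
  (q %| y - y')%Z -> congr_count q y l = congr_count q y' l.
Proof.
move=> qyy'; apply: eq_count => z /=.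
have -> : y - z = (y - y') + (y' - z) by rewrite addrA subrK.
by apply: rpredDl.
Qed.

Lemma vweight_eq p a l n y y' :
  (p%:Z ^+ n %| y - y')%Z -> vweight p a l n y = vweight p a l n y'.
Proof.
move=> yy'; apply: eq_big_nat => m /andP[_ mn]; congr (_%:Z + _).
by apply: congr_count_eq; apply: dvdz_trans yy'; apply: dvdz_exp2l.
Qed.

Definition first_in_class (q : int) (l : seq int) (i : nat) : bool :=
  ~~ has (fun z => (q %| l`_i - z)%Z) (take i l).

(** * The closed expression for the zeta function *)

Section IgusaExpression.

Variables (L : fieldType) (t : L) (p : nat) (a : int) (l : seq int) (v : nat).
Local Notation q n := (p%:Z ^+ n).
Local Notation w := (vweight p a l).

(** If n >= v and p^v divides y, the congruence ac = y modulo p^(n+1) has p^v solutions c modulo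
    p^(n+1); this is their share in the change of the mean from level n to level n + 1. *)
Definition level_term (n : nat) (y : int) : L :=
  (q v)%:~R / (q n.+1)%:~R * (t ^ w n.+1 y - t ^ w n y).

(** The sum of all level terms from n on when every level adds e to the weight: a geometric series
    of ratio t^e / p, in closed form. *)
Definition tail_term (n : nat) (y : int) : L :=
  let e := Posz (congr_count (q n) y l) in
  (q v)%:~R / (q n)%:~R * t ^ w n y * (t ^ e - 1) / (p%:~R - t ^ e).

Definition root_term (K i : nat) : L :=
  \sum_(k < K | first_in_class (q (v + k).+1) l i) level_term (v + k) l`_i +
  (if first_in_class (q (v + K)) l i then tail_term (v + K) l`_i else 0).

(** The field is arbitrary because the expression is used twice: at the indeterminate of Q(T) it is
    the output of the program, at p^-s in C it is the value of the integral. *)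
Definition igusa_expr (K : nat) : L :=
  t ^ w v 0 + \sum_(i < size l | (q v %| l`_i)%Z) root_term K i.

End IgusaExpression.

(** For every level m <= v the power p^m divides a, so ax is 0 modulo p^m: the count is taken at 0,
    and every pass adds 1 - d. The next product to compare with a is prepared before each test. *)
Definition content_prog := block [::
  Assign vP #1; Assign vE #0; Assign vy #0;
  Arith vu Mul vP vp; Arith vt Div va vu; Arith vt Mul vt vu;
  While Eq vt va (block [::
    Arith vP Mul vP vp; Assign vq vP; count_prog vd;
    Arith vE Add vE vk; Arith vE Add vE #1; Arith vE Defs.Sub vE vd;
    Arith vu Mul vP vp; Arith vt Div va vu; Arith vt Mul vt vu])].

Definition content_regs := [:: vP; vE; vy; vq; vk; vj; vu; vt].

Lemma dvdz_pexp (p : nat) (a : int) n :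
  prime p -> a != 0 -> (p%:Z ^+ n %| a)%Z = (n <= logn p `|a|)%N.
Proof.
by move=> pp a0; rewrite dvdzE abszX pfactor_dvdn // absz_gt0.
Qed.

Lemma runs_content (H U p : nat) (a : int) (ys : seq int) s :
  prime p -> a != 0 -> (`|a| <= U)%N -> let v := logn p `|a| in
  let d := size ys in (0 < d)%N -> (d < H)%N ->
  (4 * p * U <= H)%N -> (d * v.+2 <= H)%N ->
  (forall i, (i < d)%N -> arr s 3 i = ys`_i) ->
  (forall z, z \in ys -> (`|z| <= U)%N) ->
  var s vp = p -> var s va = a -> var s vd = d ->
  runs H (v * (d * 7 + 9) + 4) content_prog s (fun s' =>
    [/\ frame content_regs s s', arr s' = arr s,
        var s' vP = p%:Z ^+ v & var s' vE = vweight p a ys v 0]).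
Proof.
move=> pp a0 aU v d d0 dH pUH dvH cells ysU sp sa sd.
have p1 : (1 < p)%N := prime_gt1 pp.
have U0 : (0 < U)%N by apply: leq_trans aU; rewrite absz_gt0.
have pvU n : (n <= v)%N -> (p ^ n <= U)%N.
  move=> nv; apply: leq_trans aU; apply: dvdn_leq; rewrite ?absz_gt0 //.
  by rewrite pfactor_dvdn ?absz_gt0.
have qE n : p%:Z ^+ n = (p ^ n)%N by rewrite -[in RHS]natz natrX natz.
have q0 n : 0 < p%:Z ^+ n by rewrite exprn_gt0 // ltz_nat prime_gt0.
have UpU : (U <= p * U)%N by rewrite leq_pmull // ltnW.
have [UH pH U2H pUH'] : [/\ U <= H, p <= H, U + p * U <= H & 2 * U + p * U <= H]%N.
  have : (p <= p * U)%N by rewrite leq_pmulr.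
  by move: pUH UpU; rewrite -mulnA; move: (p * U)%N; clear; split; lia.
have aH : (`|a| <= H)%N by apply: leq_trans UH.
pose I n (s' : state) :=
  [/\ (n <= v)%N /\ var s' vP = p%:Z ^+ (v - n),
      frame content_regs s s', arr s' = arr s,
      var s' vE = vweight p a ys (v - n) 0 /\ var s' vy = 0 &
      var s' vt = (a %/ p%:Z ^+ (v - n).+1)%Z * p%:Z ^+ (v - n).+1].
have tH n : (n <= v)%N ->
    (`|((a %/ p%:Z ^+ n.+1)%Z * p%:Z ^+ n.+1)%R| <= H)%N.
  move=> nv; apply: leq_trans (absz_divz_mul_le _ (q0 _)) _.
  apply: leq_trans U2H; apply: leq_add => //.
  by rewrite qE absz_nat expnS leq_mul2l pvU // orbT.
have sqH n : (n <= v)%N -> (`|(p%:Z ^+ n)%R| <= U)%N /\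
    (`|(p%:Z ^+ n * p%:Z)%R| <= p * U)%N.
  move=> nv; rewrite -exprSr !qE !absz_nat expnS.
  by rewrite leq_mul2l pvU // orbT.
have pUH2 : (p * U <= H)%N by move: U2H; clear; lia.
do 3! eapply runs_assign.
rewrite (_ : v * (d * 7 + 9) + 4 = ((v * (d * 7 + 8).+1).+1 + 0).+3)%N; last first.
  by clear; lia.
eapply runs_arith => //=; rewrite ?sp ?mul1r //; first exact: leq_trans (ltnW p1) pH.
eapply runs_arith => //=; rewrite ?sa //.
eapply runs_arith => //=.
  exact: leq_trans (absz_divz_le _ (q0 1%N)) aH.
apply: (@runs_then _ _ _ _ _ _ (I 0%N)); last first.
  move=> s1 [[_ P] fr ar [E _] _]; apply: runs_nil; rewrite subn0 in P E.
  by split.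
apply: (@runs_while _ (d * 7 + 8) _ _ _ _ I); last first.
  split=> //=; rewrite ?subnn //.
  - by frame_tac.
  - by rewrite vweight0.
move=> n s1 [[nv s1P] fr ar [s1E s1y] s1t].
have s1p : var s1 vp = p by rewrite fr.
have s1a : var s1 va = a by rewrite fr.
have s1d : var s1 vd = d by rewrite fr.
rewrite /= s1t s1a; split=> //; first by apply: tH; apply: leq_subr.
rewrite -dvdz_eq dvdz_pexp // -/v; case: ifP => [lt|ge]; last first.
  have n0 : n = 0%N by move: ge nv; clear; lia.
  by subst n.
case: n => [|n] in nv s1P s1E s1t lt *; first by rewrite subn0 ltnn in lt.
split=> //.
have nE : (v - n.+1).+1 = (v - n)%N by rewrite subnSK.
have nv' : (v - n <= v)%N by apply: leq_subr.
have [PU PpU] := sqH _ (ltnW lt); have [QU QpU] := sqH _ nv'.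
rewrite nE in lt.
rewrite (_ : d * 7 + 8 = ((d * 7 + 1) + 6).+1)%N; last by clear; lia.
eapply runs_arith; rewrite /= ?s1P ?s1p //; first by apply: leq_trans UH.
rewrite -exprSr nE.
eapply runs_assign => /=.
apply: runs_then.
  apply: (@runs_count H U d vd ys 0 (p%:Z ^+ (v - n))) => //=.
  - by move=> i id; rewrite ar cells.
  - by apply: leq_trans pUH'; rewrite leq_add2l (leq_trans QU).
move=> s2 [fr2 ar2 s2k].
have s2p : var s2 vp = p by rewrite fr2.
have s2a : var s2 va = a by rewrite fr2.
have s2d : var s2 vd = d by rewrite fr2.
have s2P : var s2 vP = p%:Z ^+ (v - n) by rewrite fr2.
have s2E : var s2 vE = vweight p a ys (v - n.+1) 0 by rewrite fr2.
rewrite take_size in s2k.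
have wS := vweightS p a ys (v - n.+1) 0.
rewrite nE dvdz_pexp // nv' -/d in wS.
have EB := @vweight_bound p a ys (v - n.+1) 0 d0.
have kB : (congr_count (p%:Z ^+ (v - n)) 0 ys <= d)%N by apply: count_size.
have EB' : (size ys * (v - n.+1) + d + 1 <= H)%N.
  apply: leq_trans dvH; rewrite !mulnS -/d; move: d0.
  have : (d * (v - n.+1) <= d * v)%N by rewrite leq_mul2l leq_subr orbT.
  by move: (d * v)%N (d * _)%N; clear; lia.
set k := congr_count _ _ _ in s2k kB wS.
set E := vweight _ _ _ _ _ in s2E wS EB.
have [e1 e2 e3 e4] : [/\ `|E| <= H, `|(E + k%:Z)%R| <= H, `|(E + k%:Z + 1)%R| <= H & k <= H]%N.
  by move: EB EB' kB; rewrite -/d; move: (d * _)%N; clear; split; lia.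
eapply runs_arith; rewrite /= ?s2E ?s2k //.
eapply runs_arith; rewrite /= //; first by apply: leq_trans dH.
eapply runs_arith; rewrite /= ?s2d //; first by apply: ltnW.
eapply runs_arith; rewrite /= ?s2P ?s2p //; first by apply: leq_trans UH.
rewrite -exprSr.
eapply runs_arith; rewrite /= ?s2a //; first by rewrite exprSr (leq_trans QpU).
eapply runs_arith; rewrite /=.
- exact: leq_trans (absz_divz_le _ (q0 _)) aH.
- by rewrite exprSr (leq_trans QpU).
apply: runs_nil; split=> //=; first by rewrite ltnW.
- do 6! (refine (@frame_set _ _ _ _ _ _ _) => //).
  apply: (frame_trans (s2 := s1)) => //.
  apply: (frame_trans (s2 := set_var (set_var s1 vP (p%:Z ^+ (v - n))) vq (p%:Z ^+ (v - n)))).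
    by frame_tac.
  by apply: frame_sub fr2; apply/allP.
- by rewrite ar2.
- by rewrite wS !addrA fr2.
Qed.

(** The entries [#0] next to operation tags are fillers. The final tag 2 adds the new term to the
    partial sum left on the stack. *)
Definition level_tokens : seq (int * atom) :=
  [:: (Posz 0, Var vP); (Posz 0, Var vq); (Posz 5, #0); (Posz 1, Var vz);
      (Posz 1, Var vw); (Posz 3, #0); (Posz 4, #0); (Posz 2, #0)].

Definition tail_tokens : seq (int * atom) :=
  [:: (Posz 0, Var vP); (Posz 0, Var vq); (Posz 5, #0); (Posz 1, Var vw);
      (Posz 4, #0); (Posz 1, Var vk); (Posz 0, #1); (Posz 3, #0); (Posz 4, #0);
      (Posz 0, Var vp); (Posz 1, Var vk); (Posz 3, #0); (Posz 5, #0);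
      (Posz 2, #0)].

(** [vr] counts the earlier roots in the class modulo [vq], so it is 0 exactly for the first root of
    a class; [vw] and [vz] are the weights before and after the level. *)
Definition root_term_prog := block [::
  Assign vq vP; Assign vw vE;
  While Le vq vM (block [::
    Arith vq Mul vq vp; count_prog vi; Assign vr vk; count_prog vd;
    Arith vz Add vw vk;
    If Eq vr #0 (emit level_tokens) Skip; Assign vw vz]);
  If Eq vr #0 (emit tail_tokens) Skip].

Definition terms_prog := block [::
  Arith vM Add vU vU; emit [:: (Posz 1, Var vE)]; Assign vi #0;
  While Lt vi vd (block [::
    Read vy 3 vi; Arith vu Div vy vP; Arith vt Mul vu vP;
    If Eq vt vy root_term_prog Skip; Arith vi Add vi #1])].

Lemma ratfun_intr_neq0 (c : int) :
  c != 0 -> (c%:~R : {fraction {poly rat}}) != 0.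
Proof.
move=> c0; rewrite -(rmorph_int (@FracField.tofrac {poly rat})) tofrac_eq0.
by rewrite -(rmorph_int (@polyC rat)) polyC_eq0 intr_eq0.
Qed.

Local Notation ratX := (('X : {poly rat})%:F).

(** The constant coefficient of X^k is 0 or 1, and p is neither. *)
Lemma ratfun_tail_neq0 (p k : nat) : prime p -> (p%:~R - ratX ^ Posz k) != 0.
Proof.
move=> pp; rewrite subr_eq0 -exprnP -tofracXn.
rewrite -(rmorph_int (@FracField.tofrac {poly rat})) tofrac_eq.
rewrite -(rmorph_int (@polyC rat)); apply/eqP => /polyP/(_ 0%N).
rewrite coefC coefXn eqxx /=; case: k => [|k] /eqP.
  by rewrite -[_%:R]/(1%:~R) eqr_int eqz_nat => /eqP p1; rewrite p1 in pp.
by rewrite -[0%:R]/(0%:~R) eqr_int eqz_nat => /eqP p0; rewrite p0 in pp.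
Qed.

Lemma level_tokens_sem (F : {fraction {poly rat}}) s : var s vq != 0 ->
  foldl token_sem (Some [:: F])
    [seq (x.1, atom_sem s x.2) | x <- level_tokens] =
  Some [:: F + (var s vP)%:~R / (var s vq)%:~R *
               (ratX ^ var s vz - ratX ^ var s vw)].
Proof. by move=> q0 /=; rewrite (negbTE (ratfun_intr_neq0 q0)). Qed.

Lemma tail_tokens_sem (F : {fraction {poly rat}}) (k p : nat) s :
  var s vq != 0 -> var s vk = k -> var s vp = p -> prime p ->
  foldl token_sem (Some [:: F])
    [seq (x.1, atom_sem s x.2) | x <- tail_tokens] =
  Some [:: F + (var s vP)%:~R / (var s vq)%:~R * ratX ^ var s vw *
               (ratX ^ var s vk - 1) / (p%:~R - ratX ^ var s vk)].
Proof.
move=> q0 sk sp pp /=; rewrite sk sp (negbTE (ratfun_intr_neq0 q0)) /=.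
by rewrite (negbTE (ratfun_tail_neq0 k pp)).
Qed.

Definition term_regs := [:: vN; vq; vw; vk; vj; vu; vt; vr; vz].

Lemma first_in_classE q l i :
  first_in_class q l i = (congr_count q l`_i (take i l) == 0%N).
Proof. by rewrite /first_in_class has_count -eqn0Ngt. Qed.

Section TermsProgram.

Variables (H U p K : nat) (a : int) (ys : seq int).
Let v := logn p `|a|.
Let d := size ys.
Hypotheses (pp : prime p) (a0 : a != 0) (aU : (`|a| <= U)%N) (d0 : (0 < d)%N).
Hypotheses (dH : (d < H)%N) (pUH : (4 * p * U <= H)%N).
Hypothesis vKH : (d * (v + K).+2 <= H)%N.
Hypothesis tokH : (1 + d * (8 * K + 14) <= H)%N.
Hypothesis ysU : forall z, z \in ys -> (`|z| <= U)%N.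
Hypothesis K_le : forall k, (k < K)%N -> (p ^ (v + k) <= 2 * U)%N.
Hypothesis K_gt : (2 * U < p ^ (v + K))%N.

Let qE n : p%:Z ^+ n = (p ^ n)%N.
Proof. by rewrite -[in RHS]natz natrX natz. Qed.

Let q0 n : 0 < p%:Z ^+ n.
Proof. by rewrite exprn_gt0 // ltz_nat prime_gt0. Qed.

Definition terms_env (s : state) :=
  [/\ var s vp = p, var s vP = p%:Z ^+ v, var s vE = vweight p a ys v 0,
      var s vM = (2 * U)%N /\ var s vd = d &
      forall i, (i < d)%N -> arr s 3 i = ys`_i].

(** 8 and 14 are the lengths of the two token lists. Each of the K levels counts congruences twice,
    over the earlier roots and over all roots, at 7 operations per root. *)
Lemma runs_root_term (B i : nat) F s :
  (i < d)%N -> (p%:Z ^+ v %| ys`_i)%Z -> (B + 8 * K + 14 <= H)%N ->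
  terms_env s -> var s vi = i -> var s vy = ys`_i -> emitted B s F ->
  runs H (K * (d * 14 + 14) + 16) root_term_prog s (fun s' =>
    [/\ frame term_regs s s', arr s' 3 = arr s 3 &
        emitted (B + 8 * K + 14) s' (F + root_term ratX p a ys v K i)]).
Proof.
move=> id vy_dvd BH [sp sP sE [sM sd] cells] si sy em.
have p1 : (1 < p)%N := prime_gt1 pp.
have U0 : (0 < U)%N by apply: leq_trans aU; rewrite absz_gt0.
have UpU : (U <= p * U)%N by rewrite leq_pmull // ltnW.
have [UH pH pUH' U2H] : [/\ U <= H, p <= H, 2 * U + 2 * (p * U) <= H & 2 * U <= H]%N.
  have : (p <= p * U)%N by rewrite leq_pmulr.
  by move: pUH UpU; rewrite -mulnA; move: (p * U)%N; clear; split; lia.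
have H0 : (0 < H)%N by apply: leq_trans UH.
set y := ys`_i in vy_dvd sy *.
have yU : (`|y| <= U)%N by apply/ysU/mem_nth.
have qB k : (k < K)%N -> (`|(p%:Z ^+ (v + k).+1)%R| <= 2 * (p * U))%N.
  by move=> kK; rewrite qE absz_nat expnS mulnCA leq_mul2l K_le // orbT.
have qkH k : (k <= K)%N -> (`|(p%:Z ^+ (v + k))%R| <= H)%N.
  case: k => [|k] kK.
    rewrite addn0 qE absz_nat (leq_trans _ UH) // (leq_trans _ aU) //.
    by apply: dvdn_leq; rewrite ?absz_gt0 // pfactor_dvdn ?absz_gt0.
  by rewrite addnS; apply: leq_trans (qB k kK) _; move: pUH'; clear; lia.
have wH n : (n <= v + K)%N ->
    (`|vweight p a ys n y| + d <= H)%N.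
  move=> nK; apply: leq_trans vKH; rewrite mulnS addnC leq_add2l.
  apply: leq_trans (vweight_bound _ _ _ _ d0) _; rewrite leq_mul2l.
  by rewrite (leq_trans nK) ?orbT.
(* As p^v <= |a| <= U, the loop makes at least one pass; hence [vr] and [vk] are set when the tail
   reads them. *)
have K0 : (0 < K)%N.
  rewrite lt0n; apply/eqP => K0; move: K_gt; rewrite K0 addn0.
  have : (p ^ v <= U)%N.
    rewrite (leq_trans _ aU) //.
    by apply: dvdn_leq; rewrite ?absz_gt0 // pfactor_dvdn ?absz_gt0.
  by move: (p ^ v)%N; clear; lia.
(* The weight in [vE] was computed at 0; since p^v divides y, it is also the weight at y. *)
have wE : vweight p a ys v 0 = vweight p a ys v y.
  by apply: vweight_eq; rewrite sub0r rpredN.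
pose Fk k := F + \sum_(k' < k | first_in_class (p%:Z ^+ (v + k').+1) ys i)
                   level_term ratX p a ys v (v + k') y.
pose I n (s' : state) :=
  [/\ (n <= K)%N, frame term_regs s s', arr s' 3 = arr s 3,
     emitted (B + 8 * (K - n)) s' (Fk (K - n)%N) &
     [/\ var s' vq = p%:Z ^+ (v + (K - n)),
         var s' vw = vweight p a ys (v + (K - n)) y &
         (n < K)%N ->
           var s' vr = congr_count (p%:Z ^+ (v + (K - n))) y (take i ys) /\
           var s' vk = congr_count (p%:Z ^+ (v + (K - n))) y ys]].
do 2! eapply runs_assign.
rewrite (_ : K * (d * 14 + 14) + 16 = (K * (d * 14 + 13).+1).+1 + (15 + 0))%N; last first.
  by clear; lia.
apply: (@runs_then _ _ _ _ _ _ (I 0%N)); last first.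
  move=> s1 [_ fr ar em1 [s1q s1w /(_ K0)[s1r s1k]]].
  rewrite subn0 in em1 s1q s1w s1r s1k.
  have s1p : var s1 vp = p by rewrite fr.
  have s1P : var s1 vP = p%:Z ^+ v by rewrite fr.
  apply: (@runs_then _ _ _ _ _ _ (fun s' =>
      [/\ frame term_regs s s', arr s' 3 = arr s 3 &
        emitted (B + 8 * K + 14) s' (F + root_term ratX p a ys v K i)]));
    last by move=> s2 [fr2 ar2 em2]; apply: runs_nil.
  eapply runs_if => //=; rewrite ?s1r.
    apply: leq_trans (count_size _ _) _; rewrite size_takel ?(ltnW id) //.
    by apply: ltnW; apply: ltn_trans dH.
  rewrite eqz_nat -first_in_classE /root_term addrA -/(Fk K).
  case: ifP => fic; last first.
    apply: (@runs_leq _ 0) => //; apply: runs_skip; split=> //.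
    case: em1 => n [s1n nB tk]; exists n; split=> //; last by rewrite fic addr0.
    by apply: leq_trans nB _; rewrite leq_addr.
  have q1 : var s1 vq != 0 by rewrite s1q lt0r_neq0.
  have sem := tail_tokens_sem (Fk K) q1 s1k s1p pp.
  rewrite s1P s1q s1w s1k in sem; rewrite fic.
  eapply runs_weaken;
    [| |exact: (@runs_emit_sem H _ tail_tokens s1 _ _ isT H0 BH em1 sem)] => //.
  move=> s2 [fr2 ar2 em2]; split=> //; last by rewrite ar2.
  by apply: frame_trans fr (frame_sub _ fr2); apply/allP.
apply: (@runs_while _ (d * 14 + 13) _ _ _ _ I); last first.
  split=> //=; rewrite ?subnn //.
  - by frame_tac.
  - by rewrite /Fk big_ord0 addr0 muln0 addn0.
  - by rewrite addn0 sP sE wE ltnn.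
move=> n s1 [nK fr ar em1 [s1q s1w s1rk]] /=.
have s1p : var s1 vp = p by rewrite fr.
have s1P : var s1 vP = p%:Z ^+ v by rewrite fr.
have s1M : var s1 vM = (2 * U)%N by rewrite fr.
have s1d : var s1 vd = d by rewrite fr.
have s1i : var s1 vi = i by rewrite fr.
have s1y : var s1 vy = y by rewrite fr.
have nK' : (K - n <= K)%N by apply: leq_subr.
rewrite s1q s1M; split; [exact: qkH|by []|].
rewrite qE lez_nat; case: ifP => [lt|ge]; last first.
  have n0 : n = 0%N.
    case: n nK ge {em1 s1q s1w s1rk nK'} => // n nK.
    by rewrite K_le // ltn_subrL K0.
  by subst n.
case: n => [|n] in nK em1 s1q s1w lt nK' {s1rk} *.
  by move: lt; rewrite subn0 leqNgt K_gt.
split=> //=.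
set k := (K - n.+1)%N in em1 s1q s1w lt nK'.
have kE : (K - n = k.+1)%N by rewrite /k subnSK.
have kK : (k < K)%N by rewrite /k ltn_subrL.
rewrite (_ : d * 14 + 13 =
  ((d * 7 + 1) + ((d * 7 + 1) + (9 + 0).+1)).+1)%N; last by clear; lia.
have qH := qkH k nK'; have q1B := qB k kK.
eapply runs_arith; rewrite /= ?s1q ?s1p //.
rewrite -exprSr.
have YH : (2 * U + `|(p%:Z ^+ (v + k).+1)%R| <= H)%N.
  by apply: leq_trans pUH'; rewrite leq_add2l.
apply: runs_then.
  apply: (@runs_leq _ (i * 7 + 1)); first by rewrite leq_add2r leq_mul2r ltnW.
  apply: (@runs_count H U i vi ys y (p%:Z ^+ (v + k).+1)) => //=.
  - exact: ltnW.
  - by apply: ltn_trans dH.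
  - by move=> j ji; rewrite ar cells //; apply: ltn_trans id.
move=> s2 [fr2 ar2 s2k]; eapply runs_assign => /=; rewrite s2k.
set r := congr_count _ _ _.
apply: runs_then.
  apply: (@runs_count H U d vd ys y (p%:Z ^+ (v + k).+1)) => //=.
  - by rewrite fr2.
  - by move=> j jd; rewrite ar2 ar cells.
  - by rewrite fr2.
  - by rewrite fr2.
move=> s3 [fr3 ar3]; rewrite take_size; set c := congr_count _ _ _ => s3k.
have s3w : var s3 vw = vweight p a ys (v + k) y by rewrite fr3 //= fr2.
have s3P : var s3 vP = p%:Z ^+ v by rewrite fr3 //= fr2.
have s3q : var s3 vq = p%:Z ^+ (v + k).+1 by rewrite fr3 //= fr2.
have s3r : var s3 vr = r by rewrite fr3.
have wS : vweight p a ys (v + k) y + c = vweight p a ys (v + k).+1 y.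
  by rewrite vweightS dvdz_pexp // ltnNge leq_addr addr0.
have cd : (c <= d)%N by apply: count_size.
have rH : (r <= H)%N.
  apply: leq_trans (count_size _ _) _; rewrite size_takel ?(ltnW id) //.
  by apply: ltnW; apply: ltn_trans dH.
have wkH := wH (v + k)%N ltac:(by rewrite leq_add2l).
eapply runs_arith; rewrite /= ?s3w ?s3k.
- by apply: leq_trans wkH; rewrite leq_addr.
- exact: leq_trans cd (ltnW dH).
rewrite wS; set s4 := set_var _ _ _.
have fr4 : frame term_regs s s4.
  refine (@frame_set _ _ _ _ _ _ _) => //.
  apply: (frame_trans (s2 := set_var s2 vr r)); last first.
    by apply: frame_sub fr3; apply/allP.
  refine (@frame_set _ _ _ _ _ _ _) => //.
  apply: (frame_trans (s2 := set_var s1 vq (p%:Z ^+ (v + k).+1))).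
    by frame_tac.
  by apply: frame_sub fr2; apply/allP.
have ar4 : arr s4 3 = arr s 3 by rewrite /= ar3 /= ar2.
have em4 : emitted (B + 8 * k) s4 (Fk k).
  case: em1 => m [s1m mB tk]; exists m; split=> //.
    by rewrite /= fr3 //= fr2.
  by rewrite -tk /tokens /= ar3 /= ar2.
have BH' : (B + 8 * k + size level_tokens <= H)%N.
  by apply: leq_trans BH; move: kK; clear; rewrite /=; lia.
apply: (@runs_then _ _ _ _ _ _ (fun s' =>
    [/\ frame [:: vN] s4 s', arr s' 3 = arr s 3 &
      emitted (B + 8 * k.+1) s' (Fk k.+1)])).
  eapply runs_if; rewrite /= ?s3r //.
  have FS G : G = Fk k + (if first_in_class (p%:Z ^+ (v + k).+1) ys i then
                     level_term ratX p a ys v (v + k) y else 0) -> Fk k.+1 = G.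
    by move=> ->; rewrite /Fk big_mkcond big_ord_recr -big_mkcond addrA.
  rewrite eqz_nat -first_in_classE; case: ifP => fic; last first.
    apply: (@runs_leq _ 0) => //; apply: runs_skip; split=> //.
    rewrite (FS (Fk k)) ?fic ?addr0 //.
    case: em4 => m [s4m mB tk]; exists m; split=> //.
    by apply: leq_trans mB _; rewrite leq_add2l leq_mul2l leqnSn orbT.
  rewrite mulnS [(8 + _)%N]addnC addnA.
  have q1 : var s4 vq != 0 by rewrite /= s3q lt0r_neq0.
  have sem := level_tokens_sem (Fk k) q1.
  eapply runs_weaken; 
    [| |exact: (@runs_emit_sem H _ level_tokens s4 _ _ isT H0 BH' em4 sem)] => //.
  move=> s5 [fr5 ar5 em5]; split=> //; first by rewrite ar5.
  by move: em5; rewrite /= s3P s3q s3w (FS _ erefl) fic.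
move=> s5 [fr5 ar5 em5].
have s5z : var s5 vz = vweight p a ys (v + k).+1 y by rewrite fr5.
eapply runs_assign; apply: runs_nil; rewrite /= s5z; split.
- exact: ltnW.
- refine (@frame_set _ _ _ _ _ _ _) => //; apply: frame_trans fr4 _.
  by apply: frame_sub fr5; apply/allP.
- by rewrite /= ar5.
- by rewrite kE.
- by rewrite kE !addnS /= !fr5 //= s3q s3r s3k.
Qed.

Lemma runs_terms s :
  (forall i, (i < d)%N -> arr s 3 i = ys`_i) ->
  var s vp = p -> var s vP = p%:Z ^+ v -> var s vE = vweight p a ys v 0 ->
  var s vd = d -> var s vU = U -> var s vN = 0 ->
  runs H (d * (K * (d * 14 + 14) + 21) + 3) terms_prog s (fun s' =>
    emitted (1 + d * (8 * K + 14)) s' (igusa_expr ratX p a ys v K)).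
Proof.
move=> cells sp sP sE sd sU sN.
have U0 : (0 < U)%N by apply: leq_trans aU; rewrite absz_gt0.
have UpU : (U <= p * U)%N by rewrite leq_pmull // prime_gt0.
have [UH U2H] : (U <= H /\ 2 * U <= H)%N.
  by move: pUH UpU; rewrite -mulnA; move: (p * U)%N; clear; split; lia.
have H0 : (0 < H)%N by apply: leq_trans UH.
pose Fi i := ratX ^ vweight p a ys v 0 +
  \sum_(j < i | (p%:Z ^+ v %| ys`_j)%Z) root_term ratX p a ys v K j.
pose I n (s' : state) :=
  [/\ (n <= d)%N, var s' vi = (d - n)%N, terms_env s' &
      emitted (1 + (d - n) * (8 * K + 14)) s' (Fi (d - n)%N)].
rewrite (_ : _ + 3 = (1 + ((d * (K * (d * 14 + 14) + 20).+1).+1 + 0)).+1)%N;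
  last by clear; lia.
eapply runs_arith; rewrite /= ?sU // -PoszD.
apply: (@runs_then _ _ _ _ _ _ (fun s' => [/\ terms_env s' &
    emitted 1 s' (ratX ^ vweight p a ys v 0)])).
  apply: (runs_weaken (leqnn _) _
      (@runs_emit H 0 [:: (Posz 1, Var vE)] _ isT H0 H0 _)); last by [].
  move=> s1 [fr s1N ar tk]; split.
    split; rewrite ?fr //=.
      by rewrite mul2n -addnn.
    by move=> i id; rewrite ar //= cells.
  by exists 1%N; split=> //; rewrite tk /= sE.
move=> s1 [env1 em1]; eapply runs_assign => /=.
apply: (@runs_then _ _ _ _ _ _ (I 0%N)); last first.
  by move=> s2 [_ _ _ em2]; apply: runs_nil; rewrite subn0 in em2.
apply: (@runs_while _ (K * (d * 14 + 14) + 20) _ _ _ _ I); last first.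
  split=> //=; rewrite ?subnn ?mul0n ?addn0 //.
  by rewrite /Fi big_ord0 addr0.
move=> n s2 [nd s2i env2 em2].
have [s2p s2P s2E [s2M s2d] cells2] := env2.
have dnd : (d - n <= d)%N by apply: leq_subr.
rewrite /= s2i s2d; split.
- by apply: leq_trans (ltnW dH).
- exact: ltnW.
rewrite ltz_nat; case: ifP => [lt|ge]; last first.
  have n0 : n = 0%N by move: ge nd; clear; lia.
  by subst n.
case: n => [|n] in nd s2i em2 lt dnd *; first by rewrite subn0 ltnn in lt.
split=> //=; set i := (d - n.+1)%N in s2i em2 lt dnd.
have iE : (d - n = i.+1)%N by rewrite /i subnSK.
have yU : (`|(ys`_i)%R| <= U)%N by apply/ysU/mem_nth.
have qHn : (`|(p%:Z ^+ v)%R| <= U)%N.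
  rewrite qE absz_nat (leq_trans _ aU) //.
  by apply: dvdn_leq; rewrite ?absz_gt0 // pfactor_dvdn ?absz_gt0.
rewrite (_ : _ + 20 = ((K * (d * 14 + 14) + 16).+1 + (1 + 0)).+2)%N;
  last by clear; lia.
eapply runs_read; rewrite /= s2i cells2 //.
eapply runs_arith; rewrite /= ?s2P.
- exact: leq_trans yU UH.
- exact: leq_trans qHn UH.
eapply runs_arith; rewrite /= ?s2P.
- by apply: leq_trans (absz_divz_le _ (q0 _)) (leq_trans yU UH).
- exact: leq_trans qHn UH.
set s3 := set_var _ _ _.
have em3 : emitted (1 + i * (8 * K + 14)) s3 (Fi i) by [].
have env3 : terms_env s3 by split.
apply: (@runs_then _ _ _ _ _ _ (fun s' => [/\ var s' vi = i, terms_env s' &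
    emitted (1 + i.+1 * (8 * K + 14)) s' (Fi i.+1)])).
  have FS : Fi i.+1 = Fi i + (if (p%:Z ^+ v %| ys`_i)%Z then
      root_term ratX p a ys v K i else 0).
    by rewrite /Fi big_mkcond big_ord_recr -big_mkcond addrA.
  have leB : (1 + i * (8 * K + 14) + 8 * K + 14 = 1 + i.+1 * (8 * K + 14))%N.
    by rewrite mulSn; clear; lia.
  eapply runs_if; rewrite /=.
  - apply: leq_trans (absz_divz_mul_le _ (q0 _)) _.
    by apply: leq_trans U2H; rewrite mul2n -addnn leq_add.
  - exact: leq_trans yU UH.
  rewrite -dvdz_eq; case: ifP => vy_dvd; last first.
    apply: (@runs_leq _ 0) => //; apply: runs_skip; split=> //.
    rewrite FS vy_dvd addr0; case: em3 => m [s3m mB tk]; exists m; split=> //.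
    by apply: leq_trans mB _; rewrite leq_add2l leq_mul2r leqnSn orbT.
  have BH : (1 + i * (8 * K + 14) + 8 * K + 14 <= H)%N.
    by rewrite leB (leq_trans _ tokH) // leq_add2l leq_mul2r lt orbT.
  eapply runs_weaken; [| |exact: (runs_root_term lt vy_dvd BH env3 s2i _ em3)] => //.
    move=> s4 [fr4 ar4 em4]; split; first by rewrite fr4.
      by split; rewrite ?fr4 //; move=> j jd; rewrite ar4 cells2.
    by rewrite -leB FS vy_dvd.
move=> s4 [s4i env4 em4]; eapply runs_arith; rewrite /= ?s4i //.
  exact: leq_trans dnd (ltnW dH).
apply: runs_nil; split; rewrite /= ?iE -?PoszD ?addn1 //.
exact: ltnW.
Qed.

End TermsProgram.

(** * Integrality and size of the scaled roots *)

Lemma coef_comp_scaleX (R : comNzRingType) (g : {poly R}) (c : R) i :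
  (g \Po (c *: 'X))`_i = g`_i * c ^+ i.
Proof.
rewrite comp_polyE coef_sum.
under eq_bigr do rewrite exprZn scalerA coefZ coefXn.
have [ig|gi] := ltnP i (size g).
  rewrite (bigD1 (Ordinal ig)) //= eqxx mulr1 big1 ?addr0 // => j ji.
  by rewrite -val_eqE eq_sym in ji; rewrite (negbTE ji) mulr0.
rewrite (nth_default _ gi) mul0r big1 // => j _.
by rewrite gtn_eqF ?mulr0 // (leq_trans (ltn_ord j)).
Qed.

Lemma comp_scaleX_inj (R : idomainType) (c : R) :
  c != 0 -> injective (fun g : {poly R} => g \Po (c *: 'X)).
Proof.
move=> c0 g h gh; apply/polyP => i; apply: (@mulIf _ (c ^+ i)).
  by rewrite expf_neq0.
by rewrite -!coef_comp_scaleX gh.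
Qed.

(** The defining property g = a^(d-1) f(X/a), with X replaced by aX so that it makes sense over the
    integers. *)
Lemma monic_scale_comp (f : {poly int}) : (1 < size f)%N ->
  monic_scale f \Po (lead_coef f *: 'X) = lead_coef f ^+ (size f).-2 *: f.
Proof.
move=> sf; have dE : (size f).-1 = (size f).-2.+1 by case: (size f) sf => [|[]].
apply/polyP => i; rewrite coef_comp_scaleX coefZ coefD coefXn coef_poly dE.
case: (ltngtP i (size f).-2.+1) => [lt|gt|->].
- by rewrite add0r -mulrA -exprD subnK // mulrC.
- by rewrite addr0 mul0r nth_default ?mulr0 // (leq_trans _ gt) // -dE; case: (size f) sf.
- by rewrite addr0 mul1r exprSr lead_coefE dE.
Qed.

Lemma monic_scale_horner (R : comNzRingType) (f : {poly int}) (x : R) :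
  (1 < size f)%N ->
  (map_poly intr (monic_scale f)).[(lead_coef f)%:~R * x] =
  (lead_coef f)%:~R ^+ (size f).-2 * (map_poly intr f).[x].
Proof.
move=> sf; have := congr1 (map_poly (intr : int -> R)) (monic_scale_comp sf).
rewrite map_comp_poly !map_polyZ /= map_polyX => /(congr1 (horner^~ x)).
by rewrite horner_comp !hornerZ hornerX rmorphXn.
Qed.

Lemma monic_scale_monic (f : {poly int}) : monic_scale f \is monic.
Proof.
rewrite monicE lead_coefDl ?lead_coefXn // size_polyXn ltnS.
exact: size_poly.
Qed.

(** By Gauss's lemma the factor X - y is a rational multiple of an integer polynomial dividing g. As
    g is monic, the leading coefficient of that polynomial is a unit, so the multiplier is an
    integer and y is one too. *)
Lemma rat_root_monic_int (g : {poly int}) (y : rat) :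
  g \is monic -> root (map_poly intr g) y -> y = (numq y)%:~R.
Proof.
move=> mg; rewrite -dvdp_XsubCl => /dvdpP_rat_int[p1 [c c0 Xy] [r gE]].
have sp1 : size p1 = 2.
  have := congr1 (size \o polyseq) Xy; rewrite /= size_XsubC size_scale //.
  by rewrite size_map_inj_poly //; exact: intr_inj.
have u1 : p1`_1 * lead_coef r = 1.
  have := monicP mg; rewrite gE lead_coefM => <-; congr (_ * _).
  by rewrite lead_coefE sp1.
have c1 : 1 = c * (p1`_1)%:~R :> rat.
  have := congr1 (fun q : {poly rat} => q`_1) Xy.
  by rewrite coefZ coef_map coefB coefX coefC subr0.
have cE : c = (lead_coef r)%:~R.
  by rewrite -[c]mulr1 -[1 in LHS](rmorph1 (intr : int -> rat)) -u1 rmorphM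
    mulrA -c1 mul1r.
have := congr1 (fun q : {poly rat} => q`_0) Xy.
rewrite coefZ coef_map coefB coefX coefC sub0r cE /= -rmorphM => /eqP.
by rewrite eqr_oppLR -rmorphN => /eqP ->; rewrite numq_int.
Qed.

(** At a root, |y|^d <= S sum |y|^i |a|^(d-1-i). Multiplying by |y| - |a| collapses the sum and
    gives (|y| - |a|) |y|^d <= S (|y|^d - |a|^d), which is impossible if |y| - |a| > S; and |a| <=
    S. *)
Lemma monic_scale_root_bound (f : {poly int}) (y : int) :
  (1 < size f)%N -> root (monic_scale f) y -> (`|y| <= 2 * sumsq f)%N.
Proof.
move=> sf /rootP; rewrite hornerD hornerXn horner_poly.
set d := (size f).-1; set a := lead_coef f => /eqP.
rewrite addr_eq0 => /eqP yE; set S := sumsq f.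
have fS i : `|f`_i| <= S%:Z by rewrite -abszE lez_nat coef_le_sumsq.
have aS : `|a| <= S%:Z by apply: fS.
suff : `|y| <= 2 * S%:Z by rewrite -abszE -[2]/(Posz 2) -PoszM lez_nat.
rewrite leNgt; apply/negP => yS.
have y0 : 0 < `|y| by apply: le_lt_trans yS; rewrite mulr_ge0.
have ya : 0 <= `|y| - `|a| by move: yS aS; clear; lia.
have le1 : `|y| ^+ d <= S%:Z * \sum_(i < d) `|y| ^+ i * `|a| ^+ (d.-1 - i).
  rewrite -normrX yE normrN mulr_sumr; apply: le_trans (ler_norm_sum _ _ _) _.
  apply: ler_sum => i _; rewrite !normrM !normrX -mulrA [X in _ * X <= _]mulrC.
  by rewrite ler_wpM2r // mulr_ge0 // exprn_ge0.
have := ler_wpM2l ya le1.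
have sE : \sum_(i < d) `|y| ^+ i * `|a| ^+ (d.-1 - i) =
          \sum_(i < d) `|y| ^+ (d.-1 - i) * `|a| ^+ i.
  rewrite (reindex_inj rev_ord_inj) /=; apply: eq_bigr => i _.
  by congr (_ ^+ _ * _ ^+ _); have := ltn_ord i; clear; lia.
rewrite mulrCA sE -subrXX.
have yd0 : 0 < `|y| ^+ d by rewrite exprn_gt0.
have ad0 : 0 <= `|a| ^+ d by rewrite exprn_ge0.
apply/negP; rewrite -ltNge.
apply: (@le_lt_trans _ _ (S%:Z * `|y| ^+ d)).
  by rewrite ler_wpM2l // gerBl.
by rewrite ltr_pM2r //; move: yS aS; clear; lia.
Qed.

(** If f splits over Q with roots z, then a^(d-1) f(X/a) splits with roots az, which are integers
    because the polynomial is monic. *)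
Lemma splitting_integer_roots (f : {poly int}) :
  (1 < size f)%N ->
  splittingFieldFor 1%VS (map_poly intr f : {poly rat^o}) fullv ->
  exists2 l : seq int, monic_scale f = roots_poly l & size l = (size f).-1.
Proof.
move=> sf [rs fE _]; have {fE} : map_poly intr f =
    (lead_coef f)%:~R *: \prod_(z <- rs) ('X - z%:P) :> {poly rat}.
  have := eqp_eq fE; rewrite (monicP (monic_prod_XsubC _ _ _)) scale1r => ->.
  by rewrite lead_coef_map_inj //; exact: intr_inj.
set a : rat := (lead_coef f)%:~R => fE.
have a0 : a != 0 by rewrite intr_eq0 lead_coef_eq0 -size_poly_gt0 ltnW.
have dE : (size f).-1 = (size f).-2.+1 by case: (size f) sf => [|[]].
have srs : size rs = (size f).-1.
  have := congr1 (size \o polyseq) fE; rewrite /= size_scale // size_prod_XsubC.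
  by rewrite size_map_inj_poly ?rmorph0 => [->||] //; exact: intr_inj.
have prodE : \prod_(z <- rs) ('X - (a * z)%:P) \Po (a *: 'X) =
    a ^+ size rs *: \prod_(z <- rs) ('X - z%:P) :> {poly rat}.
  elim: rs {fE srs} => [|z rs IHrs]; first by rewrite !big_nil comp_polyC scale1r.
  rewrite !big_cons comp_polyM IHrs comp_polyB comp_polyX comp_polyC exprS.
  by rewrite polyCM mul_polyC -scalerBr -scalerAl -scalerAr scalerA.
have gE : map_poly intr (monic_scale f) = \prod_(z <- rs) ('X - (a * z)%:P).
  apply: (comp_scaleX_inj a0); rewrite /= prodE.
  have := congr1 (map_poly (intr : int -> rat)) (monic_scale_comp sf).
  rewrite map_comp_poly !map_polyZ /= map_polyX -/a => ->.
  by rewrite fE scalerA rmorphXn -exprSr srs dE.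
exists [seq numq (a * z) | z <- rs]; last by rewrite size_map.
apply: (map_inj_poly (f := intr : int -> rat)) => //; first exact: intr_inj.
rewrite gE /roots_poly rmorph_prod /= big_map; apply: eq_big_seq => z zrs.
rewrite rmorphB /= map_polyX map_polyC /= -(rat_root_monic_int (monic_scale_monic f)) //.
rewrite gE -(big_map (fun z => a * z) xpredT (fun y => 'X - y%:P)).
by rewrite root_prod_XsubC map_f.
Qed.

(** * The program and its cost *)

Definition igusa_prog := block [:: setup_prog; roots_prog; content_prog; terms_prog].

(** The exponent covers the bound (U+1)^(2d+1) of Newton's method, where U + 1 <= 2^(L+1). The
    factor p covers p U and the powers of p, the last of which may exceed 2U by a factor of up to
    p. *)
Definition operand_bound (p d L : nat) : nat := (p * 2 ^ (L.+4 * (2 * d).+1))%N.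

(** Newton's method dominates: d roots, O(d L) steps for each, O(d) operations per step. *)
Definition time_bound (d L : nat) : nat := (200 * (d ^ 3 * L.+4))%N.

Lemma emitted_output B s F : emitted B s F -> output s = Some F.
Proof. by case=> n [sn _ tk]; rewrite /output sn /postfix_sem -/(tokens s n) tk. Qed.

Lemma newton_cost_le d L : (0 < d)%N -> (newton_cost d L.+2 <= 33 * (d ^ 2 * L.+4))%N.
Proof.
move=> d0; rewrite /newton_cost expnS expn1.
have h1 : (d <= d * d)%N by rewrite leq_pmulr.
have h2 : (d * d <= d * d * L.+4)%N by rewrite leq_pmulr.
have h3 : (d * L.+4 <= d * d * L.+4)%N by rewrite leq_mul2r h1 orbT.
have -> : ((d * L.+2 + 2 * d) * (d.+1 * 6 + 6) + d.+1 * 6 + 3 =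
  6 * (d * d * L.+4) + 12 * (d * L.+4) + 6 * d + 9)%N by lia.
by move: (d * d * L.+4)%N (d * L.+4)%N (d * d)%N h1 h2 h3 d0; clear; lia.
Qed.

Lemma total_cost_le d L v K : (0 < d)%N -> (v <= L)%N -> (K <= L.+2)%N ->
  ((d * 6 + 3) + ((d * (newton_cost d L.+2 + d * 4 + 3) + 1) +
   ((v * (d * 7 + 9) + 4) + ((d * (K * (d * 14 + 14) + 21) + 3) + 0))) <=
  time_bound d L)%N.
Proof.
move=> d0 vL KL; rewrite /time_bound.
have h0 := newton_cost_le L d0.
set X := (d ^ 3 * L.+4)%N.
have e1 : (d * (d ^ 2 * L.+4) = X)%N by rewrite mulnA -expnS.
have h1 : (d <= d ^ 2)%N by rewrite -mulnn leq_pmulr.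
have h2 : (d ^ 2 <= d ^ 3)%N by rewrite leq_pexp2l.
have h3 : (d ^ 3 <= X)%N by rewrite leq_pmulr.
have h4 : (d * L.+4 <= X)%N by rewrite leq_mul2r (leq_trans h1 h2) orbT.
have h5 : (d ^ 2 * L.+4 <= X)%N by rewrite leq_mul2r h2 orbT.
have a1 : (d * (newton_cost d L.+2 + d * 4 + 3) <= 33 * X + 4 * d ^ 2 + 3 * d)%N.
  rewrite -e1 !mulnDr -mulnn; have := leq_mul (leqnn d) h0.
  by move: (newton_cost _ _) => c; lia.
have a2 : (v * (d * 7 + 9) <= 16 * X)%N.
  apply: (@leq_trans (L.+4 * (16 * d))); first by rewrite leq_mul //; lia.
  by move: h4; lia.
have a3 : (d * (K * (d * 14 + 14) + 21) <= 28 * X + 21 * d)%N.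
  have : (K * (d * 14 + 14) <= L.+4 * (28 * d))%N by rewrite leq_mul //; lia.
  by move=> /(leq_mul (leqnn d)); move: h5; rewrite -mulnn; lia.
move: a1 a2 a3 h1 h2 h3 d0; move: (d * (_ + 3))%N (v * _)%N (d * (_ + 21))%N.
clearbody X.
by move: (d ^ 2)%N (d ^ 3)%N; clear; lia.
Qed.

Lemma leq_operand_bound (p d L e : nat) :
  (0 < p)%N -> (e <= L.+4 * (2 * d).+1)%N -> (2 ^ e <= operand_bound p d L)%N.
Proof.
by move=> p0 le; apply: leq_trans (leq_pmull _ p0); rewrite leq_pexp2l.
Qed.

Lemma runs_igusa_prog (p : nat) (f : {poly int}) :
  prime p -> (1 < size f)%N ->
  splittingFieldFor 1%VS (map_poly intr f : {poly rat^o}) fullv ->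
  let d := (size f).-1 in let L := (trunc_log 2 (sumsq f)).+1 in
  runs (operand_bound p d L) (time_bound d L) igusa_prog (input_state p f)
    (fun s' => exists (l : seq int) (K : nat),
      let v := logn p `|lead_coef f| in
      [/\ monic_scale f = roots_poly l, size l = (size f).-1,
          forall k y z, (K <= k)%N -> y \in l -> z \in l ->
            (p%:Z ^+ (v + k) %| y - z)%Z -> y = z &
          output s' = Some (igusa_expr (('X : {poly rat})%:F) p (lead_coef f) l v K)]).
Proof.
move=> pp sf split_f d L.
have [l gE sl] := splitting_integer_roots sf split_f.
set S := sumsq f; pose U := (2 * S)%N; set a := lead_coef f.
have lU y : y \in l -> (`|y| <= U)%N.
  move=> yl; apply: monic_scale_root_bound => //.
  by rewrite gE root_prod_XsubC.
have a0 : a != 0 by rewrite lead_coef_eq0 -size_poly_gt0 ltnW.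
have d0 : (0 < d)%N by rewrite /d; case: (size f) sf => [|[]].
have aS : (`|a| <= S)%N by apply: coef_le_sumsq.
have aU : (`|a| <= U)%N by rewrite (leq_trans aS) // leq_pmull.
have SL : (S < 2 ^ L)%N by apply: trunc_log_ltn.
have L0 : (0 < L)%N by [].
clearbody L.
have SU : (S.+1 <= U.+1)%N by rewrite ltnS leq_pmull.
have U1 : (U.+1 <= 2 ^ L.+1)%N by rewrite expnS /U; move: SL; clear; lia.
have UL : (2 * U < 2 ^ L.+2)%N by rewrite expnS ltn_pmul2l.
have p1 := prime_gt1 pp; have p0 := prime_gt0 pp.
set v := logn p `|a|.
have p2 n : (2 ^ n <= p ^ n)%N.
  by case: n => // n; rewrite leq_exp2r.
have vL : (v < L)%N.
  rewrite -(ltn_exp2l (m := 2)) // (leq_ltn_trans (p2 v)) //.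
  apply: leq_ltn_trans SL; rewrite (leq_trans _ aS) //.
  by apply: dvdn_leq; rewrite ?absz_gt0 // pfactor_dvdn ?absz_gt0.
(* The least such k is the number of passes of the loop over the levels. As p >= 2 and 2U < 2^(L+2),
   minimality gives v + K <= L + 2. *)
have exK : exists k, (2 * U < p ^ (v + k))%N.
  exists L.+2; apply: leq_trans UL _; rewrite (leq_trans (p2 _)) //.
  by rewrite leq_pexp2l // leq_addl.
case: (ex_minnP exK) => K K_gt K_min.
have K_le k : (k < K)%N -> (p ^ (v + k) <= 2 * U)%N.
  by move=> kK; rewrite leqNgt; apply/negP => /K_min; rewrite leqNgt kK.
have vK : (v + K <= L.+2)%N.
  case: K K_le {K_gt K_min} => [|K] K_le; first by rewrite addn0 !leqW // ltnW.
  rewrite addnS -(ltn_exp2l (m := 2)) //.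
  by apply: leq_ltn_trans UL; apply: leq_trans (K_le _ (leqnn _)); apply: p2.
have KL : (K <= L.+2)%N by apply: leq_trans vK; rewrite leq_addl.
set H := operand_bound p d L.
have H2 e : (e <= L.+4 * (2 * d).+1)%N -> (2 ^ e <= H)%N.
  by apply: leq_operand_bound.
have dL : (d + L + 12 <= L.+4 * (2 * d).+1)%N by move: d0 L0; clear; nia.
have dH : (d < H)%N.
  apply: leq_trans (ltn_expl d (ltnSn 1)) (H2 _ _).
  by apply: leq_trans dL; rewrite -addnA leq_addr.
have UdH : (U.+1 ^ d * U.+1 ^ d.+1 <= H)%N.
  rewrite -expnD (@leq_trans ((2 ^ L.+1) ^ (d + d.+1))) ?leq_exp2r ?addnS //.
  by rewrite -expnM H2 // leq_mul //; clear; lia.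
have SdH : (S.+1 ^ d.+1 <= H)%N.
  apply: leq_trans UdH; apply: (@leq_trans (U.+1 ^ d.+1)).
    by rewrite leq_exp2r.
  by rewrite leq_pmull // expn_gt0.
have pUH : (4 * p * U <= H)%N.
  rewrite -mulnA mulnCA leq_mul2l; apply/orP; right.
  apply: (@leq_trans (2 ^ (L.+4))).
    by rewrite -[4%N]/(2 ^ 2)%N !expnS in U1 *; move: U1; clear; lia.
  by rewrite leq_pexp2l // leq_pmulr.
have sum_pow e e' n : (n <= 2 ^ e')%N -> (e + e' <= L.+4 * (2 * d).+1)%N ->
    (2 ^ e * n <= H)%N.
  move=> ne ee; apply: leq_trans (H2 _ ee); rewrite expnD.
  by rewrite leq_mul2l ne orbT.
have dexp : (d <= 2 ^ d)%N by apply: ltnW; apply: ltn_expl.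
have Lexp : (L < 2 ^ L)%N by apply: ltn_expl.
have dvH : (d * (v + K).+2 <= H)%N.
  apply: leq_trans (@sum_pow d L.+3 (v + K).+2 _ _).
  - by rewrite leq_mul2r dexp orbT.
  - by rewrite !expnS; move: Lexp vK; clear; lia.
  - by apply: leq_trans dL; clear; lia.
have tokH : (1 + d * (8 * K + 14) <= H)%N.
  apply: (@leq_trans (2 ^ d * (8 * K + 15))).
    rewrite (_ : 8 * K + 15 = (8 * K + 14).+1)%N; last by clear; lia.
    rewrite mulnS.
    by apply: leq_add; rewrite ?expn_gt0 // leq_mul2r dexp orbT.
  apply: (@sum_pow d L.+4.+2).
    by rewrite !expnS; move: Lexp KL; clear; lia.
  by apply: leq_trans dL; clear; lia.
apply: runs_leq (total_cost_le d0 (ltnW vL) KL) _.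
apply: runs_then; first exact: (runs_setup p sf SdH dH).
move=> s1 [[s1N s1d s1p s1a s1U] cl1].
apply: runs_then.
  apply: (@runs_roots H U L.+2 d l) => //.
  by move=> i id; rewrite cl1 // gE.
move=> s2 [fr2 ar2 [ys ysl cl2]].
have ysU y : y \in ys -> (`|y| <= U)%N by rewrite (perm_mem ysl); apply: lU.
have sys : size ys = d by rewrite (perm_size ysl).
apply: runs_then.
  rewrite -sys; apply: (@runs_content H U p a ys) => //; rewrite ?sys //.
  - by apply: leq_trans dvH; rewrite leq_mul2l !ltnS leq_addr orbT.
  - by rewrite fr2.
  - by rewrite fr2.
  - by rewrite fr2.
move=> s3 [fr3 ar3 s3P s3E].
have s3d : var s3 vd = d by rewrite fr3 ?fr2.
apply: (@runs_then _ _ _ _ _ _ (fun s' => emitted (1 + d * (8 * K + 14)) s'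
    (igusa_expr (('X : {poly rat})%:F) p a ys v K))).
  rewrite -sys; apply: (@runs_terms H U p K a ys) => //; rewrite ?sys //.
  - by move=> i id; rewrite ar3 cl2.
  - by rewrite fr3 ?fr2.
  - by rewrite fr3 ?fr2.
  - by rewrite fr3 ?fr2.
move=> s4 em4; apply: runs_nil; exists ys, K; split=> //.
- by rewrite gE; apply: perm_big; rewrite perm_sym.
- move=> k y z Kk yys zys; rewrite dvdzE abszX absz_nat => dv.
  apply/eqP; rewrite -subr_eq0 -absz_eq0; apply: contraTT dv => yz.
  apply/negP => /dvdn_leq; rewrite lt0n => /(_ yz); apply/negP; rewrite -ltnNge.
  apply: leq_ltn_trans (_ : 2 * U < _)%N.
    by have := ysU y yys; have := ysU z zys; clear; lia.
  by apply: leq_trans K_gt _; rewrite leq_pexp2l // leq_add2l.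
- exact: emitted_output em4.
Qed.

(** * Means over the residues modulo powers of p *)

Lemma sum_periodic (V : nmodType) (A B : nat) (F : nat -> V) :
  (forall c, F (c + A)%N = F c) ->
  \sum_(0 <= c < A * B) F c = (\sum_(0 <= c < A) F c) *+ B.
Proof.
move=> FA; have FAB c k : F (c + A * k)%N = F c.
  by elim: k => [|k IHk]; rewrite ?muln0 ?addn0 // mulnSr addnA FA.
elim: B => [|B IHB]; first by rewrite muln0 big_geq.
rewrite mulnS addnC (big_cat_nat (n := A * B)) ?leq_addr //= IHB mulrSr.
congr (_ + _); rewrite -[X in \sum_(X <= _ < _) _]add0n big_addn addKn.
by apply: eq_big_nat => c _; rewrite FAB.
Qed.

Lemma count_linear_congruence (A : nat) (u y : int) :
  (0 < A)%N -> coprimez A u ->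
  (\sum_(0 <= c < A) (A%:Z %| (u * c%:Z - y)%R)%Z = 1)%N.
Proof.
move=> A0 Au; have Az : (A%:Z != 0) by rewrite eqz_nat -lt0n.
have [w wu] : exists w : int, (A%:Z %| u * w - 1)%Z.
  have [[r s] rs] := coprimezP A%:Z u Au; exists s.
  by rewrite -rs /= opprD addrCA [u * s]mulrC subrr addr0 rpredN dvdz_mull.
pose c0 := `|((w * y) %% A%:Z)%Z|%N.
have c0E : c0%:Z = ((w * y) %% A%:Z)%Z by rewrite gez0_abs // modz_ge0.
have c0A : (c0 < A)%N by rewrite -ltz_nat c0E ltz_pmod.
have c0P : (A%:Z %| u * c0%:Z - y)%Z.
  have e1 : (A%:Z %| w * y - c0%:Z)%Z.
    by rewrite c0E {1}(divz_eq (w * y) A%:Z) addrK dvdz_mull.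
  have -> : u * c0%:Z - y = (u * w - 1) * y - u * (w * y - c0%:Z) by ring.
  by apply: rpredB; [apply: dvdz_mulr|apply: dvdz_mull].
rewrite big_mkord (bigD1 (Ordinal c0A)) //= c0P big1 // => c cc0.
apply/eqP; rewrite eqb0; apply: contra cc0 => cP.
have : (A%:Z %| u * (c%:Z - c0%:Z))%Z.
  have -> : u * (c%:Z - c0%:Z) = (u * c%:Z - y) - (u * c0%:Z - y) by ring.
  by rewrite rpredB.
rewrite Gauss_dvdzr // => dc; rewrite -val_eqE /= -eqz_nat -subr_eq0 -absz_eq0.
apply: contraTT dc => dc; rewrite dvdzE absz_nat; apply/negP => /dvdn_leq.
rewrite lt0n => /(_ dc); apply/negP; rewrite -ltnNge.
by have := ltn_ord c; move: c0A; clear; lia.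
Qed.

Section LevelSums.

Variables (L : fieldType) (t : L) (p : nat) (a : int) (l : seq int).
Hypotheses (pp : prime p) (a0 : a != 0) (t0 : t != 0) (pL : p%:R != 0 :> L).
Let v := logn p `|a|.
Local Notation q n := (p%:Z ^+ n).
Local Notation w := (vweight p a l).

Let qE n : q n = (p ^ n)%N.
Proof. by rewrite -[in RHS]natz natrX natz. Qed.

Let qL n : (q n)%:~R != 0 :> L.
Proof. by rewrite rmorphXn /= expf_neq0. Qed.

Definition level_mean (n : nat) : L :=
  (\sum_(0 <= c < p ^ n) t ^ w n (a * c%:Z)) / (q n)%:~R.

(** Write a = p^v u. Unless p^v divides y there is no solution; otherwise division by p^v leaves a
    congruence modulo p^(n-v) with the invertible coefficient u. Its unique solution has p^v lifts
    modulo p^n. *)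
Lemma count_solutions (n : nat) (y : int) : (v <= n)%N ->
  (\sum_(0 <= c < p ^ n) (q n %| (a * c%:Z - y)%R)%Z =
   if (q v %| y)%Z then p ^ v else 0)%N.
Proof.
move=> vn; have qv0 : q v != 0 by rewrite expf_neq0 // eqz_nat -lt0n prime_gt0.
have qva : (q v %| a)%Z by rewrite dvdz_pexp.
have qvn : (q v %| q n)%Z by apply: dvdz_exp2l.
case: ifPn => [|nvy]; last first.
  rewrite big1 // => c _; apply/eqP; rewrite eqb0; apply: contra nvy => dv.
  have -> : y = a * c%:Z - (a * c%:Z - y) by rewrite opprB addrCA subrr addr0.
  by apply: rpredB; [apply: dvdz_mulr|apply: dvdz_trans dv].
move=> /dvdzP[y' yE]; have /dvdzP[u aE] := qva.
have pu : coprimez p u.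
  rewrite coprimezE absz_nat prime_coprime //.
  apply/negP => pu; have : (q v.+1 %| a)%Z.
    by rewrite aE exprS dvdz_mul // dvdzE absz_nat.
  by rewrite dvdz_pexp // ltnn.
rewrite -{1}(subnK vn) expnD.
rewrite (eq_bigr (fun c => nat_of_bool
    ((p ^ (n - v))%N%:Z %| u * c%:Z - y')%Z)); last first.
  move=> c _; rewrite yE aE mulrAC -mulrBl -{1}(subnK vn) exprD.
  by rewrite dvdz_mul2r // qE.
rewrite sum_periodic; last first.
  move=> c; congr nat_of_bool; rewrite PoszD mulrDr addrAC.
  by rewrite rpredDr // dvdz_mull.
rewrite count_linear_congruence ?expn_gt0 ?prime_gt0 //.
  exact: natn.
by rewrite -qE coprimezXl.
Qed.

Lemma exists_first_in_class (m : int) (x : int) :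
  has (fun y => (m %| x - y)%Z) l ->
  exists2 i, (i < size l)%N & (m %| x - l`_i)%Z && first_in_class m l i.
Proof.
move=> hx; set P := (fun y => _) in hx; exists (find P l); rewrite -?has_find //.
have := nth_find 0 hx; rewrite /P => xi; rewrite xi /=.
apply/hasPn => y /(nthP 0)[j]; rewrite size_take -has_find hx => jlt.
rewrite nth_take // => <-; apply: contraFN (before_find 0 jlt) => iy.
rewrite /P (_ : x - l`_j = (x - l`_(find P l)) + (l`_(find P l) - l`_j)).
  by rewrite rpredD.
by rewrite addrA subrK.
Qed.

Lemma first_in_class_inj (m : int) (x : int) i j :
  (i < size l)%N -> (j < size l)%N ->
  (m %| x - l`_i)%Z -> (m %| x - l`_j)%Z ->
  first_in_class m l i -> first_in_class m l j -> i = j.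
Proof.
move=> il jl xi xj.
have ij i' j' : (m %| x - l`_i')%Z -> (m %| x - l`_j')%Z -> (i' < size l)%N ->
    first_in_class m l j' -> ~~ (i' < j')%N.
  move=> xi' xj' il' /hasPn h; apply/negP => ij.
  have : l`_i' \in take j' l.
    by rewrite -(nth_take 0 ij) mem_nth // size_take; case: ifP.
  move=> /h /negP; apply.
  have -> : l`_j' - l`_i' = (x - l`_i') - (x - l`_j').
    by ring.
  by rewrite rpredB.
move=> fi fj; apply/eqP; rewrite eqn_leq.
by apply/andP; split; rewrite leqNgt; apply: ij.
Qed.

(** Since p^v divides a, all ac are 0 modulo p^v and have the same weight at level v. *)
Lemma level_mean_init : level_mean v = t ^ w v 0.
Proof.
rewrite /level_mean (eq_big_nat _ _ (F2 := fun=> t ^ w v 0)); last first.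
  move=> c _; congr (_ ^ _); apply: vweight_eq.
  by rewrite subr0 dvdz_mulr // dvdz_pexp.
have := qL v; rewrite sumr_const_nat subn0 -mulr_natr qE -pmulrn => h.
by rewrite mulfK.
Qed.

(** Both means are taken over the residues modulo p^(n+1), on which w_n is periodic; the change is
    then summed class by class and the elements of a class are counted. *)
Lemma level_mean_step n : (v <= n)%N ->
  level_mean n.+1 = level_mean n +
  \sum_(i < size l | (q v %| l`_i)%Z && first_in_class (q n.+1) l i)
     level_term t p a l v n l`_i.
Proof.
move=> vn; have vn1 : (v <= n.+1)%N by apply: leqW.
have pE : p%:R = p%:~R :> L by [].
have lift : level_mean n =
    (\sum_(0 <= c < p ^ n.+1) t ^ w n (a * c%:Z)) / (q n.+1)%:~R.
  rewrite expnSr sum_periodic; last first.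
    move=> c; congr (_ ^ _); apply: vweight_eq.
    by rewrite PoszD mulrDr addrC addKr dvdz_mull // qE.
  rewrite -mulr_natr exprSr rmorphM /= invfM mulrACA -pE.
  by rewrite -[p%:R^-1]/(p%:R^-1) divff ?mulr1.
apply/eqP; rewrite addrC -subr_eq lift -mulrBl -sumrB; apply/eqP.
(* If some root is congruent to ac, exactly one of them is the first in its class and gives the
   change. If none is, level n + 1 adds nothing to the weight, because n + 1 > v. *)
have termE (c : nat) : t ^ w n.+1 (a * c%:Z) - t ^ w n (a * c%:Z) =
    \sum_(i < size l | first_in_class (q n.+1) l i)
      (t ^ w n.+1 l`_i - t ^ w n l`_i) *+ (q n.+1 %| (a * c%:Z - l`_i)%R)%Z.
  have [|] := boolP (has (fun y => (q n.+1 %| a * c%:Z - y)%Z) l).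
    move=> /exists_first_in_class[i il /andP[ci fi]].
    rewrite (bigD1 (Ordinal il)) //= ci big1 ?addr0 => [|j /andP[fj ji]].
      congr (_ ^ _ - _ ^ _); apply: vweight_eq => //.
      by apply: dvdz_trans ci; apply: dvdz_exp2l.
    have [cj|//] := boolP (_ %| _)%Z; case/eqP: ji; apply/val_inj.
    exact: first_in_class_inj cj ci fj fi.
  move=> /hasPn hx; rewrite big1 => [|i _].
    rewrite vweightS dvdz_pexp // ltnNge vn addr0 /congr_count.
    by rewrite (eq_in_count (a2 := pred0)) ?count_pred0 ?addr0 ?subrr // => y /hx/negbTE.
  by rewrite (negbTE (hx _ (mem_nth 0 (ltn_ord i)))).
rewrite (eq_bigr _ (fun c _ => termE c)) exchange_big mulr_suml /=.
rewrite [RHS]big_mkcondl /= [RHS]big_mkcond [LHS]big_mkcond; apply: eq_bigr => i _.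
rewrite -/v; case: (first_in_class _ _ _) => //.
rewrite sumrMnr count_solutions //; case: ifP => _; last by rewrite mulr0n mul0r.
by rewrite /level_term -mulr_natl (qE v) -pmulrn mulrAC.
Qed.

Definition root_remainder (K i : nat) : L :=
  if first_in_class (q (v + K)) l i then tail_term t p a l v (v + K) l`_i else 0.

Hypothesis tail_neq0 : forall e : nat, p%:R - t ^ Posz e != 0.

(** Beyond level v + K the terms of a root form a geometric series with sum [tail_term], so after M
    terms the missing part is [tail_term] times the M-th power of the ratio. The identity is
    algebraic; convergence is considered only for complex t. *)
Lemma level_mean_expr (K M : nat) :
  (forall k y z, (K <= k)%N -> y \in l -> z \in l ->
     (q (v + k) %| y - z)%Z -> y = z) ->
  level_mean (v + (K + M)) = igusa_expr t p a l v K -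
    \sum_(i < size l | (q v %| l`_i)%Z) root_remainder K i *
      (t ^ Posz (congr_count (q (v + K)) l`_i l) / p%:R) ^+ M.
Proof.
move=> sep; pose lt k i := if first_in_class (q (v + k).+1) l i
  then level_term t p a l v (v + k) l`_i else 0.
have sumE N : level_mean (v + N) = t ^ w v 0 +
    \sum_(i < size l | (q v %| l`_i)%Z) \sum_(k < N) lt k i.
  elim: N => [|N IHN].
    by rewrite addn0 level_mean_init big1 ?addr0 // => i _; rewrite big_ord0.
  rewrite addnS level_mean_step ?leq_addr // IHN -addrA; congr (_ + _).
  rewrite big_mkcondr -big_split /=; apply: eq_bigr => i _.
  by rewrite big_ord_recr.
rewrite sumE /igusa_expr -addrA -sumrB; congr (_ + _); apply: eq_bigr => i _.
have yl : l`_i \in l by apply: mem_nth.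
rewrite big_split_ord /= /root_term -/(root_remainder K i) [in RHS]big_mkcond /=.
rewrite -addrA; congr (_ + _).
set y := l`_i in yl *; set e := congr_count (q (v + K)) y l.
have countE k : (K <= k)%N -> congr_count (q (v + k)) y l = e.
  move=> Kk; apply: eq_in_count => z zl; apply/idP/idP.
    by apply: dvdz_trans; apply: dvdz_exp2l; rewrite leq_add2l.
  by move/(sep K y z (leqnn K) yl zl) => <-; rewrite -/y subrr dvdz0.
have firstE k : (K <= k)%N -> first_in_class (q (v + k)) l i =
                              first_in_class (q (v + K)) l i.
  move=> Kk; congr (~~ _); apply: eq_in_has => z /mem_take zl; apply/idP/idP.
    by apply: dvdz_trans; apply: dvdz_exp2l; rewrite leq_add2l.
  by move/(sep K y z (leqnn K) yl zl) => <-; rewrite -/y subrr dvdz0.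
(* From level v + K on, the only roots congruent to y are its own repetitions, so each level adds
   the multiplicity e to the weight. *)
have wE m : w (v + K + m) y = w (v + K) y + e%:Z * m%:Z.
  elim: m => [|m IHm]; first by rewrite addn0 mulr0 addr0.
  have ge : (v + (K + m).+1 <= logn p `|a|)%N = false.
    by apply/negbTE; rewrite -ltnNge addnS ltnS leq_addr.
  rewrite addnS vweightS IHm dvdz_pexp // -(addnA v) -addnS.
  rewrite countE ?(leqW (leq_addr _ _)) // ge addr0 -addrA intS mulrDr mulr1.
  by rewrite [_ + e%:Z]addrC.
rewrite /root_remainder -/y -/e.
(* Each term has the form tail (1 - x) x^m with x = t^e / p, so the sum telescopes to tail (1 -
   x^M). *)
rewrite (eq_bigr (fun m : 'I_M => if first_in_class (q (v + K)) l i then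
   tail_term t p a l v (v + K) y * (1 - t ^ e%:Z / p%:R) *
     (t ^ e%:Z / p%:R) ^+ m else 0)).
  case: ifP => _; last by rewrite big1 // mul0r subr0.
  rewrite -mulr_sumr -mulrA -[1 - _]opprB mulNr.
  rewrite -[X in - X]subrX1 opprB mulrBr mulr1; congr (_ - _).
move=> m _; rewrite /lt -/y -addnS firstE; last first.
  by rewrite -addnS leq_addr.
case: ifP => // _.
have tE (n : nat) : t ^ w (v + K + n) y = t ^ w (v + K) y * (t ^ e%:Z) ^+ n.
  by rewrite wE expfzDr // exprnP exprz_exp.
rewrite /level_term /tail_term -/e addnA -addnS !tE addnS -addnS exprD.
rewrite (rmorphM _ (q (v + K)) (q m.+1)) exprS rmorphM /= !rmorphXn /=.
have := tail_neq0 e; have := pL; have := qL (v + K); rewrite rmorphXn /=.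
rewrite -[(p%:Z)%:~R]/(p%:R : L) [(t ^ e%:Z) ^+ m.+1]exprS expr_div_n.
move: (t ^ w _ _) (t ^ e%:Z) (p%:R : L) => Tw x P Q0 P0 D0; field.
by rewrite Q0 D0 P0 !expf_neq0.
Qed.

End LevelSums.

(** * Valuations of p-adic integers *)

Lemma modz_eq0 (m d : int) : ((m %% d)%Z == 0) = (d %| m)%Z.
Proof. exact/eqP/dvdz_mod0P. Qed.

Lemma modz_pow (u d : int) (m n : nat) : (m <= n)%N ->
  ((u %% d ^+ n)%Z %% d ^+ m)%Z = (u %% d ^+ m)%Z.
Proof.
move=> mn; rewrite [in RHS](divz_eq u (d ^+ n)) -[in X in _ * X](subnK mn).
by rewrite exprD mulrA modzMDl.
Qed.

Section PadicValuation.

Variables (p : nat) (p_pr : prime p).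
Local Notation Zp := (padic_int p_pr).
Local Notation q n := (p%:Z ^+ n).
Implicit Types x y z : Zp.

Lemma residue_add x y n : residue (x + y) n = ((residue x n + residue y n) %% q n)%Z.
Proof. by []. Qed.

Lemma residue_mul x y n : residue (x * y) n = ((residue x n * residue y n) %% q n)%Z.
Proof. by []. Qed.

Lemma residue_opp x n : residue (- x) n = ((- residue x n) %% q n)%Z.
Proof. by []. Qed.

Lemma residue_intr (c : int) n : residue (c%:~R : Zp) n = (c %% q n)%Z.
Proof.
have natE (k : nat) : residue (k%:R : Zp) n = (k%:Z %% q n)%Z.
  elim: k => [|k IHk]; first by rewrite /= mod0z.
  by rewrite -addn1 natrD residue_add IHk modzDm PoszD.
case: c => k; first exact: natE.
by rewrite NegzE mulrNz residue_opp -pmulrn natE modzNm.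
Qed.

Lemma residue_sub_eq0 x y n :
  (residue (x - y) n == 0) = (residue x n == residue y n).
Proof.
rewrite residue_add residue_opp modzDmr modz_eq0.
by rewrite -eqz_mod_dvd !residue_modz.
Qed.

Lemma residue_leq_eq0 x m n : (m <= n)%N -> residue x n = 0 -> residue x m = 0.
Proof. by move=> mn xn; rewrite -(residueP x mn) xn mod0z. Qed.

Lemma residue0 x : residue x 0 = 0.
Proof. by rewrite -(residue_modz x 0) expr0 modz1. Qed.

(** For x <> 0 the default value in [padic_int_val] is not reached. This form compares valuations
    level by level, as residues present them. *)
Lemma padic_int_valP x n : x != 0 -> (residue x n == 0) = (n <= padic_int_val x)%N.
Proof.
move=> x0; rewrite /padic_int_val; case: pselect => [xn|]; last first.
  have [[|m] xm] := padic_int_neq0 x0; first by rewrite residue0 in xm.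
  by case; exists m.
case: ex_minnP => v xv vmin; apply/eqP/idP => [xn0|nv].
  rewrite leqNgt; apply/negP => vn; move: xv.
  by rewrite (residue_leq_eq0 vn xn0).
case: n nv => [|n] nv; first exact: residue0.
by apply/eqP; rewrite -[_ == _]negbK; apply/negP => /vmin; rewrite leqNgt nv.
Qed.

Lemma residue_dvdz x m n : (m <= n)%N -> (q m %| residue x n)%Z = (residue x m == 0).
Proof. by move=> mn; rewrite -(residueP x mn) modz_eq0. Qed.

(** Modulo a high enough power of p, the residues of x and y are nonzero integers with the same
    valuations, so additivity comes from that of [logn]. *)
Lemma padic_int_valM x y : x != 0 -> y != 0 ->
  padic_int_val (x * y) = (padic_int_val x + padic_int_val y)%N.
Proof.
move=> x0 y0; have xy0 : x * y != 0 by rewrite mulf_neq0.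
set m := padic_int_val x; set n := padic_int_val y.
have lognE z N : z != 0 -> (padic_int_val z < N)%N ->
    residue z N != 0 /\ logn p `|residue z N| = padic_int_val z.
  move=> z0 zN; have rN : residue z N != 0 by rewrite padic_int_valP // -ltnNge.
  split=> //; have r0 : (0 < `|residue z N|)%N by rewrite absz_gt0.
  apply/eqP; rewrite eqn_leq; apply/andP; split.
    rewrite leqNgt -pfactor_dvdn // -[(p ^ _)%N]/(`|(p ^ _)%N|%N).
    rewrite -dvdzE -natz natrX natz residue_dvdz //.
    by rewrite padic_int_valP // ltnn.
  rewrite -pfactor_dvdn // -[(p ^ _)%N]/(`|(p ^ _)%N|%N).
  by rewrite -dvdzE -natz natrX natz residue_dvdz ?padic_int_valP // ltnW.
set N := (m + n).+1.
have mN : (m < N)%N by rewrite ltnS leq_addr.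
have nN : (n < N)%N by rewrite ltnS leq_addl.
have [rx lx] := lognE x N x0 mN; have [ry ly] := lognE y N y0 nN.
have vE k : (k <= N)%N -> (residue (x * y) k == 0) = (k <= m + n)%N.
  move=> kN; rewrite -(residueP (x * y) kN) residue_mul.
  rewrite modz_pow // modz_eq0 dvdzE abszX absz_nat abszM pfactor_dvdn //.
    by rewrite lognM ?absz_gt0 // lx ly.
  by rewrite muln_gt0 !absz_gt0 rx ry.
apply/eqP; rewrite eqn_leq; apply/andP; split.
  rewrite leqNgt -padic_int_valP // vE ?ltnn //.
by rewrite -padic_int_valP // vE // leqnSn.
Qed.

(** The representative of x/1 is some pair (n, d) with x d = n; additivity of the valuation gives
    v(n) - v(d) = v(x). *)
Lemma padic_val_tofrac x : x != 0 -> padic_val (x%:F : padic p_pr) = padic_int_val x.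
Proof.
move=> x0; rewrite /padic_val.
set r := repr _; have d0 : r.2 != 0 := denom_ratioP r.
have E : x * r.2 = r.1.
  have := FracField.equivf_r (Ratio x 1).
  rewrite !numden_Ratio ?oner_neq0 // mul1r => E.
  have rE : r = repr (\pi_(FracField.type (padic_int p_pr))%qT (Ratio x 1)).
    by rewrite /r /FracField.tofrac; unlock.
  by rewrite rE.
have n0 : r.1 != 0 by rewrite -E mulf_neq0.
by rewrite -E padic_int_valM // PoszD addrK.
Qed.

End PadicValuation.

(** * Haar measure and integration of residues *)

Lemma tofrac_inj (R : idomainType) : injective (@FracField.tofrac R).
Proof. by move=> x y /eqP; rewrite tofrac_eq => /eqP. Qed.

Section HaarMeasure.

Local Open Scope classical_set_scope.

Variables (p : nat) (p_pr : prime p) (R : realType).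
Variable mu : {measure set padic_borel p_pr -> \bar R}.
Hypothesis mu_haar : normalized_haar mu.
Local Notation Zp := (padic_int p_pr).
Local Notation Qp := (padic p_pr).
Local Notation q n := (p%:Z ^+ n).

(** For 0 <= c < p^n this is the coset c + p^n Z_p. *)
Definition residue_class (n : nat) (c : int) : set (padic_borel p_pr) :=
  [set x | exists2 z : Zp, x = z%:F :> Qp & residue z n = c].

Lemma measurable_residue_class n c : measurable (residue_class n c).
Proof.
apply: sub_sigma_algebra => x [z -> zc]; exists n => w.
exists (z + p%:R ^+ n * w); first by rewrite tofracD tofracM tofracXn rmorph_nat.
rewrite residue_add residue_mul -natrX -[(p ^ n)%:R]/((p ^ n)%N%:~R) residue_intr.
have -> : Posz (p ^ n)%N = q n by rewrite -[LHS]natz natrX natz.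
by rewrite modzz mul0r mod0z addr0 residue_modz.
Qed.

Lemma residue_class0 : residue_class 0 0 = padic_integers p_pr.
Proof.
apply/seteqP; split=> [x [z -> _]|x [z _ <-]]; first by exists z.
by exists z => //; apply: residue0.
Qed.

Lemma measurable_padic_integers :
  measurable (padic_integers p_pr : set (padic_borel p_pr)).
Proof. by rewrite -residue_class0; apply: measurable_residue_class. Qed.

Lemma trivIset_residue_class n : trivIset setT (fun c : nat => residue_class n c%:Z).
Proof.
move=> c c' _ _ [x [[z -> zc] [z' /tofrac_inj zz' zc']]].
by move: zc; rewrite zz' zc' => /eqP; rewrite eqz_nat => /eqP.
Qed.

Lemma bigsetU_residue_class n :
  \big[setU/set0]_(c < p ^ n) residue_class n c%:Z = padic_integers p_pr.
Proof.
rewrite -(bigcup_mkord _ (fun c : nat => residue_class n c%:Z)).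
apply/seteqP; split=> [x [c _ [z -> _]]|x [z _ <-]].
  by exists z.
have rz := residue_modz z n; have q0 : (0 < q n)%R.
  by rewrite exprn_gt0 // ltz_nat prime_gt0.
have r0 : (0 <= residue z n)%R by rewrite -rz modz_ge0 // lt0r_neq0.
have rq : (residue z n < q n)%R by rewrite -rz ltz_pmod.
exists `|residue z n|%N => /=; last by exists z; rewrite ?gez0_abs.
rewrite -ltz_nat gez0_abs // (lt_le_trans rq) //.
by rewrite -[X in (_ <= X)%R]natz natrX natz.
Qed.

Lemma measure_residue_class_shift n (c : nat) : (c < p ^ n)%N ->
  mu (residue_class n c%:Z) = mu (residue_class n 0).
Proof.
move=> cq; have [mu_shift _] := mu_haar.
rewrite -(mu_shift (c%:R)%:F _ (measurable_residue_class n 0)); congr (mu _).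
have cE : residue (c%:R : Zp) n = c%:Z.
  rewrite -[c%:R]/(c%:~R) residue_intr.
  have -> : q n = Posz (p ^ n)%N by rewrite -[RHS]natz natrX natz.
  by rewrite modz_small // lez_nat ltz_nat.
apply/seteqP; split=> [x [z -> zc]|x [y [z -> zc] <-]].
  exists ((z - c%:R)%:F) => /=; last by rewrite -tofracD subrK.
  exists (z - c%:R) => //.
  by apply/eqP; rewrite residue_sub_eq0 zc cE.
exists (z + c%:R); first by rewrite tofracD.
by rewrite residue_add zc add0r cE -cE residue_modz.
Qed.

(** The p^n classes partition Z_p and are translates of each other. *)
Lemma measure_residue_class n (c : nat) : (c < p ^ n)%N ->
  mu (residue_class n c%:Z) = ((p%:R ^+ n)^-1)%:E.
Proof.
move=> cq; rewrite measure_residue_class_shift //.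
have [_ mu1] := mu_haar.
have : mu (\big[setU/set0]_(c < p ^ n) residue_class n c%:Z) = 1%E.
  by rewrite bigsetU_residue_class.
rewrite (@measure_bigsetU _ _ _ mu (fun c : nat => residue_class n c%:Z)
  (fun=> measurable_residue_class n _) (@trivIset_residue_class n)).
rewrite (eq_bigr (fun=> mu (residue_class n 0))); last first.
  by move=> i _; apply: measure_residue_class_shift.
(* Finiteness of the common measure lets the equation p^n m = 1 be solved in the reals. *)
have fin0 : mu (residue_class n 0) \is a fin_num.
  rewrite ge0_fin_numE //; apply: le_lt_trans (ltry 1); rewrite -mu1.
  rewrite -residue_class0; apply: le_measure; rewrite ?inE.
  - exact: measurable_residue_class.
  - exact: measurable_residue_class.
  - by move=> x [z -> _]; exists z => //; apply: residue0.
rewrite -(fineK fin0) sumEFin sumr_const card_ord => -[e].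
congr EFin; have pn : (p%:R ^+ n : R)%R != 0%R.
  by rewrite expf_neq0 // pnatr_eq0 -lt0n prime_gt0.
by apply: (mulfI pn); rewrite divff // -natrX mulr_natl.
Qed.

End HaarMeasure.

Arguments residue_class {p} p_pr n c _.

Section ResidueIntegral.

Local Open Scope classical_set_scope.

Variables (p : nat) (p_pr : prime p) (R : realType).
Variable mu : {measure set padic_borel p_pr -> \bar R}.
Hypothesis mu_haar : normalized_haar mu.
Local Notation Zp := (padic_int p_pr).
Local Notation Qp := (padic p_pr).
Local Notation D := (padic_integers p_pr : set (padic_borel p_pr)).

(** [xget] extends the residue to all of Q_p, with the value of the default 0 outside Z_p. *)
Definition padic_residue (n : nat) (x : padic_borel p_pr) : int :=
  residue (xget 0 [set z : Zp | z%:F = x :> Qp]) n.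

Lemma padic_residue_tofrac n (z : Zp) : padic_residue n (z%:F : Qp) = residue z n.
Proof.
have := @xgetPex _ 0 [set w : Zp | w%:F = z%:F :> Qp] (ex_intro _ z erefl).
by rewrite /padic_residue /= => /tofrac_inj ->.
Qed.

Lemma padic_residue_class n c x : residue_class p_pr n c x -> padic_residue n x = c.
Proof. by case=> z -> <-; apply: padic_residue_tofrac. Qed.

Lemma measurable_padic_residue n (phi : int -> \bar R) :
  measurable_fun D (fun x => phi (padic_residue n x)).
Proof.
(* The classes with c >= p^n are empty, so the finite partition can be written as a countable
   union. *)
have -> : D = \bigcup_(c : nat) residue_class p_pr n c%:Z.
  rewrite -(bigsetU_residue_class p_pr n).
  rewrite -(bigcup_mkord _ (fun c : nat => residue_class p_pr n c%:Z)).
  apply/seteqP; split=> [x [c _ xc]|x [c _ [z -> zc]]]; first by exists c.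
  exists c; last by exists z.
  rewrite /= -ltz_nat -zc -(residue_modz z n).
  have -> : Posz (p ^ n)%N = p%:Z ^+ n by rewrite -[LHS]natz natrX natz.
  by rewrite ltz_pmod // exprn_gt0 // ltz_nat prime_gt0.
apply/measurable_fun_bigcup => [c|c]; first exact: measurable_residue_class.
apply: (eq_measurable_fun (cst (phi c%:Z))); last exact: measurable_cst.
by move=> x; rewrite inE => /padic_residue_class ->.
Qed.

Lemma integral_padic_residue n (phi : int -> R) :
  (\int[mu]_(x in D) (phi (padic_residue n x))%:E =
   (\sum_(0 <= c < p ^ n) phi c%:Z / p%:R ^+ n)%R%:E)%E.
Proof.
rewrite -(bigsetU_residue_class p_pr n).
rewrite -(big_mkord xpredT (fun c : nat => residue_class p_pr n c%:Z)).
rewrite integral_bigsetU_EFin.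
- rewrite -sumEFin; apply: eq_big_nat => c /andP[_ cq].
  rewrite (eq_integral (cst (phi c%:Z)%:E)); last first.
    by move=> x; rewrite inE => /padic_residue_class ->.
  rewrite integral_cst; last exact: measurable_residue_class.
  by rewrite (measure_residue_class mu_haar).
- by move=> c; apply: measurable_residue_class.
- exact: iota_uniq.
- by apply: sub_trivIset (@trivIset_residue_class _ p_pr n).
- rewrite big_mkord bigsetU_residue_class.
  exact: (measurable_padic_residue n (fun c => (phi c)%:E)).
Qed.

(** Measurability of [f] is obtained from the limit: the approximations are constant on residue
    classes. A constant dominates them, and it is integrable because Z_p has measure 1. *)
Lemma Rintegral_residue_limit (phi : nat -> int -> R) (f : padic_borel p_pr -> R)
    (B l : R) :
  (forall n (z : Zp), `|phi n (residue z n)| <= B)%R ->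
  (forall z : Zp, phi n (residue z n) @[n --> \oo] --> f (z%:F : Qp)) ->
  (\sum_(0 <= c < p ^ n) phi n c%:Z / p%:R ^+ n)%R @[n --> \oo] --> l ->
  Rintegral mu D f = l.
Proof.
move=> phiB phif Il.
have mD : measurable D by apply: measurable_padic_integers.
have muD : mu D = 1%E by case: mu_haar.
pose f_ n x := (phi n (padic_residue n x))%:E.
have f_f x : D x -> f_ ^~ x @ \oo --> (f x)%:E.
  case=> z _ <-; apply: cvg_EFin; first by apply: nearW.
  rewrite (_ : _ \o _ = (fun n => phi n (residue z n))) //.
  by apply/funext => n /=; rewrite padic_residue_tofrac.
have mf_ n : measurable_fun D (f_ n).
  exact: (measurable_padic_residue n (fun c => (phi n c)%:E)).
have [] := @dominated_convergence _ _ _ mu D mD f_ (EFin \o f) (cst B%:E) mf_.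
- exact: emeasurable_fun_cvg f_f.
- by apply: aeW => x; apply: f_f.
- apply/integrableP; split; first exact: measurable_cst.
  by rewrite /= integral_cst // muD mule1 ltry.
- apply: aeW => x n [z _ <-].
  by rewrite /f_ padic_residue_tofrac /= lee_fin phiB.
move=> _ _; rewrite (_ : [sequence _]_n = EFin \o
    (fun n => \sum_(0 <= c < p ^ n) phi n c%:Z / p%:R ^+ n)%R); last first.
  by apply/funext => n /=; rewrite integral_padic_residue.
move=> int_l; rewrite /Rintegral (_ : (\int[mu]_(x in D) (f x)%:E)%E = l%:E) //.
apply: (cvg_unique _ int_l) => //.
by apply: cvg_EFin Il; apply: nearW.
Qed.

End ResidueIntegral.

(** * Valuation of a value of f *)

Section WeightLimit.

Variables (p : nat) (p_pr : prime p) (f : {poly int}) (l : seq int).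
Hypotheses (sf : (1 < size f)%N) (fl : monic_scale f = roots_poly l).
Hypothesis sl : size l = (size f).-1.
Local Notation Zp := (padic_int p_pr).
Local Notation a := (lead_coef f).
Let v := logn p `|a|.
Local Notation q n := (p%:Z ^+ n).
Local Notation w := (vweight p a l).

(** Only the levels up to v lose, at most d - 1 each. The case k = 0 is the uniform bound for
    dominated convergence, the case k = 1 the growth at the zeros of f. *)
Lemma weight_lower_bound (k n : nat) (y : int) :
  (forall m, (0 < m <= n)%N -> (k <= congr_count (q m) y l)%N) ->
  (k * n)%N%:Z - ((size f).-2 * v)%N%:Z <= w n y.
Proof.
have a0 : a != 0 by rewrite lead_coef_eq0 -size_poly_gt0 ltnW.
have dE : (size f).-1 = (size f).-2.+1 by case: (size f) sf => [|[]].
(* The induction on n needs the loss up to level n only, hence [minn n v]. *)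
move=> kc; apply: (@le_trans _ _ ((k * n)%N%:Z - ((size f).-2 * minn n v)%N%:Z)).
  by rewrite lerB // lez_nat leq_mul2l geq_minr orbT.
elim: n kc => [|n IHn] kc; first by rewrite vweight0 min0n !muln0.
rewrite vweightS dvdz_pexp // -/v sl dE.
have := kc n.+1 ltac:(by rewrite ltnS leqnn).
have := IHn (fun m mn => kc m ltac:(by case/andP: mn => -> /leqW)).
move: (congr_count _ _ _) (w _ _) => c x; rewrite mulnS.
have [nv|] := boolP (n < v)%N.
  rewrite (minn_idPl nv) (minn_idPl (ltnW nv)) mulnS.
  by move: (k * n)%N ((size f).-2 * n)%N (size f).-2; clear; lia.
rewrite -leqNgt => vn; rewrite (minn_idPr vn) (minn_idPr (leqW vn)).
by move: (k * n)%N ((size f).-2 * v)%N; clear; lia.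
Qed.

Lemma residue_linear (z : Zp) (y : int) n :
  residue (a%:~R * z - y%:~R) n = ((a * residue z n - y) %% q n)%Z.
Proof.
rewrite residue_add residue_opp residue_mul !residue_intr.
by rewrite modzMml modzDml modzDmr -modzDmr modzNm modzDmr.
Qed.

Lemma congr_residue (z : Zp) (y : int) (m n : nat) : (m <= n)%N ->
  (q m %| a * residue z n - y)%Z = (residue (a%:~R * z - y%:~R) m == 0).
Proof.
by move=> mn; rewrite -(residue_dvdz _ mn) residue_linear -!modz_eq0 modz_pow.
Qed.

Lemma monic_scale_horner_padic (z : Zp) :
  (a%:~R) ^+ (size f).-2 * (map_poly intr f).[z] =
  \prod_(y <- l) (a%:~R * z - y%:~R).
Proof.
rewrite -monic_scale_horner // fl /roots_poly rmorph_prod horner_prod.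
apply: eq_bigr => y _.
by rewrite rmorphB /= map_polyX map_polyC /= hornerXsubC.
Qed.

(** Z_p is a domain, so some factor az - y of a^(d-1) f(z) vanishes, and this y is counted at every
    level. *)
Lemma weight_root (z : Zp) n : (map_poly intr f).[z] = 0 ->
  n%:Z - ((size f).-2 * v)%N%:Z <= w n (a * residue z n).
Proof.
move=> fz; rewrite -[n in n%:Z - _]mul1n; apply: weight_lower_bound => m /andP[_ mn].
have := monic_scale_horner_padic z; rewrite fz mulr0 => /esym/eqP.
rewrite prodf_seq_eq0 => /hasP[y yl /= /eqP azy].
rewrite -has_count; apply/hasP; exists y => //.
by rewrite congr_residue // azy /= mod0z.
Qed.

Lemma padic_int_val_intr (c : int) : c != 0 ->
  padic_int_val (c%:~R : Zp) = logn p `|c|.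
Proof.
move=> c0; have e n : (residue (c%:~R : Zp) n == 0) = (n <= logn p `|c|)%N.
  by rewrite residue_intr modz_eq0 dvdz_pexp.
have c0' : (c%:~R : Zp) != 0.
  apply/eqP => cz; have := e (logn p `|c|).+1.
  by rewrite cz /= mod0z eqxx ltnn.
apply/eqP; rewrite eqn_leq -e padic_int_valP // leqnn /=.
by rewrite -padic_int_valP // e.
Qed.

(** The weight is the sum over y of min(n, v(az - y)), minus (d - 1) min(n, v). Once n passes all
    these valuations, this is the valuation of prod (az - y) / a^(d-1) = f(z). *)
Lemma weight_nonroot (z : Zp) : (map_poly intr f).[z] != 0 ->
  exists N, forall n, (N <= n)%N ->
    w n (a * residue z n) = padic_int_val (map_poly intr f).[z].
Proof.
move=> fz; have a0 : a != 0 by rewrite lead_coef_eq0 -size_poly_gt0 ltnW.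
have dE : (size f).-1 = (size f).-2.+1 by case: (size f) sf => [|[]].
set h := (map_poly intr f).[z] in fz *.
pose u y : Zp := a%:~R * z - y%:~R.
have aZ : (a%:~R : Zp) != 0.
  apply/eqP => az; have : residue (a%:~R : Zp) v.+1 = 0 by rewrite az /= mod0z.
  by move/eqP; rewrite residue_intr modz_eq0 dvdz_pexp // ltnn.
have hE := monic_scale_horner_padic z; rewrite -/h in hE.
have u0 y : y \in l -> u y != 0.
  move=> yl; apply: contraNneq fz => uy.
  have : (a%:~R : Zp) ^+ (size f).-2 * h == 0.
    by rewrite hE prodf_seq_eq0; apply/hasP; exists y; rewrite //= -/(u y) uy.
  by rewrite mulf_eq0 expf_eq0 (negbTE aZ) andbF.
have vprod s : {subset s <= l} ->
    padic_int_val (\prod_(y <- s) u y) = (\sum_(y <- s) padic_int_val (u y))%N.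
  elim: s => [|y s IHs] sub.
    by rewrite !big_nil -[1]/(1%:~R) padic_int_val_intr // logn1.
  have sub' : {subset s <= l} by move=> x xs; apply: sub; rewrite inE xs orbT.
  rewrite !big_cons padic_int_valM ?IHs //; first by apply/u0/sub/mem_head.
  by rewrite prodf_seq_neq0; apply/allP => x /sub' /u0.
have vpow k : padic_int_val ((a%:~R : Zp) ^+ k) = (k * v)%N.
  elim: k => [|k IHk].
    by rewrite expr0 -[1]/(1%:~R) padic_int_val_intr // logn1.
  by rewrite exprS padic_int_valM ?expf_neq0 // IHk padic_int_val_intr // mulSn.
have vE : ((size f).-2 * v + padic_int_val h = \sum_(y <- l) padic_int_val (u y))%N.
  by rewrite -vprod // -[RHS]/(padic_int_val (\prod_(y <- l) u y)) -hE
    padic_int_valM ?vpow ?expf_neq0.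
(* The sum is a crude common bound for the valuations in it. *)
exists (maxn v (\sum_(y <- l) padic_int_val (u y))) => n.
rewrite geq_max => /andP[vn un].
have wE k : (k <= n)%N -> w k (a * residue z n) =
    (\sum_(y <- l) minn k (padic_int_val (u y)))%N%:Z
      - ((size f).-2 * minn k v)%N%:Z.
  elim: k => [|k IHk] kn.
    rewrite vweight0 min0n muln0 big1 // => y _; exact: min0n.
  rewrite vweightS IHk ?(ltnW kn) // dvdz_pexp // -/v sl dE.
  have -> : (\sum_(y <- l) minn k.+1 (padic_int_val (u y)) =
      \sum_(y <- l) minn k (padic_int_val (u y)) +
      congr_count (q k.+1) (a * residue z n) l)%N.
    rewrite /congr_count -sum1_count [X in (_ + X)%N]big_mkcond -big_split /=.
    rewrite big_seq [RHS]big_seq; apply: eq_bigr => y yl.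
    rewrite congr_residue // -/(u y) padic_int_valP ?u0 //.
    by move: (padic_int_val _) => c; clear; case: ifP; lia.
  move: (congr_count _ _ _) (\sum_(y <- l) _)%N => c S.
  have [kv|] := boolP (k < v)%N.
    rewrite (minn_idPl kv) (minn_idPl (ltnW kv)) mulnS.
    by move: ((size f).-2 * k)%N (size f).-2; clear; lia.
  rewrite -leqNgt => vk; rewrite (minn_idPr vk) (minn_idPr (leqW vk)).
  by move: ((size f).-2 * v)%N; clear; lia.
rewrite wE // (minn_idPr vn).
have -> : (\sum_(y <- l) minn n (padic_int_val (u y)) =
           \sum_(y <- l) padic_int_val (u y))%N.
  apply: eq_big_seq => y yl; apply/minn_idPr; apply: leq_trans un.
  by rewrite (big_rem y) //= leq_addr.
by rewrite -vE PoszD addrC addKr.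
Qed.

Lemma horner_tofrac (z : Zp) :
  (map_poly intr f).[z%:F : padic p_pr] = ((map_poly intr f).[z])%:F.
Proof.
rewrite -horner_map -map_poly_comp; congr (_.[_]).
by apply: eq_map_poly => c /=; rewrite rmorph_int.
Qed.

End WeightLimit.

(** * Complex powers and evaluation of rational functions *)

Section ComplexPowers.

Variable R : realType.
Local Open Scope classical_set_scope.
Local Open Scope complex_scope.
Import Normc.
Implicit Types (x y : R[i]).

Lemma normc_ge0 x : 0 <= normc x.
Proof. by case: x => a b; apply: sqrtr_ge0. Qed.

Lemma normcX x n : normc (x ^+ n) = normc x ^+ n.
Proof.
by elim: n => [|n IHn]; rewrite ?expr0 ?normc1 // !exprS normcM IHn.
Qed.

Lemma normcXz x (k : int) : normc (x ^ k) = normc x ^ k.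
Proof.
by case: k => n; rewrite ?NegzE -?exprnN -?exprnP ?normcV normcX.
Qed.

Lemma normc_neq0 x : x != 0 -> normc x != 0.
Proof. by apply: contra => /eqP/eq0_normc ->. Qed.

Lemma normc_real (r : R) : 0 <= r -> normc r%:C = r.
Proof. by move=> r0; rewrite /normc /= expr0n addr0 sqrtr_sqr ger0_norm. Qed.

Lemma le_Re_normc x : `|complex.Re x| <= normc x.
Proof.
case: x => a b /=; rewrite -(@ler_pXn2r _ 2) ?nnegrE ?sqrtr_ge0 //.
by rewrite sqr_sqrtr ?addr_ge0 ?sqr_ge0 // real_normK ?num_real // lerDl sqr_ge0.
Qed.

Lemma le_Im_normc x : `|complex.Im x| <= normc x.
Proof.
case: x => a b /=; rewrite -(@ler_pXn2r _ 2) ?nnegrE ?sqrtr_ge0 //.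
by rewrite sqr_sqrtr ?addr_ge0 ?sqr_ge0 // real_normK ?num_real // lerDr sqr_ge0.
Qed.

Definition cexp (u v : R) : R[i] := (expR u)%:C * (cos v +i* sin v).

Lemma cexp0 : cexp 0 0 = 1.
Proof. by rewrite /cexp expR0 cos0 sin0 mul1r. Qed.

Lemma cexpD u u' v v' : cexp (u + u') (v + v') = cexp u v * cexp u' v'.
Proof.
rewrite /cexp expRD cosD sinD rmorphM mulrACA; congr (_ * _).
by simpc; congr (_ +i* _); rewrite addrC.
Qed.

Lemma cexpMn u v n : cexp (u *+ n) (v *+ n) = cexp u v ^+ n.
Proof.
elim: n => [|n IHn]; first by rewrite !mulr0n cexp0.
by rewrite !mulrS cexpD IHn exprS.
Qed.

Lemma normc_cexp u v : normc (cexp u v) = expR u.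
Proof.
rewrite /cexp normcM normc_real ?expR_ge0 //= cos2Dsin2 sqrtr1 mulr1 //.
Qed.

Lemma cpowE (a : R) (s : R[i]) : a != 0 ->
  cpow a s = cexp (complex.Re s * ln a) (complex.Im s * ln a).
Proof. by move=> /negbTE a0; rewrite /cpow a0. Qed.

Lemma cpow_padic (p k : nat) (s : R[i]) : (0 < p)%N ->
  cpow ((p%:R : R) ^ (- k%:Z)) s = cpow p%:R (- s) ^+ k.
Proof.
move=> p0; have pR : 0 < p%:R :> R by rewrite ltr0n.
rewrite -exprnN !cpowE ?invr_eq0 ?expf_neq0 ?lt0r_neq0 //.
rewrite -cexpMn lnV ?posrE ?exprn_gt0 // lnXn //.
by case: s => u v /=; congr cexp; rewrite mulrN -mulrnAr mulNr.
Qed.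

Lemma normc_cpow_lt1 (p : nat) (s : R[i]) : (1 < p)%N -> 0 < complex.Re s ->
  normc (cpow p%:R (- s)) < 1.
Proof.
move=> p1; case: s => u v /= u0; have pR : 1 < p%:R :> R by rewrite ltr1n.
rewrite cpowE ?normc_cexp ?expR_lt1 /=; last by rewrite pnatr_eq0 -lt0n ltnW.
by rewrite mulNr oppr_lt0 mulr_gt0 // ln_gt0.
Qed.

Lemma cpow_neq0 (p : nat) (s : R[i]) : (0 < p)%N -> cpow p%:R s != 0.
Proof.
move=> p0; have pR : p%:R != 0 :> R by rewrite pnatr_eq0 -lt0n.
apply/eqP => /(congr1 (@normc R)); rewrite cpowE // normc_cexp normc0 => /eqP.
by rewrite gt_eqF // expR_gt0.
Qed.

Lemma cvg0_geometric_bound (u : nat -> R) (C r : R) : 0 <= r < 1 ->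
  (forall n, `|u n| <= C * r ^+ n) -> u n @[n --> \oo] --> 0.
Proof.
move=> /andP[r0 r1] ub; have geo b : geometric b r @ \oo --> (0 : R).
  by apply: cvg_geometric; rewrite ger0_norm.
apply: (@squeeze_cvgr _ _ _ _ (geometric (- C) r) (geometric C r)) => //.
apply: nearW => n; rewrite /geometric /= mulNr -ler_norml; exact: ub.
Qed.

End ComplexPowers.

(** * Evaluation of rational functions *)

Section RationalEvaluation.

Variables (R : realType) (z : R[i]).
Implicit Types F G : {fraction {poly rat}}.
Local Notation ev P := ((map_poly (ratr : rat -> R[i]) P).[z]).

Let evM (P Q : {poly rat}) : ev (P * Q) = ev P * ev Q.
Proof. by rewrite rmorphM hornerM. Qed.

Let evD (P Q : {poly rat}) : ev (P + Q) = ev P + ev Q.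
Proof. by rewrite rmorphD hornerD. Qed.

Let frM (P Q : {poly rat}) : (P * Q)%:F = P%:F * Q%:F.
Proof. exact: tofracM. Qed.

Let frD (P Q : {poly rat}) : (P + Q)%:F = P%:F + Q%:F.
Proof. exact: tofracD. Qed.

Lemma ratfun_eval_poly (P : {poly rat}) : ratfun_eval P%:F z (ev P).
Proof.
by exists P, 1; rewrite tofrac1 rmorph1 hornerC !divr1 oner_neq0.
Qed.

Lemma ratfun_evalD F G w w' : ratfun_eval F z w -> ratfun_eval G z w' ->
  ratfun_eval (F + G) z (w + w').
Proof.
move=> [n [d [-> d0 ->]]] [n' [d' [-> d'0 ->]]].
have D0 : d%:F != 0 by rewrite tofrac_eq0; apply: contraNneq d0 => ->; rewrite rmorph0 horner0.
have D'0 : d'%:F != 0 by rewrite tofrac_eq0; apply: contraNneq d'0 => ->; rewrite rmorph0 horner0.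
exists (n * d' + n' * d), (d * d'); split.
- by rewrite (addf_div n%:F n'%:F D0 D'0) frD (frM n d') (frM n' d) (frM d d').
- by rewrite evM mulf_neq0.
- by rewrite evD !evM; apply: addf_div.
Qed.

Lemma ratfun_evalM F G w w' : ratfun_eval F z w -> ratfun_eval G z w' ->
  ratfun_eval (F * G) z (w * w').
Proof.
move=> [n [d [-> d0 ->]]] [n' [d' [-> d'0 ->]]].
exists (n * n'), (d * d'); split.
- by rewrite (mulf_div n%:F d%:F n'%:F d'%:F) (frM n n') (frM d d').
- by rewrite evM mulf_neq0.
- by rewrite !evM; apply: mulf_div.
Qed.

Lemma ratfun_evalN F w : ratfun_eval F z w -> ratfun_eval (- F) z (- w).
Proof.
move=> [n [d [-> d0 ->]]]; exists (- n), d.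
by split; rewrite ?rmorphN ?hornerN ?mulNr.
Qed.

Lemma ratfun_evalB F G w w' : ratfun_eval F z w -> ratfun_eval G z w' ->
  ratfun_eval (F - G) z (w - w').
Proof. by move=> Fw Gw; apply/ratfun_evalD/ratfun_evalN. Qed.

(** A nonzero value forces the numerator to be nonzero at z, so it may serve as the new
    denominator. *)
Lemma ratfun_evalV F w : w != 0 -> ratfun_eval F z w -> ratfun_eval F^-1 z w^-1.
Proof.
move=> w0 [n [d [-> d0 wE]]]; exists d, n; rewrite invf_div wE invf_div.
by split=> //; apply: contraNneq w0 => n0; rewrite wE n0 mul0r.
Qed.

Lemma ratfun_eval_div F G w w' : w' != 0 -> ratfun_eval F z w ->
  ratfun_eval G z w' -> ratfun_eval (F / G) z (w / w').
Proof. by move=> w0 Fw Gw; apply/ratfun_evalM/ratfun_evalV. Qed.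

Lemma ratfun_eval_int (c : int) : ratfun_eval c%:~R z c%:~R.
Proof.
have := ratfun_eval_poly c%:~R; rewrite !rmorph_int.
by rewrite -[in X in ratfun_eval _ _ X](rmorph_int (@polyC R[i])) hornerC.
Qed.

Lemma ratfun_eval_sum (I : Type) (r : seq I) (P : pred I)
    (F : I -> {fraction {poly rat}}) (w : I -> R[i]) :
  (forall i, P i -> ratfun_eval (F i) z (w i)) ->
  ratfun_eval (\sum_(i <- r | P i) F i) z (\sum_(i <- r | P i) w i).
Proof.
move=> Fw; elim/big_ind2: _ => //; first exact: (ratfun_eval_int 0).
by move=> *; apply: ratfun_evalD.
Qed.

Hypothesis z0 : z != 0.
Local Notation T := (('X : {poly rat})%:F).

Lemma ratfun_eval_Xz (k : int) : ratfun_eval (T ^ k) z (z ^ k).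
Proof.
have Xn n : ratfun_eval (T ^+ n) z (z ^+ n).
  have := ratfun_eval_poly 'X^n; rewrite tofracXn.
  by rewrite map_polyXn hornerXn.
case: k => n; first exact: Xn.
by rewrite NegzE -!exprnN; apply: ratfun_evalV; rewrite ?expf_neq0.
Qed.

(** Evaluation commutes with the field operations as long as no denominator vanishes at z, and both
    sides are the same expression in two fields. *)
Lemma ratfun_eval_igusa_expr (p : nat) (a : int) (l : seq int) (v K : nat) :
  (0 < p)%N -> (forall e : nat, p%:R - z ^ Posz e != 0) ->
  ratfun_eval (igusa_expr T p a l v K) z (igusa_expr z p a l v K).
Proof.
move=> p0 tail0; have pz n : ((p%:Z ^+ n)%:~R : R[i]) != 0.
  by rewrite intr_eq0 expf_neq0 // eqz_nat -lt0n.
apply: ratfun_evalD; first exact: ratfun_eval_Xz.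
apply: ratfun_eval_sum => i _; apply: ratfun_evalD.
  apply: ratfun_eval_sum => k _; apply: ratfun_evalM.
    by apply: ratfun_eval_div => //; apply: ratfun_eval_int.
  by apply: ratfun_evalB; apply: ratfun_eval_Xz.
case: ifP => _; last exact: (ratfun_eval_int 0).
apply: ratfun_eval_div => //.
  apply: ratfun_evalM.
    apply: ratfun_evalM; last exact: ratfun_eval_Xz.
    by apply: ratfun_eval_div => //; apply: ratfun_eval_int.
  by apply: ratfun_evalB; [apply: ratfun_eval_Xz|apply: (ratfun_eval_int 1)].
by apply: ratfun_evalB; [apply: (ratfun_eval_int p)|apply: ratfun_eval_Xz].
Qed.

End RationalEvaluation.

(** * The value of the zeta function *)

Section ZetaValue.

Local Open Scope classical_set_scope.
Local Open Scope complex_scope.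
Import Normc.

Variables (R : realType) (p : nat) (p_pr : prime p) (f : {poly int}).
Variables (l : seq int) (K : nat).
Variable mu : {measure set padic_borel p_pr -> \bar R}.
Hypothesis mu_haar : normalized_haar mu.
Hypotheses (sf : (1 < size f)%N) (fl : monic_scale f = roots_poly l).
Hypothesis sl : size l = (size f).-1.
Local Notation Zp := (padic_int p_pr).
Local Notation Qp := (padic p_pr).
Local Notation a := (lead_coef f).
Local Notation v := (logn p `|a|).
Local Notation w := (vweight p a l).
Hypothesis sep : forall k y z, (K <= k)%N -> y \in l -> z \in l ->
  (p%:Z ^+ (v + k) %| y - z)%Z -> y = z.
Variable s : R[i].
Hypothesis s0 : 0 < complex.Re s.
Let t : R[i] := cpow p%:R (- s).
Let rho : R := normc t.

Let p1 : (1 < p)%N. Proof. exact: prime_gt1. Qed.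
Let a0 : a != 0. Proof. by rewrite lead_coef_eq0 -size_poly_gt0 ltnW. Qed.
Let t0 : t != 0. Proof. exact/cpow_neq0/ltnW. Qed.
Let rho_gt0 : 0 < rho.
Proof. by rewrite lt0r normc_neq0 // normc_ge0. Qed.
Let rho_lt1 : rho < 1. Proof. exact: normc_cpow_lt1. Qed.

(** The modulus of t^e is at most 1, and p > 1. *)
Lemma igusa_tail_neq0 (e : nat) : p%:R - t ^ Posz e != 0.
Proof.
rewrite subr_eq0; apply/eqP => /(congr1 (@normc R)) pt.
have : (1 : R) < normc (p%:R : R[i]).
  by rewrite -[p%:R](rmorph_nat (@real_complex R)) normc_real ?ler0n // ltr1n.
by rewrite pt -exprnP normcX ltNge exprn_ile1 // ltW.
Qed.

Let pC : (p%:R : R[i]) != 0.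
Proof. by rewrite pnatr_eq0 -lt0n ltnW. Qed.

Lemma normc_exp_le (m k : int) : m <= k -> normc (t ^ k) <= rho ^ m.
Proof.
move=> mk; rewrite normcXz -/rho -(subrK m k) expfzDr ?gt_eqF //.
apply: ler_piMl; first by rewrite exprz_ge0 // ltW.
have : 0 <= k - m by rewrite subr_ge0.
by case: (k - m) => // n _; apply: exprn_ile1; apply: ltW.
Qed.

(** [cintegral] integrates real and imaginary parts separately, so the limit is taken for a real
    linear [phi] with |phi x| <= |x|, which stands for either of them. *)
Section Projection.

Variable phi : R[i] -> R.
Hypothesis phiD : {morph phi : x y / x + y}.
Hypothesis phiZ : forall (r : R) x, phi (x * r%:C) = phi x * r.
Hypothesis phi_le : forall x, `|phi x| <= normc x.

Let phi0 : phi 0 = 0.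
Proof. by have := phiZ 0 0; rewrite mul0r mulr0. Qed.

Let phiN x : phi (- x) = - phi x.
Proof. by apply/eqP; rewrite -addr_eq0 -phiD addNr phi0. Qed.

Lemma phi_level_mean n : phi (level_mean t p a l n) =
  \sum_(0 <= c < p ^ n) phi (t ^ w n (a * c%:Z)) / p%:R ^+ n.
Proof.
have -> : (level_mean t p a l n) =
    \sum_(0 <= c < p ^ n) t ^ w n (a * c%:Z) * ((p%:R ^+ n)^-1 : R)%:C.
  rewrite /level_mean mulr_suml; apply: eq_bigr => c _; congr (_ * _).
  by rewrite fmorphV !rmorphXn /= rmorph_nat.
by rewrite (big_morph phi phiD phi0); apply: eq_bigr => c _; rewrite phiZ.
Qed.

(** By the exact remainder formula, the error M levels beyond v + K is a sum of constants times
    powers (t^e / p)^M, and |t^e| <= 1. *)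
Lemma phi_level_mean_limit :
  phi (level_mean t p a l n) @[n --> \oo] --> phi (igusa_expr t p a l v K).
Proof.
rewrite -(cvg_shiftn (v + K)).
apply/subr_cvg0.
pose r i := root_remainder t p a l K i.
pose x i := t ^ Posz (congr_count (p%:Z ^+ (v + K)) l`_i l) / (p%:R : R[i]).
pose C := \sum_(i < size l | (p%:Z ^+ v %| l`_i)%Z) normc (r i).
apply: (@cvg0_geometric_bound _ _ C (p%:R^-1)).
  by rewrite invr_ge0 ler0n /= invf_lt1 ?ltr1n // ltr0n ltnW.
move=> M /=; rewrite [(M + _)%N]addnC -addnA.
rewrite level_mean_expr //; last exact: igusa_tail_neq0.
rewrite phiD addrC addKr phiN normrN.
rewrite (big_morph phi phiD phi0) mulr_suml.
apply: le_trans (ler_norm_sum _ _ _) _; apply: ler_sum => i _.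
apply: le_trans (phi_le _) _; rewrite normcM normcX ler_wpM2l ?normc_ge0 //.
rewrite lerXn2r ?nnegrE ?normc_ge0 ?invr_ge0 //.
rewrite normcM normcV -[p%:R](rmorph_nat (@real_complex R)) normc_real ?ler0n //.
rewrite -exprnP normcX ler_piMl ?invr_ge0 ?ler0n //.
by rewrite exprn_ile1 ?normc_ge0 // ltW.
Qed.

Lemma Rintegral_zeta :
  Rintegral mu (padic_integers p_pr)
    (fun x : Qp => phi (cpow (padic_abs R (map_poly intr f).[x]) s)) =
  phi (igusa_expr t p a l v K).
Proof.
apply: (@Rintegral_residue_limit _ _ _ _ mu_haar
  (fun n c => phi (t ^ w n (a * c))) _ (rho ^ (- ((size f).-2 * v)%N%:Z))).
(* As rho < 1, the lower bound -(d-1) v of the weights gives the dominating constant. *)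
- move=> n z; apply: le_trans (phi_le _) _; apply: normc_exp_le.
  have := @weight_lower_bound p p_pr f l sf sl 0 n (a * residue z n) (fun _ _ => isT).
  by rewrite mul0n sub0r.
- move=> z; rewrite horner_tofrac.
  have [fz|fz] := eqVneq ((map_poly intr f).[z]) 0.
    (* At a zero of f the integrand is 0 by the convention of [cpow]; the weights grow at least like
       n, so the approximations tend to 0 as well. *)
    rewrite fz tofrac0 /padic_abs eqxx /cpow eqxx phi0.
    apply: (@cvg0_geometric_bound _ _ (rho ^ (- ((size f).-2 * v)%N%:Z)) rho).
      by rewrite ltW.
    move=> n; apply: le_trans (phi_le _) _.
    apply: le_trans (normc_exp_le (weight_root sf fl sl n fz)) _.
    by rewrite addrC expfzDr ?gt_eqF.
  (* Elsewhere the weight is eventually the valuation k of f(z), and |f(z)|^s = (p^-k)^s = t^k. *)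
  apply: cvg_near_cst; have [N wN] := weight_nonroot sf fl sl fz.
  exists N => // n /= Nn; rewrite wN // /padic_abs tofrac_eq0 (negbTE fz).
  rewrite (padic_val_tofrac fz) (cpow_padic _ _ (ltnW p1)) -/t.
  by rewrite exprnP.
- rewrite -(funext phi_level_mean); exact: phi_level_mean_limit.
Qed.

End Projection.

Lemma igusa_zetaE : igusa_zeta mu f s = igusa_expr t p a l v K.
Proof.
rewrite /igusa_zeta /cintegral.
rewrite (@Rintegral_zeta (@complex.Re R)); last exact: le_Re_normc.
rewrite (@Rintegral_zeta (@complex.Im R)); last exact: le_Im_normc.
- by case: (igusa_expr _ _ _ _ _ _).
- by case=> x y [x' y'].
- by move=> r [x y] /=; rewrite mulr0 add0r.
- by case=> x y [x' y'].
- by move=> r [x y] /=; rewrite mulr0 subr0.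
Qed.

Lemma ratfun_eval_zeta :
  ratfun_eval (igusa_expr (('X : {poly rat})%:F) p a l v K) t (igusa_zeta mu f s).
Proof.
rewrite igusa_zetaE; apply: ratfun_eval_igusa_expr => //; first exact: ltnW.
exact: igusa_tail_neq0.
Qed.

End ZetaValue.

(** * Real bounds *)

Section RealBounds.

Variable R : realType.

(** From exp(-1/2) >= 1 - 1/2. *)
Lemma half_le_ln2 : 2^-1 <= ln 2 :> R.
Proof.
rewrite -ler_expR lnK ?posrE ?ltr0n //.
have h : (2^-1 : R) <= expR (- 2^-1).
  by apply: le_trans (expR_ge1Dx _); lra.
by rewrite -[X in X <= _]invrK -[X in _ <= X]invrK lef_pV2 ?posrE ?invr_gt0
  ?expR_gt0 ?ltr0n // -expRN.
Qed.

Lemma trunc_log_le_ln (n : nat) : (0 < n)%N -> (trunc_log 2 n)%:R <= 2 * ln n%:R :> R.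
Proof.
move=> n0; have : (2 ^ trunc_log 2 n <= n)%N by apply: trunc_logP.
rewrite -(ler_nat R) natrX => le.
have : ln (2%:R ^+ trunc_log 2 n) <= ln n%:R :> R.
  by rewrite ler_ln ?posrE ?exprn_gt0 ?ltr0n.
rewrite lnXn ?ltr0n // -[_ *+ trunc_log 2 n]mulr_natl => le'.
have := le_trans (ler_wpM2l (ler0n R (trunc_log 2 n)) half_le_ln2) le'.
by lra.
Qed.

Lemma poly_norm_sumsq (f : {poly int}) : poly_norm R f = Num.sqrt (sumsq f)%:R.
Proof.
congr Num.sqrt; rewrite /sumsq /sumsq_from big_mkord natr_sum.
by apply: eq_bigr => i _; rewrite pmulrn absz_sqr rmorphM expr2.
Qed.

(** ||f||^2 is a positive integer. The factor 4 is 2 from binary to natural logarithms times 2 from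
    ||f||^2 to ||f||. *)
Lemma ln_poly_norm (f : {poly int}) : f != 0 ->
  0 <= ln (poly_norm R f) /\
  (trunc_log 2 (sumsq f))%:R <= 4 * ln (poly_norm R f).
Proof.
move=> f0; have S0 : (0 < sumsq f)%N.
  apply: leq_trans (coef_sumsq f (size f).-1).
  by rewrite expn_gt0 absz_gt0 -lead_coefE lead_coef_eq0 f0.
rewrite poly_norm_sumsq; set S : R := (sumsq f)%:R.
have S1 : 1 <= S by rewrite ler1n.
have lnS : ln S = ln (Num.sqrt S) *+ 2.
  by rewrite -lnXn ?sqr_sqrtr ?sqrtr_gt0 ?(le_trans _ S1) // (lt_le_trans _ S1).
have := ln_ge0 S1; have := trunc_log_le_ln S0; rewrite -/S lnS -[ln _ *+ 2]mulr_natl.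
by move=> h1 h2; split; lra.
Qed.

(** Only the excess of the binary logarithm over the exponent of 2 is compared with ln p, so the
    factor 2 falls on ln p alone. *)
Lemma bit_length_le (p d L : nat) (m : int) : (0 < p)%N ->
  (`|m| <= operand_bound p d L)%N ->
  (bit_length m)%:R <= 2 * ln p%:R + (L.+4 * (2 * d).+1)%N%:R + 1 :> R.
Proof.
move=> p0 mH; rewrite /bit_length -natr1 lerD2r.
have [->|m0] := posnP `|m|%N.
  by rewrite trunc_log0 addr_ge0 // mulr_ge0 // ln_ge0 // ler1n.
set k := trunc_log 2 _; set e := (_ * _)%N.
have : (2 ^ k <= p * 2 ^ e)%N by apply: leq_trans mH; apply: trunc_logP.
rewrite -(ler_nat R) natrM !natrX => le0.
have : ln (2%:R ^+ k) <= ln (p%:R * 2%:R ^+ e) :> R.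
  by rewrite ler_ln ?posrE ?mulr_gt0 ?exprn_gt0 ?ltr0n.
rewrite lnM ?posrE ?exprn_gt0 ?ltr0n // !lnXn ?ltr0n //.
rewrite -[ln 2 *+ k]mulr_natl -[ln 2 *+ e]mulr_natl => le.
have ln2 := half_le_ln2; have lnp : 0 <= ln p%:R :> R by rewrite ln_ge0 // ler1n.
have [ke|ek] := leP (k%:R : R) e%:R; first by lra.
have : (k%:R - e%:R) * (2^-1 : R) <= (k%:R - e%:R) * ln 2.
  by rewrite ler_wpM2l // subr_ge0 ltW.
by rewrite [X in _ <= X]mulrBl; lra.
Qed.

End RealBounds.

Theorem theorem7p1 :
  exists (A : program) (C : nat),
  forall (p : nat) (p_pr : prime p) (f : {poly int}),
    (1 < size f)%N ->
    splittingFieldFor 1%VS (map_poly intr f : {poly rat^o}) fullv ->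
    exists (t : trace) (s' : state) (F : {fraction {poly rat}}),
    [/\ exec A (input_state p f) t s',
        output s' = Some F,
        forall (R : realType) (mu : {measure set padic_borel p_pr -> \bar R}),
          normalized_haar mu ->
          forall s : R[i], 0 < complex.Re s ->
            ratfun_eval F (cpow p%:R (- s)) (igusa_zeta mu f s)
      & forall (R : realType) (alpha0 : rat) (r : nat) (alpha : 'I_r -> rat)
               (e : 'I_r -> nat) (c d : 'I_r -> 'I_r -> int),
          root_factorization f alpha0 alpha e ->
          is_difference_fraction alpha c d ->
          let df : R := (size f).-1%:R in
          let lf : R := (root_level p_pr alpha)%:~R in
          let B : R := (difference_bound c d)%:R in
          let normf : R := poly_norm R f in
          (size t)%:R <=
            C%:R * (df ^+ 6 + df ^+ 9 * ln normf + lf ^+ 2 * df ^+ 3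
                    + df ^+ 2 * ln (Num.max B p%:R)) /\
          forall m n : int, (m, n) \in t ->
            (maxn (bit_length m) (bit_length n))%:R <=
              C%:R * Num.max (ln p%:R)
                       (Num.max (ln (lf * df))
                         (Num.max (ln B) (df ^+ 3 + df ^+ 2 * ln normf)))].
Proof.
(* The constant is generous: 200 d^3 (4 log ||f|| + 5) <= 1000 d^6 + 800 d^9 log ||f||, and a bit
   length is at most 2 log p + 3d (4 log ||f|| + 5) + 1, at most 18 times the maximum. *)
exists igusa_prog, 2000%N => p p_pr f sf split_f.
have f0 : f != 0 by rewrite -size_poly_gt0 ltnW.
have p0 := prime_gt0 p_pr.
have [t [s' [ex st bt [l [K [fl sl sep out]]]]]] :=
  runs_igusa_prog p_pr sf split_f.
exists t, s'; eexists; split; [exact: ex|exact: out| |].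
  by move=> R mu haar s s0; apply: ratfun_eval_zeta.
move=> R alpha0 r alpha e c d _ _ df lf B normf.
have [lam0 ell] := ln_poly_norm R f0; rewrite -/normf in lam0 ell.
set lam := ln normf in lam0 ell *.
set L := (trunc_log 2 (sumsq f)).+1 in st bt.
have dn : (0 < (size f).-1)%N by case: (size f) sf => [|[]].
have df1 : 1 <= df by rewrite ler1n.
have df0 : 0 <= df by rewrite ler0n.
have dX (i j : nat) : (i <= j)%N -> df ^+ i <= df ^+ j.
  by move=> ij; rewrite ler_weXn2l.
have dXlam (i j : nat) : (i <= j)%N -> df ^+ i * lam <= df ^+ j * lam.
  by move=> ij; rewrite ler_wpM2r ?dX.
have lnp : 0 <= ln p%:R :> R by rewrite ln_ge0 // ler1n.
have L4 : (L.+4)%:R <= 4 * lam + 5.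
  by rewrite -[L.+4]/(5 + trunc_log 2 (sumsq f))%N natrD; lra.
split.
  have h1 : 0 <= lf ^+ 2 * df ^+ 3 by rewrite mulr_ge0 ?sqr_ge0 ?exprn_ge0.
  have h2 : 0 <= df ^+ 2 * ln (Num.max B p%:R).
    rewrite mulr_ge0 ?exprn_ge0 // ln_ge0 // le_max; apply/orP; right.
    by rewrite ler1n.
  have h3 : (time_bound (size f).-1 L)%:R <= 200 * (df ^+ 3 * (4 * lam + 5)) :> R.
    rewrite (natrM R 200) (natrM R ((size f).-1 ^ 3)) natrX.
    by rewrite ler_wpM2l // ler_wpM2l ?exprn_ge0.
  have h4 := dX 3 6 isT; have h5 := dXlam 3 9 isT.
  have h6 : (size t)%:R <= (time_bound (size f).-1 L)%:R :> R by rewrite ler_nat.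
  have h7 : 0 <= df ^+ 9 * lam by rewrite mulr_ge0 ?exprn_ge0.
  have h8 : 0 <= df ^+ 6 by rewrite exprn_ge0.
  by lra.
move=> m n /(allP bt) /= /andP[mB nB].
set M := Num.max (ln p%:R) _.
have M1 : ln p%:R <= M by rewrite le_max lexx.
have M2 : df ^+ 3 + df ^+ 2 * lam <= M by rewrite !le_max lexx !orbT.
have bnd x : (`|x| <= operand_bound p (size f).-1 L)%N ->
    (bit_length x)%:R <= 2000%:R * M.
  move=> xB; apply: le_trans (bit_length_le R p0 xB) _.
  have h1 : (L.+4 * (2 * (size f).-1).+1)%N%:R <= (4 * lam + 5) * (3 * df).
    rewrite natrM ler_pM // ?ler0n // -natr1 natrM -/df; lra.
  have h2 := dX 1%N 3 isT; have h3 := dXlam 1%N 2 isT; have h4 := dX 0%N 3 isT.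
  rewrite expr1 in h2 h3; rewrite expr0 in h4.
  have h5 : 0 <= df ^+ 2 * lam by rewrite mulr_ge0 ?exprn_ge0.
  by lra.
by case: (leqP (bit_length m) (bit_length n)) => _; apply: bnd.
Qed.
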